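(* For each $n\ge 2$ let $x_i=(i-1/2)/n$, $i=1,\dots,n$, and suppose $$Y_i=\frac{\beta(x_i)}{\sqrt n}+\epsilon_i,\qquad i=1,\dots,n,$$ where $\epsilon_1,\epsilon_2,\dots$ are independent and identically distributed with density $f$, and $\beta:[0,1]\to\mathbb R$ satisfies $\int_0^1\beta^2(x)\,dx>0$. Let $h$ be the density of $\epsilon_1-\epsilon_2$. Assume: (i) $h$ is Lipschitz continuous in a neighborhood of $0$; (ii) $\beta$ is Lipschitz continuous on $[0,1]$ except perhaps at finitely many points, at which it has simple (jump) discontinuities. Let $R(Y_i)$ be the rank of $Y_i$ among $Y_1,\dots,Y_n$, $U_i=R(Y_i)/(n+1)$, $$\hat\phi_j=\frac1n\sum_{i=1}^n U_i\cos(\pi jx_i),\quad j=1,\dots,n-1,\qquad R_n=\max_{1\le m<n}\frac1m\sum_{j=1}^m 24n\hat\phi_j^2 .$$ Let $G(t)=\exp\{-\sum_{j=1}^\infty P(\chi_j^2>jt)/j\}$ (with $\chi_j^2$ chi-squared with $j$ degrees of freedom), let $\alpha\in(0,1)$ and let $t_\alpha$ be the $1-\alpha$ quantile of $G$. Let $Z_1,Z_2,\dots$ be i.i.d. standard normal random variables, $\beta_j=\int_0^1\beta(x)\cos(\pi jx)\,dx$, and $$\mathcal T=\max_{m\ge1}\frac1m\sum_{j=1}^m\big(Z_j+\sqrt{24}\,h(0)\beta_j\big)^2 .$$ Then the power of the level-$\alpha$ rank-based order selection test, which rejects when $R_n\ge t_\alpha$, satisfies $$\lim_{n\to\infty}P(R_n\ge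 t_\alpha)=P(\mathcal T\ge t_\alpha).$$
   Context: The rank-based order selection (OS) test rejects the null hypothesis that the regression function is constant for large values of $R_n$; $G$ is the limiting null distribution of $R_n$. The model considered is a sequence of local alternatives $r_n(x)=\beta(x)/\sqrt n$ to the constant-regression null. *)

(* Defs.v *)
From HB Require Import structures.
From mathcomp Require Import all_boot all_order all_algebra.
From mathcomp Require Import all_classical all_reals all_analysis.
Set Implicit Arguments. Unset Strict Implicit. Unset Printing Implicit Defensive.
Import Order.TTheory GRing.Theory Num.Theory.
Import numFieldNormedType.Exports.
Local Open Scope classical_set_scope.
Local Open Scope ring_scope.

Section Defs.
Context {R : realType}.

Definition mutually_independent d (T : measurableType d) (P : probability T R)
  (X : nat -> T -> R) : Prop :=
  (forall j, measurable_fun setT (X j)) /\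
  forall (s : seq nat) (B : nat -> set R), uniq s ->
    (forall j, j \in s -> measurable (B j)) ->
    P (\big[setI/setT]_(j <- s) (X j @^-1` B j)) =
    (\prod_(j <- s) P (X j @^-1` B j))%E.

Definition has_density d (T : measurableType d) (P : probability T R)
  (X : T -> R) (f : R -> R) : Prop :=
  (forall x, 0 <= f x) /\ measurable_fun setT f /\
  forall A : set R, measurable A ->
    P (X @^-1` A) = (\int[lebesgue_measure]_(x in A) (f x)%:E)%E.

Definition lipschitz_near0 (h : R -> R) : Prop :=
  exists delta L : R, 0 < delta /\ forall x y, `|x| < delta -> `|y| < delta ->
    `|h x - h y| <= L * `|x - y|.

(* Lipschitz on [0,1] except at finitely many points s (at which only jump
   discontinuities can occur): one Lipschitz constant on every closed
   subinterval of [0,1] avoiding the exceptional points *)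
Definition piecewise_lipschitz01 (b : R -> R) : Prop :=
  exists (s : seq R) (L : R), forall x y, 0 <= x <= 1 -> 0 <= y <= 1 ->
    (forall a, a \in s -> ~ (Num.min x y <= a <= Num.max x y)) ->
    `|b x - b y| <= L * `|x - y|.

(* design point x_{i+1} = (i + 1/2)/n, i = 0..n-1 *)
Definition xpt (n i : nat) : R := (i%:R + 2^-1) / n%:R.

Definition Yobs T (b : R -> R) (eps : nat -> T -> R) (n : nat) (w : T) (i : nat) : R :=
  b (xpt n i) / Num.sqrt n%:R + eps i w.

Definition rankY T (b : R -> R) (eps : nat -> T -> R) (n : nat) (w : T) (i : nat) : R :=
  \sum_(k < n) (if Yobs b eps n w k <= Yobs b eps n w i then 1 else 0).

Definition phihat T (b : R -> R) (eps : nat -> T -> R) (n j : nat) (w : T) : R :=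
  n%:R^-1 * \sum_(i < n)
     (rankY b eps n w i / n.+1%:R) * cos (pi * j%:R * xpt n i).

Definition Rstat T (b : R -> R) (eps : nat -> T -> R) (n : nat) (w : T) : R :=
  \big[Num.max/0]_(1 <= m < n)
     (m%:R^-1 * \sum_(1 <= j < m.+1) (24 * n%:R * phihat b eps n j w ^+ 2)).

Definition beta_coef (b : R -> R) (j : nat) : R :=
  \int[lebesgue_measure]_(x in `[0, 1]) (b x * cos (pi * j%:R * x)).

(* P(chi^2_j > x), chi^2_j realised as Z_0^2 + ... + Z_{j-1}^2 *)
Definition chi2_tail d (T : measurableType d) (Q : probability T R)
  (Z : nat -> T -> R) (j : nat) (x : R) : \bar R :=
  Q [set w | x < \sum_(k < j) Z k w ^+ 2].

Definition Gfun d (T : measurableType d) (Q : probability T R)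
  (Z : nat -> T -> R) (t : R) : \bar R :=
  expeR (- (\sum_(1 <= j <oo) ((j%:R^-1)%:E * chi2_tail Q Z j (j%:R * t)))%E).

Definition quantileG d (T : measurableType d) (Q : probability T R)
  (Z : nat -> T -> R) (alpha : R) : R :=
  inf [set t | ((1 - alpha)%:E <= Gfun Q Z t)%E].

Definition Tlim T (Z : nat -> T -> R) (h0 : R) (b : R -> R) (w : T) : \bar R :=
  ereal_sup [set (m%:R^-1 * \sum_(1 <= j < m.+1)
                   (Z j w + Num.sqrt 24 * h0 * beta_coef b j) ^+ 2)%:E
            | m in [set m : nat | (0 < m)%N]].

End Defs.

(* Main.v *)
Require Import Defs.
From HB Require Import structures.
From mathcomp Require Import all_boot all_order all_algebra.
From mathcomp Require Import all_classical all_reals all_analysis.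
From mathcomp Require Import measurable_realfun ring lra.
Import Order.TTheory GRing.Theory Num.Theory.
Import numFieldNormedType.Exports.
Local Open Scope classical_set_scope.
Local Open Scope ring_scope.
Set Implicit Arguments. Unset Strict Implicit. Unset Printing Implicit Defensive.

(* Each indicator [Y_k <= Y_i] splits into F(eps_i) - F(eps_k) + 1/2, a
   deterministic shift h(0) (beta(x_i) - beta(x_k)) / sqrt n up to the square of
   that difference, a doubly degenerate kernel and a centred kernel of variance
   O(n^-1/2).  Since the cosines sum to zero over the design, sqrt(24 n) phihat_j
   is n / (n + 1) times the sum of a linear statistic W_j of the independent
   scores F(eps_i) - 1/2, a Riemann sum of sqrt 24 h(0) beta_j, and a remainder
   whose second moment is O(n^-1/2) uniformly in j; hence the averaged squares of
   the remainders are negligible uniformly in m.  For m bounded, (W_j) converges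
   to independent standard normals by characteristic functions.  For m large,
   the averages of W_j^2 and of Z_j^2 stay below any level exceeding 1, uniformly
   in n, by Chebyshev's inequality along the squares m = k^2; this suffices
   because t_alpha > 1.  Finally the limit has no atom at t_alpha, the averages
   of (Z_j + c_j)^2 having none. *)

(** * Real-valued expectation *)

(** The constant 24 is 12 times 2: F(eps_i) has variance 1/12, and the squared cosines sum to n/2
    over the design. Since m ranges up to n - 1, finite-dimensional convergence alone is not enough;
    each term needs a bound valid for all m at once. For the remainders, (1/m) sum_{j <= m} r_j^2 <=
    sum_{j < n} r_j^2 / j, whose mean is O(n^-1/2) times a harmonic sum. For the Riemann sums,
    Bessel's inequality bounds the total sum of squares, so averages over m terms are O(1/m)
    although convergence holds only for each fixed j. Square roots of the averages are seminorms, so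
    these bounds combine by the triangle inequality; the price is small displacements of the level
    sqrt t_alpha, absorbed by the absence of an atom. That t_alpha exceeds 1 comes from the harmonic
    series: P(chi_j^2 > j) stays bounded below, so the series in G becomes arbitrarily large as t
    decreases to 1. Weak convergence is derived directly from characteristic functions, by
    Bernstein's approximation of Lipschitz functions with trigonometric polynomials instead of a
    compactness argument. *)

Definition Ex d (T : measurableType d) (R : realType) (P : probability T R)
  (X : T -> R) : R := (\int[P]_w X w)%R.

Definition pr d (T : measurableType d) (R : realType) (P : probability T R)
  (A : set T) : R := fine (P A).

(** Bounded measurable functions form an algebra, so integrability of polynomials in indicators,
    scores and cosines follows from closure lemmas. [L1] is kept for the Gaussian variables and
    their powers, which are unbounded. *)
Definition bdm d (T : measurableType d) (R : realType) (X : T -> R) : Prop :=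
  measurable_fun setT X /\ exists B, forall w, `|X w| <= B.

Notation L1 P X := (integrable P setT (EFin \o X)).

Section expectation.
Context d (T : measurableType d) (R : realType) (P : probability T R).
Implicit Types (X Y : T -> R) (A B : set T).

Lemma bdm_cst (c : R) : bdm (fun _ : T => c).
Proof. by split; [exact: measurable_cst|exists `|c|]. Qed.

Lemma bdmD X Y : bdm X -> bdm Y -> bdm (fun w => X w + Y w).
Proof.
move=> [mX [a Xa]] [mY [b Yb]]; split; first exact: measurable_funD.
by exists (a + b) => w; rewrite (le_trans (ler_normD _ _))// lerD.
Qed.

Lemma bdmM X Y : bdm X -> bdm Y -> bdm (fun w => X w * Y w).
Proof.
move=> [mX [a Xa]] [mY [b Yb]]; split; first exact: measurable_funM.
by exists (a * b) => w; rewrite normrM ler_pM.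
Qed.

Lemma bdmZ (c : R) X : bdm X -> bdm (fun w => c * X w).
Proof. by move=> bX; apply: bdmM => //; exact: bdm_cst. Qed.

Lemma bdmN X : bdm X -> bdm (fun w => - X w).
Proof.
move=> [mX [a Xa]]; split; first exact: measurableT_comp.
by exists a => w; rewrite normrN.
Qed.

Lemma bdmB X Y : bdm X -> bdm Y -> bdm (fun w => X w - Y w).
Proof. by move=> bX bY; apply: bdmD => //; exact: bdmN. Qed.

Lemma bdmX X n : bdm X -> bdm (fun w => X w ^+ n).
Proof.
move=> bX; elim: n => [|n IH].
  by under eq_fun do rewrite expr0; exact: bdm_cst.
by under eq_fun do rewrite exprS; exact: bdmM.
Qed.

Lemma bdm_sum I (s : seq I) (p : pred I) (X : I -> T -> R) :
  (forall i, p i -> bdm (X i)) -> bdm (fun w => \sum_(i <- s | p i) X i w).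
Proof.
move=> bX; elim: s => [|i s IH].
  by under eq_fun do rewrite big_nil; exact: bdm_cst.
case pi : (p i).
  by under eq_fun do rewrite big_cons pi; apply: bdmD => //; exact: bX.
by under eq_fun do rewrite big_cons pi.
Qed.

Lemma bdm_cos X : measurable_fun setT X -> bdm (fun w => cos (X w)).
Proof.
move=> mX; split; last by exists 1 => w; rewrite ler_norml cos_geN1 cos_le1.
by apply: measurableT_comp => //; apply: continuous_measurable_fun; exact: continuous_cos.
Qed.

Lemma bdm_sin X : measurable_fun setT X -> bdm (fun w => sin (X w)).
Proof.
move=> mX; split; last by exists 1 => w; rewrite ler_norml sin_geN1 sin_le1.
by apply: measurableT_comp => //; apply: continuous_measurable_fun; exact: continuous_sin.
Qed.

Lemma bdm_bool (p : T -> bool) : measurable_fun setT p ->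
  bdm (fun w => (p w)%:R : R).
Proof.
move=> mp; split; last by exists 1 => w; case: (p w); rewrite ?normr0 ?normr1.
have -> : (fun w => (p w)%:R) = (fun w => if p w then 1 else 0) :> (T -> R).
  by apply/funext => w; case: (p w).
by apply: measurable_fun_ifT.
Qed.

Lemma bdm_le X Y : measurable_fun setT X -> measurable_fun setT Y ->
  bdm (fun w => (X w <= Y w)%R%:R : R).
Proof. by move=> mX mY; apply: bdm_bool; exact: measurable_fun_ler. Qed.

Lemma bdm_L1 X : bdm X -> L1 P X.
Proof.
move=> [mX [a Xa]]; apply: measurable_bounded_integrable => //.
  by rewrite /= probability_setT ltry.
exists a; split; first by rewrite num_real.
by move=> x ax w _ /=; apply: (le_trans (Xa w)); exact: ltW.
Qed.

Lemma L1_measurable X : L1 P X -> measurable_fun setT X.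
Proof. by move/integrableP => [/measurable_EFinP]. Qed.

Lemma L1D X Y : L1 P X -> L1 P Y -> L1 P (fun w => X w + Y w).
Proof. by move=> lX lY; exact: (integrableD measurableT lX lY). Qed.

Lemma L1B X Y : L1 P X -> L1 P Y -> L1 P (fun w => X w - Y w).
Proof. by move=> lX lY; exact: (integrableB measurableT lX lY). Qed.

Lemma L1Z (c : R) X : L1 P X -> L1 P (fun w => c * X w).
Proof. by move=> lX; exact: (integrableZl measurableT c lX). Qed.

Lemma L1_cst (c : R) : L1 P (fun _ => c).
Proof. exact: bdm_L1 (bdm_cst c). Qed.

Lemma L1_sum I (s : seq I) (p : pred I) (X : I -> T -> R) :
  (forall i, p i -> L1 P (X i)) -> L1 P (fun w => \sum_(i <- s | p i) X i w).
Proof.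
move=> lX; elim: s => [|i s IH].
  by under eq_fun do rewrite big_nil; exact: L1_cst.
case pi : (p i).
  by under eq_fun do rewrite big_cons pi; apply: L1D => //; exact: lX.
by under eq_fun do rewrite big_cons pi.
Qed.

Lemma L1_le X Y : measurable_fun setT X -> L1 P Y ->
  (forall w, `|X w| <= `|Y w|) -> L1 P X.
Proof.
move=> mX lY XY; apply: le_integrable lY => //; first exact/measurable_EFinP.
by move=> w _; rewrite /= lee_fin.
Qed.

Lemma L1_norm X : L1 P X -> L1 P (fun w => `|X w|).
Proof.
move=> lX; apply: (L1_le _ lX) => [|w]; last by rewrite normr_id.
by apply: measurableT_comp => //; exact: L1_measurable.
Qed.

Lemma ExD X Y : L1 P X -> L1 P Y ->
  Ex P (fun w => X w + Y w) = Ex P X + Ex P Y.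
Proof. by move=> lX lY; rewrite /Ex RintegralD. Qed.

Lemma ExB X Y : L1 P X -> L1 P Y ->
  Ex P (fun w => X w - Y w) = Ex P X - Ex P Y.
Proof. by move=> lX lY; rewrite /Ex RintegralB. Qed.

Lemma ExZ (c : R) X : L1 P X -> Ex P (fun w => c * X w) = c * Ex P X.
Proof. by move=> lX; rewrite /Ex RintegralZl. Qed.

Lemma Ex_cst (c : R) : Ex P (fun _ => c) = c.
Proof.
transitivity (c * fine (P setT)); first exact: Rintegral_cst.
by rewrite probability_setT/= mulr1.
Qed.

Lemma Ex_sum I (s : seq I) (p : pred I) (X : I -> T -> R) :
  (forall i, p i -> L1 P (X i)) ->
  Ex P (fun w => \sum_(i <- s | p i) X i w) = \sum_(i <- s | p i) Ex P (X i).
Proof.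
move=> lX; elim: s => [|i s IH].
  by rewrite big_nil -[RHS]Ex_cst; congr Ex; apply/funext => w; rewrite big_nil.
rewrite big_cons; case pi : (p i); last first.
  by rewrite -IH; congr Ex; apply/funext => w; rewrite big_cons pi.
rewrite -IH -ExD; [|exact: lX|exact: L1_sum].
by congr Ex; apply/funext => w; rewrite big_cons pi.
Qed.

Lemma le_Ex X Y : L1 P X -> L1 P Y -> (forall w, X w <= Y w) ->
  Ex P X <= Ex P Y.
Proof. by move=> lX lY XY; apply: le_Rintegral. Qed.

Lemma Ex_ge0 X : (forall w, 0 <= X w) -> 0 <= Ex P X.
Proof. by move=> X0; apply: Rintegral_ge0. Qed.

Lemma norm_Ex X : L1 P X -> `|Ex P X| <= Ex P (fun w => `|X w|).
Proof. exact: le_normr_Rintegral. Qed.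

Lemma norm_Ex_le X Y : L1 P X -> L1 P Y -> (forall w, `|X w| <= Y w) ->
  `|Ex P X| <= Ex P Y.
Proof.
move=> lX lY XY; apply: (le_trans (norm_Ex lX)).
by apply: le_Ex => //; exact: L1_norm.
Qed.

Lemma EFin_Ex X : L1 P X -> ((Ex P X)%:E = \int[P]_w (X w)%:E)%E.
Proof. by move=> lX; rewrite /Ex /Rintegral fineK//; exact: integrable_fin_num. Qed.

Lemma pr_ge0 A : 0 <= pr P A. Proof. exact: fine_ge0. Qed.

Lemma EFin_pr A : measurable A -> (pr P A)%:E = P A.
Proof. by move=> mA; rewrite /pr fineK// fin_num_measure. Qed.

Lemma le_pr A B : measurable A -> measurable B -> A `<=` B -> pr P A <= pr P B.
Proof. by move=> mA mB AB; rewrite -lee_fin !EFin_pr//; apply: le_measure; rewrite ?inE. Qed.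

Lemma pr_setU A B : measurable A -> measurable B ->
  pr P (A `|` B) <= pr P A + pr P B.
Proof.
move=> mA mB; rewrite -lee_fin EFinD !EFin_pr//; last exact: measurableU.
exact: measureU2.
Qed.

Lemma Ex_bool (p : T -> bool) : measurable_fun setT p ->
  Ex P (fun w => (p w)%:R : R) = pr P [set w | p w].
Proof.
move=> mp; rewrite /Ex /Rintegral /pr; congr fine.
have mA : measurable [set w | p w].
  by have := mp measurableT [set true] I; rewrite setTI.
transitivity (\int[P]_w (\1_[set w | p w] w)%:E)%E; last first.
  by rewrite integral_indic// setIT.
by apply: eq_integral => w _; rewrite indicE mem_setE.
Qed.

Lemma markov_pr X (c : R) : L1 P X -> (forall w, 0 <= X w) -> 0 < c ->
  pr P [set w | c <= X w] <= Ex P X / c.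
Proof.
move=> lX X0 c0; have mX := L1_measurable lX.
have mp : measurable_fun setT (fun w => c <= X w) by exact: measurable_fun_ler.
rewrite -(@Ex_bool (fun w => c <= X w))// ler_pdivlMr// mulrC -ExZ; last first.
  exact: bdm_L1 (bdm_bool mp).
apply: le_Ex => //; first exact: L1Z (bdm_L1 (bdm_bool mp)).
by move=> w; case: (boolP (c <= X w)) => [|_]; rewrite ?mulr1// mulr0.
Qed.

End expectation.

Lemma ge0_Ex_fin d (T : measurableType d) (R : realType) (P : probability T R)
    (X : T -> R) (a : R) : (forall w, 0 <= X w) ->
  ((\int[P]_w (X w)%:E) = a%:E)%E -> Ex P X = a.
Proof. by move=> X0 Xa; rewrite /Ex /Rintegral Xa. Qed.

(** * Independence *)

Section independent_pair.
Context d (T : measurableType d) (R : realType) (P : probability T R).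

(** The targets are arbitrary measurable spaces so that either variable can be a tuple of
    coordinates. *)
Definition indep d1 d2 (T1 : measurableType d1) (T2 : measurableType d2)
    (U : T -> T1) (V : T -> T2) : Prop :=
  [/\ measurable_fun setT U, measurable_fun setT V &
   forall A B, measurable A -> measurable B ->
     P (U @^-1` A `&` V @^-1` B) = (P (U @^-1` A) * P (V @^-1` B))%E].

(** The law of the pair agrees with the product of the two laws on rectangles, hence everywhere, and
    Tonelli applies. The inner integral is pulled back to [T], so that conditioning on [U] becomes
    an expectation over a second copy of the sample point. *)
Lemma ge0_integral_indep d1 d2 (T1 : measurableType d1) (T2 : measurableType d2)
    (U : T -> T1) (V : T -> T2) (Phi : T1 * T2 -> \bar R) :
  indep U V -> measurable_fun setT Phi -> (forall x, 0 <= Phi x)%E ->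
  (\int[P]_w Phi (U w, V w) = \int[P]_w \int[P]_w' Phi (U w, V w'))%E.
Proof.
move=> [mU mV UV] mPhi Phi0.
have mUV : measurable_fun setT (fun w => (U w, V w)) by exact: measurable_fun_pair.
pose pU : {mfun T >-> T1} := HB.pack U (isMeasurableFun.Build _ _ _ _ U mU).
pose pV : {mfun T >-> T2} := HB.pack V (isMeasurableFun.Build _ _ _ _ V mV).
pose pUV : {mfun T >-> (T1 * T2)%type} :=
  HB.pack (fun w => (U w, V w)) (isMeasurableFun.Build _ _ _ _ _ mUV).
pose m1 : probability T1 R := distribution P pU.
pose m2 : probability T2 R := distribution P pV.
pose m3 : probability _ R := distribution P pUV.
have m12 : forall X, measurable X -> (m1 \x m2)%E X = m3 X.
  by apply: product_measure_unique => A B mA mB; exact: UV.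
transitivity (\int[m3]_x Phi x)%E.
  by rewrite ge0_integral_distribution.
transitivity (\int[(m1 \x m2)%E]_x Phi x)%E.
  by apply: eq_measure_integral => A mA _; apply/esym; exact: m12.
rewrite fubini_tonelli1// ge0_integral_distribution//; last first.
- by move=> x; apply: integral_ge0.
- exact: measurable_fun_fubini_tonelli_F.
apply: eq_integral => w _; rewrite /= /fubini_F ge0_integral_distribution//.
exact: measurableT_comp.
Qed.


Lemma indep_comp d1 d2 d3 d4 (T1 : measurableType d1) (T2 : measurableType d2)
    (T3 : measurableType d3) (T4 : measurableType d4)
    (U : T -> T1) (V : T -> T2) (f : T1 -> T3) (g : T2 -> T4) :
  indep U V -> measurable_fun setT f -> measurable_fun setT g ->
  indep (f \o U) (g \o V).
Proof.
move=> [mU mV UV] mf mg; split; [exact: measurableT_comp|exact: measurableT_comp|].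
move=> A B mA mB; apply: (UV (f @^-1` A) (g @^-1` B)).
- by rewrite -[X in measurable X]setTI; apply: mf.
- by rewrite -[X in measurable X]setTI; apply: mg.
Qed.

Lemma bdm_partial d1 d2 (T1 : measurableType d1) (T2 : measurableType d2)
    (V : T -> T2) (Phi : T1 * T2 -> R) :
  measurable_fun setT V -> bdm Phi -> forall x, bdm (fun w => Phi (x, V w)).
Proof.
move=> mV [mPhi [B PhiB]] x; split; last by exists B.
by apply: (measurableT_comp mPhi); apply: measurable_fun_pair.
Qed.

Lemma bdm_Ex d1 d2 (T1 : measurableType d1) (T2 : measurableType d2)
    (V : T -> T2) (Phi : T1 * T2 -> R) :
  measurable_fun setT V -> bdm Phi -> bdm (fun x => Ex P (fun w => Phi (x, V w))).
Proof.
move=> mV bPhi; have bp := bdm_partial mV bPhi.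
have [mPhi [B PhiB]] := bPhi.
(* Adding the bound [B] makes the integrand nonnegative, as Tonelli's measurability statement
   requires; [B] is subtracted again at the end. *)
pose F (z : T1 * T) := (Phi (z.1, V z.2) + B)%:E.
have F0 z : (0 <= F z)%E.
  by rewrite lee_fin -lerBlDr sub0r; have := PhiB (z.1, V z.2); rewrite ler_norml => /andP[].
have mF : measurable_fun setT F.
  apply/measurable_EFinP; apply: measurable_funD => //.
  apply: (measurableT_comp mPhi); apply: measurable_fun_pair => //.
  exact: measurableT_comp.
have FE x : ((Ex P (fun w => Phi (x, V w)) + B)%:E = \int[P]_w F (x, w))%E.
  have lp := bdm_L1 P (bp x).
  by rewrite -{1}(Ex_cst P B) -ExD//; [rewrite EFin_Ex//; apply: L1D => //|];
     exact: L1_cst.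
split; last first.
  exists B => x; rewrite -[leRHS](Ex_cst P B); apply: norm_Ex_le => //.
    exact: bdm_L1.
  exact: L1_cst.
have -> : (fun x => Ex P (fun w => Phi (x, V w))) =
          (fun x => (Ex P (fun w => Phi (x, V w)) + B) - B).
  by apply/funext => x; rewrite addrK.
apply: measurable_funB => //; apply/measurable_EFinP.
rewrite (_ : EFin \o _ = fun x => \int[P]_w F (x, w))%E; last by apply/funext.
exact: (measurable_fun_fubini_tonelli_F F).
Qed.

Lemma Ex_indep d1 d2 (T1 : measurableType d1) (T2 : measurableType d2)
    (U : T -> T1) (V : T -> T2) (Phi : T1 * T2 -> R) :
  indep U V -> bdm Phi ->
  Ex P (fun w => Phi (U w, V w)) =
  Ex P (fun w => Ex P (fun w' => Phi (U w, V w'))).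
Proof.
move=> iUV bPhi; have [mU mV _] := iUV; have [mPhi [B PhiB]] := bPhi.
have bp := bdm_partial mV bPhi.
have bUV : bdm (fun w => Phi (U w, V w)).
  split; last by exists B.
  by apply: (measurableT_comp mPhi); apply: measurable_fun_pair.
have bE : bdm (fun w => Ex P (fun w' => Phi (U w, V w'))).
  have [mE [C EC]] := bdm_Ex mV bPhi; split; last by exists C.
  exact: (measurableT_comp mE mU).
apply: (addIr B); rewrite -{1 2}(Ex_cst P B) -!ExD//; try exact: L1_cst;
  try exact: bdm_L1.
apply: EFin_inj; rewrite !EFin_Ex; try (apply: L1D; [exact: bdm_L1|exact: L1_cst]).
have F0 z : (0 <= (Phi z + B)%:E)%E.
  by rewrite lee_fin -lerBlDr sub0r; have := PhiB z; rewrite ler_norml => /andP[].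
rewrite (ge0_integral_indep (Phi := fun z => (Phi z + B)%:E) iUV)//; last first.
  by apply/measurable_EFinP; apply: measurable_funD.
apply: eq_integral => w _.
rewrite -{2}(Ex_cst P B) -ExD; [|exact: bdm_L1|exact: L1_cst].
by rewrite EFin_Ex//; apply: L1D; [exact: bdm_L1|exact: L1_cst].
Qed.

Lemma ge0_indep_ExM (U V : T -> R) : indep U V -> (forall w, 0 <= U w) ->
  (forall w, 0 <= V w) -> L1 P U -> L1 P V ->
  L1 P (fun w => U w * V w) /\ Ex P (fun w => U w * V w) = Ex P U * Ex P V.
Proof.
move=> iUV U0 V0 lU lV; have [mU mV _] := iUV.
have H : (\int[P]_w (U w * V w)%:E = (Ex P U * Ex P V)%:E)%E.
  pose Phi (z : R * R) := (`|z.1 * z.2|)%:E.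
  have mPhi : measurable_fun setT Phi.
    apply/measurable_EFinP; apply: measurableT_comp => //.
    exact: measurable_funM.
  transitivity (\int[P]_w Phi (U w, V w))%E.
    by apply: eq_integral => w _; rewrite /Phi ger0_norm//= mulr_ge0.
  rewrite (ge0_integral_indep iUV)//; last by move=> z; rewrite lee_fin.
  transitivity (\int[P]_w (Ex P V * U w)%:E)%E.
    apply: eq_integral => w _; rewrite mulrC -ExZ// EFin_Ex; last exact: L1Z.
    by apply: eq_integral => w' _; rewrite /Phi ger0_norm//= mulr_ge0.
  by rewrite -EFin_Ex; [rewrite ExZ// mulrC|exact: L1Z].
split; last by apply: ge0_Ex_fin H => w; rewrite mulr_ge0.
apply/integrableP; split; first by apply/measurable_EFinP; exact: measurable_funM.
rewrite [ltLHS](_ : _ = (Ex P U * Ex P V)%:E) ?ltry// -H.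
by apply: eq_integral => w _; rewrite /= ger0_norm// mulr_ge0.
Qed.

(** Positive and negative parts give four products of nonnegative independent factors, each covered
    by the Tonelli argument. This form admits unbounded factors, such as powers of Gaussian
    variables. *)
Lemma indep_ExM (U V : T -> R) : indep U V -> L1 P U -> L1 P V ->
  L1 P (fun w => U w * V w) /\ Ex P (fun w => U w * V w) = Ex P U * Ex P V.
Proof.
move=> iUV lU lV.
pose p (x : R) := Num.max x 0; pose m (x : R) := Num.max (- x) 0.
have pmE x : x = p x - m x.
  rewrite /p /m; case: (leP x 0) => x0; case: (leP (- x) 0) => x1; lra.
have p0 x : 0 <= p x by rewrite le_max lexx orbT.
have m0 x : 0 <= m x by rewrite le_max lexx orbT.
have mp : measurable_fun setT p by apply: measurable_maxr.
have mm : measurable_fun setT m by apply: measurable_maxr.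
have lp X : L1 P X -> L1 P (p \o X).
  move=> lX; apply: (L1_le _ lX) => [|w]; first by apply: measurableT_comp => //; exact: L1_measurable lX.
  by rewrite /= /p; case: (leP (X w) 0); rewrite ?normr0.
have lm X : L1 P X -> L1 P (m \o X).
  move=> lX; apply: (L1_le _ lX) => [|w]; first by apply: measurableT_comp => //; exact: L1_measurable lX.
  by rewrite /= /m; case: (leP (- X w) 0); rewrite ?normr0// normrN.
have [l1 e1] := ge0_indep_ExM (indep_comp iUV mp mp) (fun w => p0 _) (fun w => p0 _) (lp _ lU) (lp _ lV).
have [l2 e2] := ge0_indep_ExM (indep_comp iUV mp mm) (fun w => p0 _) (fun w => m0 _) (lp _ lU) (lm _ lV).
have [l3 e3] := ge0_indep_ExM (indep_comp iUV mm mp) (fun w => m0 _) (fun w => p0 _) (lm _ lU) (lp _ lV).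
have [l4 e4] := ge0_indep_ExM (indep_comp iUV mm mm) (fun w => m0 _) (fun w => m0 _) (lm _ lU) (lm _ lV).
have UVE : (fun w => U w * V w) = (fun w => ((p \o U) w * (p \o V) w - (p \o U) w * (m \o V) w)
    - ((m \o U) w * (p \o V) w - (m \o U) w * (m \o V) w)).
  by apply/funext => w /=; rewrite {1}[U w]pmE {1}[V w]pmE; ring.
split; first by rewrite UVE; apply: L1B; apply: L1B.
have UE : Ex P U = Ex P (p \o U) - Ex P (m \o U).
  rewrite -ExB; [|exact: lp|exact: lm].
  by congr Ex; apply/funext => w; exact: pmE.
have VE : Ex P V = Ex P (p \o V) - Ex P (m \o V).
  rewrite -ExB; [|exact: lp|exact: lm].
  by congr Ex; apply/funext => w; exact: pmE.
rewrite UVE !ExB ?e1 ?e2 ?e3 ?e4 ?UE ?VE; try (by apply: L1B); try by [].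
ring.
Qed.

End independent_pair.

(** * Sigma-algebras generated by blocks of coordinates *)

Section sub_sigma.
Context d (T : measurableType d) (R : realType) (P : probability T R).
Variable X : nat -> T -> R.
Hypothesis iX : mutually_independent P X.

(** The pi-system of finite-dimensional events on the coordinates in [A], on which joint
    independence can be read off directly. *)
Definition cylinders (A : pred nat) : set (set T) :=
  [set E | exists s (B : nat -> set R), [/\ uniq s, all A s,
     (forall j, measurable (B j)) & E = [set w | forall j, j \in s -> B j (X j w)]]].

(** A second measurable structure on the same sample space. Measurability from [subsig A] expresses
    dependence on the coordinates in [A] only, which reduces independence of blocks to
    measurability. *)
Definition subsig (A : pred nat) := g_sigma_algebraType (cylinders A).

Lemma cylE (s : seq nat) (B : nat -> set R) :
  [set w | forall j, j \in s -> B j (X j w)] =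
  \big[setI/setT]_(j <- s) X j @^-1` B j.
Proof. by rewrite -bigcap_seq. Qed.

Lemma measurable_cyl A : cylinders A `<=` measurable.
Proof.
move=> E [s [B [us As mB ->]]]; rewrite cylE.
elim: s {us As} => [|i s IH]; first by rewrite big_nil.
rewrite big_cons; apply: measurableI => //.
by rewrite -[X in measurable X]setTI; apply: (iX.1 i).
Qed.

Lemma cyl_setI A : setI_closed (cylinders A).
Proof.
move=> E F [s [B [us As mB ->]]] [t [C [ut At mC ->]]].
exists (undup (s ++ t)).
exists (fun j => (if j \in s then B j else setT) `&` (if j \in t then C j else setT)).
split.
- exact: undup_uniq.
- by apply/allP => j; rewrite mem_undup mem_cat => /orP[]; apply/allP.
- by move=> j; apply: measurableI; case: ifP.
- apply/seteqP; split=> [w [/= h1 h2] j|w /= h].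
    move=> _; split; case: ifPn => // js; [exact: h1|exact: h2].
  by split=> j js; have := h j; rewrite mem_undup mem_cat js ?orbT => -[].
Qed.

Lemma cyl_setT A : cylinders A setT.
Proof. by exists [::], (fun=> setT); split => //; apply/seteqP; split. Qed.

Lemma cyl_indep (A1 A2 : pred nat) : (forall j, A1 j -> A2 j -> False) ->
  forall E F, cylinders A1 E -> cylinders A2 F -> P (E `&` F) = (P E * P F)%E.
Proof.
move=> A12 E F [s [B [us As mB ->]]] [t [C [ut At mC ->]]].
rewrite !cylE !iX.2//.
have dst j : j \in s -> j \in t -> False.
  by move=> js jt; apply: (A12 j); [exact: (allP As)|exact: (allP At)].
(* The index lists are disjoint, so one family of sets serves both cylinders and joint independence
   applies to the concatenated list. *)
pose D j := if j \in s then B j else C j.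
rewrite (eq_big_seq (fun j => X j @^-1` D j)); last by move=> j js; rewrite /D js.
rewrite [X in _ `&` X](eq_big_seq (fun j => X j @^-1` D j)); last first.
  by move=> j jt; rewrite /D ifN//; apply/negP => /dst; apply.
rewrite -big_cat/= iX.2; last 2 first.
- by rewrite cat_uniq us ut andbT/=; apply/hasPn => j jt; apply/negP => /dst; apply.
- by move=> j _; rewrite /D; case: ifP.
rewrite big_cat/=; congr (_ * _)%E; apply: eq_big_seq => j jt; rewrite /D ?jt//.
by rewrite ifN//; apply/negP => /dst; apply.
Qed.

Lemma subsig_measurable A E : <<s cylinders A >> E -> measurable E.
Proof. by apply: smallest_sub; [exact: sigma_algebra_measurable|exact: measurable_cyl]. Qed.

(** For a fixed event [F], the measures P(E and F) and P(E) P(F) of [E] agree on a pi-system, hence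
    on the sigma-algebra it generates. Applied once with [F] a cylinder and once with the roles
    exchanged, this extends independence on both sides. *)
Lemma subsig_indep (A1 A2 : pred nat) : (forall j, A1 j -> A2 j -> False) ->
  forall E F, <<s cylinders A1 >> E -> <<s cylinders A2 >> F ->
  P (E `&` F) = (P E * P F)%E.
Proof.
move=> A12.
have step B1 B2 : (forall E F, cylinders B1 E -> B2 F -> P (E `&` F) = (P E * P F)%E) ->
    (B2 `<=` measurable) ->
    forall E F, <<s cylinders B1 >> E -> B2 F -> P (E `&` F) = (P E * P F)%E.
  move=> h mB2 E F sE cF; have mF := mB2 _ cF.
  pose r : {nonneg R} := NngNum (pr_ge0 P F).
  have rE : (r%:num%:E = P F)%E by rewrite /= EFin_pr.
  suff : mrestr P mF E = mscale r P E by rewrite /mrestr /mscale/= EFin_pr// muleC.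
  apply: (g_sigma_algebra_measure_unique (cylinders B1) (@measurable_cyl B1)
    (fun=> setT) (fun=> cyl_setT B1) _ _ _ (@cyl_setI B1)) => //.
  - by rewrite bigcup_const//; exists 0%N.
  - move=> A cA; transitivity (r%:num%:E * P A)%E; last by [].
    by rewrite rE muleC; exact: h.
  - move=> _; apply: le_lt_trans (ltry 1).
    by apply: probability_le1; apply: measurableI.
have c12 := cyl_indep A12.
have h1 : forall E F, <<s cylinders A1 >> E -> cylinders A2 F -> P (E `&` F) = (P E * P F)%E.
  exact: step c12 (@measurable_cyl A2).
move=> E F sE sF; rewrite setIC muleC.
apply: (step A2 <<s cylinders A1 >>) => //.
- by move=> E' F' cE' sF'; rewrite setIC muleC; apply: h1.
- by move=> ?; exact: subsig_measurable.
Qed.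

Lemma measurable_subsig (A : pred nat) j : A j ->
  measurable_fun (setT : set (subsig A)) (X j : subsig A -> R).
Proof.
move=> Aj _ B mB; rewrite setTI; apply: sub_sigma_algebra.
exists [:: j], (fun=> B); split => //=; first by rewrite Aj.
apply/seteqP; split=> [w Bw i|w /= h]; first by rewrite inE => /eqP ->.
by apply: h; rewrite mem_head.
Qed.

Lemma indep_subsig d1 d2 (T1 : measurableType d1) (T2 : measurableType d2)
    (A1 A2 : pred nat) (U : T -> T1) (V : T -> T2) :
  (forall j, A1 j -> A2 j -> False) ->
  measurable_fun (setT : set (subsig A1)) (U : subsig A1 -> T1) ->
  measurable_fun (setT : set (subsig A2)) (V : subsig A2 -> T2) ->
  indep P U V.
Proof.
move=> A12 mU mV.
have sU B : measurable B -> <<s cylinders A1 >> (U @^-1` B).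
  by move=> mB; have := mU measurableT B mB; rewrite setTI.
have sV B : measurable B -> <<s cylinders A2 >> (V @^-1` B).
  by move=> mB; have := mV measurableT B mB; rewrite setTI.
split.
- by move=> _ B mB; rewrite setTI; apply: subsig_measurable; exact: sU.
- by move=> _ B mB; rewrite setTI; apply: subsig_measurable; exact: sV.
- by move=> B C mB mC; apply: (subsig_indep A12); [exact: sU|exact: sV].
Qed.

End sub_sigma.

(** * Second moments of sums of kernels *)

Section second_moments.
Context d (T : measurableType d) (R : realType) (P : probability T R).

Lemma Ex_sqr_sum I (r : seq I) (p : pred I) (f : I -> T -> R) :
  (forall i j, p i -> p j -> L1 P (fun w => f i w * f j w)) ->
  L1 P (fun w => (\sum_(i <- r | p i) f i w) ^+ 2) /\
  Ex P (fun w => (\sum_(i <- r | p i) f i w) ^+ 2) =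
  \sum_(i <- r | p i) \sum_(j <- r | p j) Ex P (fun w => f i w * f j w).
Proof.
move=> lf.
have -> : (fun w => (\sum_(i <- r | p i) f i w) ^+ 2) =
    (fun w => \sum_(i <- r | p i) \sum_(j <- r | p j) f i w * f j w).
  by apply/funext => w; rewrite expr2 big_distrlr.
split; first by apply: L1_sum => i pi; apply: L1_sum => j pj; exact: lf.
rewrite Ex_sum; last by move=> i pi; apply: L1_sum => j pj; exact: lf.
by apply: eq_bigr => i pi; rewrite Ex_sum// => j pj; exact: lf.
Qed.

Lemma Ex_sqr_uncorrelated (I : eqType) (r : seq I) (f : I -> T -> R) : uniq r ->
  (forall i j, L1 P (fun w => f i w * f j w)) ->
  (forall i j, i != j -> Ex P (fun w => f i w * f j w) = 0) ->
  Ex P (fun w => (\sum_(i <- r) f i w) ^+ 2) =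
  \sum_(i <- r) Ex P (fun w => f i w ^+ 2).
Proof.
move=> ur lf f0; rewrite (Ex_sqr_sum r (p := predT) (fun i j _ _ => lf i j)).2.
apply: eq_big_seq => i ir; rewrite (bigD1_seq i)//= big1 ?addr0 => [|j ji].
  by congr Ex; apply/funext => w; rewrite expr2.
by rewrite f0// eq_sym.
Qed.

Lemma Ex_norm_le (X : T -> R) (B : R) : L1 P X -> (forall w, `|X w| <= B) ->
  `|Ex P X| <= B.
Proof.
move=> lX XB; rewrite -[leRHS](Ex_cst P B); apply: norm_Ex_le => //.
exact: L1_cst.
Qed.

(** As both second moments have the same bound, |xy| <= (x^2 + y^2)/2 is enough. *)
Lemma cauchy_schwarz_Ex (X Y : T -> R) (s : R) : bdm X -> bdm Y ->
  Ex P (fun w => X w ^+ 2) <= s -> Ex P (fun w => Y w ^+ 2) <= s ->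
  `|Ex P (fun w => X w * Y w)| <= s.
Proof.
move=> bX bY Xs Ys.
have lX := bdm_L1 P (bdmX 2 bX); have lY := bdm_L1 P (bdmX 2 bY).
have h : `|Ex P (fun w => X w * Y w)| <= Ex P (fun w => 2^-1 * (X w ^+ 2 + Y w ^+ 2)).
  apply: norm_Ex_le; first exact: bdm_L1 (bdmM bX bY).
    by apply: L1Z; exact: L1D.
  move=> w; rewrite ler_norml; have := sqr_ge0 (X w - Y w); have := sqr_ge0 (X w + Y w).
  by move=> h1 h2; apply/andP; split; nra.
apply: (le_trans h); rewrite ExZ ?ExD//; last exact: L1D.
lra.
Qed.

End second_moments.

Section kernels.
Context d (T : measurableType d) (R : realType) (P : probability T R).
Variable e : nat -> T -> R.
Hypothesis ie : mutually_independent P e.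

Let me_ j : measurable_fun setT (e j). Proof. exact: ie.1. Qed.

Lemma bdm_comp1 (g : R -> R) i : bdm g -> bdm (fun w => g (e i w)).
Proof. by move=> [mg [B gB]]; split; [exact: measurableT_comp|exists B]. Qed.

Lemma bdm_comp2 (p : R * R -> R) i k : bdm p -> bdm (fun w => p (e i w, e k w)).
Proof.
move=> [mp [B pB]]; split; last by exists B.
by apply: (measurableT_comp mp); apply: measurable_fun_pair.
Qed.

Lemma indep_coord i j : i != j -> indep P (e i) (e j).
Proof.
move=> ij; apply: (indep_subsig ie (A1 := pred1 i) (A2 := pred1 j)).
- by move=> l /eqP -> /eqP ijE; rewrite ijE eqxx in ij.
- by apply: measurable_subsig => /=.
- by apply: measurable_subsig => /=.
Qed.

Lemma indep_coord_pairs i k j l : i != j -> i != l -> k != j -> k != l ->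
  indep P (fun w => (e i w, e k w)) (fun w => (e j w, e l w)).
Proof.
move=> ij il kj kl.
apply: (indep_subsig ie (A1 := mem [:: i; k]) (A2 := mem [:: j; l])).
- move=> m /=; rewrite !inE => /orP[] /eqP -> /orP[] /eqP E.
  + by rewrite E eqxx in ij.
  + by rewrite E eqxx in il.
  + by rewrite E eqxx in kj.
  + by rewrite E eqxx in kl.
- by apply: measurable_fun_pair; apply: measurable_subsig; rewrite /= !inE eqxx ?orbT.
- by apply: measurable_fun_pair; apply: measurable_subsig; rewrite /= !inE eqxx ?orbT.
Qed.

Lemma indep_sum (g : nat -> R -> R) (r : seq nat) i :
  (forall j, measurable_fun setT (g j)) -> i \notin r ->
  indep P (fun w => \sum_(j <- r) g j (e j w)) (e i).
Proof.
move=> mg ir; apply: (indep_subsig ie (A1 := mem r) (A2 := pred1 i)).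
- by move=> j /= jr /eqP ji; rewrite -ji jr in ir.
- suff h r' : {subset r' <= r} -> measurable_fun (setT : set (subsig e (mem r)))
      (fun w => \sum_(j <- r') g j (e j w)) by exact: h.
  elim: r' => [|j r' IHr] sr.
    by under eq_fun do rewrite big_nil; exact: measurable_cst.
  under eq_fun do rewrite big_cons.
  apply: measurable_funD; last by apply: IHr => k kr; apply: sr; rewrite inE kr orbT.
  apply: (measurableT_comp (mg j)); apply: measurable_subsig => /=.
  by apply: sr; rewrite mem_head.
- by apply: measurable_subsig => /=.
Qed.

(** The index [k] occurs only once among the four, so integrating over [e k] first already gives
    zero. *)
Lemma Ex_degenerate i k j l (p q : R * R -> R) : bdm p -> bdm q ->
  k != i -> k != j -> k != l ->
  (forall x, Ex P (fun w => p (x, e k w)) = 0) ->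
  Ex P (fun w => p (e i w, e k w) * q (e j w, e l w)) = 0.
Proof.
move=> bp bq ki kj kl p0.
have iUV : indep P (fun w => (e i w, (e j w, e l w))) (e k).
  apply: (indep_subsig ie (A1 := mem [:: i; j; l]) (A2 := pred1 k)).
  - move=> m /=; rewrite !inE => h /eqP E; move: h; rewrite E.
    by rewrite (negbTE ki) (negbTE kj) (negbTE kl).
  - apply: measurable_fun_pair; last apply: measurable_fun_pair;
    by apply: measurable_subsig; rewrite /= !inE eqxx ?orbT.
  - by apply: measurable_subsig => /=.
pose Phi (z : (R * (R * R)) * R) := p (z.1.1, z.2) * q z.1.2.
have bPhi : bdm Phi.
  apply: bdmM.
    have [mp [B pB]] := bp; split; last by exists B.
    apply: (measurableT_comp mp); apply: measurable_fun_pair => //.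
    exact: (measurableT_comp measurable_fst measurable_fst).
  have [mq [B qB]] := bq; split; last by exists B.
  apply: (measurableT_comp mq).
  exact: (measurableT_comp measurable_snd measurable_fst).
rewrite [LHS](_ : _ = Ex P (fun w => Phi ((e i w, (e j w, e l w)), e k w)))//.
rewrite (Ex_indep iUV)// -[RHS](Ex_cst P 0); congr Ex; apply/funext => w.
rewrite /Phi/=; under eq_fun do rewrite mulrC.
rewrite ExZ ?p0 ?mulr0//; apply: bdm_L1.
have [mp [B pB]] := bp; split; last by exists B.
by apply: (measurableT_comp mp); apply: measurable_fun_pair.
Qed.

(** In the expanded square the term of two pairs vanishes unless the second pair is the first one or
    its transpose. Each surviving product of coefficients is at most half the sum of their squares,
    and the two survivors per pair account for the factor 2. *)
Lemma degenerate_second_moment n (A : nat -> nat -> R) (p : R * R -> R) (B : R) :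
  bdm p -> (forall z, `|p z| <= B) ->
  (forall k x, Ex P (fun w => p (x, e k w)) = 0) ->
  (forall k x, Ex P (fun w => p (e k w, x)) = 0) ->
  Ex P (fun w => (\sum_(x : 'I_n * 'I_n | x.1 != x.2)
                   A x.1 x.2 * p (e x.1 w, e x.2 w)) ^+ 2) <=
  2 * B ^+ 2 * \sum_(x : 'I_n * 'I_n) A x.1 x.2 ^+ 2.
Proof.
move=> bp pB p1 p2.
have B0 : 0 <= B by apply: le_trans (pB (0, 0)).
pose f (x : 'I_n * 'I_n) w := A x.1 x.2 * p (e x.1 w, e x.2 w).
have bf x : bdm (f x) by apply: bdmZ; exact: bdm_comp2.
rewrite (Ex_sqr_sum (index_enum ('I_n * 'I_n)%type) (f := f)
  (p := fun x => x.1 != x.2) (fun i j _ _ => bdm_L1 P (bdmM (bf i) (bf j)))).2.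
pose sw (x : 'I_n * 'I_n) := (x.2, x.1).
pose A2 (x : 'I_n * 'I_n) := A x.1 x.2 ^+ 2.
have A20 x : 0 <= A2 x by exact: sqr_ge0.
have le1 x y : x.1 != x.2 -> y.1 != y.2 -> Ex P (fun w => f x w * f y w) <=
    ((y == x)%:R + (y == sw x)%:R) * (B ^+ 2 * (2^-1 * (A2 x + A2 y))).
  move=> xx yy.
  have [a b /=] : bdm (fun w => p (e x.1 w, e x.2 w)) /\ bdm (fun w => p (e y.1 w, e y.2 w)).
    by split; exact: bdm_comp2.
  have -> : Ex P (fun w => f x w * f y w) = A x.1 x.2 * A y.1 y.2 *
      Ex P (fun w => p (e x.1 w, e x.2 w) * p (e y.1 w, e y.2 w)).
    rewrite -ExZ; last by apply: bdm_L1; exact: bdmM.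
    by congr Ex; apply/funext => w; rewrite /f; ring.
  (* If some index of [x] is missing from [y], degeneracy in that index kills the term; for the
     first index the kernel is transposed to reuse the same lemma. Otherwise both indices of [x]
     occur in [y], which leaves two possibilities. *)
  have fin : Ex P (fun w => p (e x.1 w, e x.2 w) * p (e y.1 w, e y.2 w)) = 0 \/
     (y == x) || (y == sw x).
    have [x2y|x2y] := boolP ((x.2 != y.1 :> nat) && (x.2 != y.2 :> nat)).
      left; move/andP: x2y => [x21 x22]; apply: Ex_degenerate => //.
      by rewrite eq_sym.
    have [x1y|x1y] := boolP ((x.1 != y.1 :> nat) && (x.1 != y.2 :> nat)).
      left; move/andP: x1y => [x11 x12].
      pose p' z : R := p (z.2, z.1).
      have bp' : bdm p'.
        have [mp [C pC]] := bp; split; last by exists C => z; exact: pC.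
        by apply: (measurableT_comp mp); apply: measurable_fun_pair.
      apply: (@Ex_degenerate x.2 x.1 y.1 y.2 p' p) => // z; exact: p2.
    right; move: x2y x1y; rewrite !negb_and !negbK /sw.
    case: x y xx yy {a b} => [x1 x2] [y1 y2] /= xx yy.
    rewrite !xpair_eqE => h1 h2.
    case/orP: h1 => /eqP/val_inj E1; case/orP: h2 => /eqP/val_inj E2; subst.
    - by rewrite eqxx in xx.
    - by rewrite !eqxx orbT.
    - by rewrite !eqxx.
    - by rewrite eqxx in xx.
  have EB : `|Ex P (fun w => p (e x.1 w, e x.2 w) * p (e y.1 w, e y.2 w))| <= B ^+ 2.
    apply: Ex_norm_le; first by apply: bdm_L1; exact: bdmM.
    by move=> w; rewrite normrM expr2; apply: ler_pM.
  have AA0 : 0 <= 2^-1 * (A2 x + A2 y) by rewrite mulr_ge0// addr_ge0// sqr_ge0.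
  case: fin => [->|yx].
    by rewrite mulr0 mulr_ge0// ?addr_ge0// mulr_ge0// sqr_ge0.
  apply: (@le_trans _ _ (B ^+ 2 * (2^-1 * (A2 x + A2 y)))); last first.
    apply: ler_peMl; first by rewrite mulr_ge0// sqr_ge0.
    by case/orP: yx => ->; case: (_ == _); rewrite ?mulr1n ?mulr0n; lra.
  have AA : `|A x.1 x.2 * A y.1 y.2| <= 2^-1 * (A2 x + A2 y).
    rewrite ler_norml /A2; have := sqr_ge0 (A x.1 x.2 - A y.1 y.2).
    by have := sqr_ge0 (A x.1 x.2 + A y.1 y.2); move=> h1 h2; apply/andP; split; nra.
  apply: (le_trans (ler_norm _)); rewrite normrM mulrC.
  by apply: ler_pM.
have swK : involutive sw by case.
have sumA : \sum_(x : 'I_n * 'I_n) A2 (sw x) = \sum_(x : 'I_n * 'I_n) A2 x.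
  by rewrite [RHS](reindex_inj (inv_inj swK)).
apply: (@le_trans _ _ (\sum_(x : 'I_n * 'I_n)
   (B ^+ 2 * A2 x + B ^+ 2 * (2^-1 * (A2 x + A2 (sw x)))))); last first.
  rewrite big_split/= -!mulr_sumr big_split/= sumA /A2.
  lra.
rewrite big_mkcond/=; apply: ler_sum => x _.
have t0 : 0 <= B ^+ 2 * A2 x + B ^+ 2 * (2^-1 * (A2 x + A2 (sw x))).
  have := A20 x; have := A20 (sw x) => h1 h2.
  by apply: addr_ge0; apply: mulr_ge0; rewrite ?sqr_ge0//; lra.
case: ifPn => // xx; apply: (@le_trans _ _ (\sum_(y : 'I_n * 'I_n)
   ((y == x)%:R + (y == sw x)%:R) * (B ^+ 2 * (2^-1 * (A2 x + A2 y))))).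
  rewrite big_mkcond/=; apply: ler_sum => y _; case: ifPn => yy; first exact: le1.
  apply: mulr_ge0; first by rewrite addr_ge0.
  by apply: mulr_ge0; rewrite ?sqr_ge0//; have := A20 x; have := A20 y; lra.
under eq_bigr do rewrite mulrDl.
rewrite big_split/= (bigD1 x)//= eqxx mul1r big1 ?addr0; last first.
  by move=> y /negbTE ->; rewrite mul0r.
rewrite (bigD1 (sw x))//= eqxx mul1r big1 ?addr0; last first.
  by move=> y /negbTE ->; rewrite mul0r.
lra.
Qed.

(** Disjoint pairs give independent centred terms and contribute nothing. A pair meets at most 4n
    others, and each covariance is at most [s] by Cauchy-Schwarz, whence n^2 times 4n times [s]. *)
Lemma overlap_second_moment n (c : nat -> R) (q : nat -> nat -> R * R -> R) (s : R) :
  (forall i, `|c i| <= 1) -> 0 <= s ->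
  (forall i k, bdm (q i k)) ->
  (forall i k, i != k -> Ex P (fun w => q i k (e i w, e k w)) = 0) ->
  (forall i k, (i < n)%N -> (k < n)%N -> i != k -> Ex P (fun w => q i k (e i w, e k w) ^+ 2) <= s) ->
  Ex P (fun w => (\sum_(x : 'I_n * 'I_n | x.1 != x.2)
                   c x.1 * q x.1 x.2 (e x.1 w, e x.2 w)) ^+ 2) <=
  4 * n%:R ^+ 3 * s.
Proof.
move=> c1 s0 bq q0 qs.
pose g (x : 'I_n * 'I_n) w := q x.1 x.2 (e x.1 w, e x.2 w).
have bg x : bdm (g x) by exact: bdm_comp2.
pose f (x : 'I_n * 'I_n) w := c x.1 * g x w.
have bf x : bdm (f x) by apply: bdmZ.
rewrite (Ex_sqr_sum (index_enum ('I_n * 'I_n)%type) (f := f)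
  (p := fun x => x.1 != x.2) (fun i j _ _ => bdm_L1 P (bdmM (bf i) (bf j)))).2.
(* The number of coincidences between the indices of the two pairs: at least 1 for overlapping
   pairs, and summing over [y] to exactly 4n. *)
pose ov (x y : 'I_n * 'I_n) : R := (x.1 == y.1)%:R + (x.1 == y.2)%:R +
   ((x.2 == y.1)%:R + (x.2 == y.2)%:R).
have ov0 x y : 0 <= ov x y by rewrite /ov !addr_ge0.
have le1 x y : x.1 != x.2 -> y.1 != y.2 ->
    Ex P (fun w => f x w * f y w) <= s * ov x y.
  move=> xx yy.
  have -> : Ex P (fun w => f x w * f y w) = c x.1 * c y.1 * Ex P (fun w => g x w * g y w).
    rewrite -ExZ; last by apply: bdm_L1; exact: bdmM.
    by congr Ex; apply/funext => w; rewrite /f; ring.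
  have gs : `|Ex P (fun w => g x w * g y w)| <= s by apply: cauchy_schwarz_Ex => //; exact: qs.
  have [/and4P[a1 a2 a3 a4]|ovl] := boolP [&& x.1 != y.1, x.1 != y.2, x.2 != y.1 & x.2 != y.2].
    have [_ E] := indep_ExM (indep_comp (indep_coord_pairs a1 a2 a3 a4) (bq x.1 x.2).1 (bq y.1 y.2).1)
       (bdm_L1 P (bg x)) (bdm_L1 P (bg y)).
    have E0 : Ex P (g x) = 0 by exact: q0.
    rewrite [X in _ * X](_ : _ = Ex P (g x) * Ex P (g y)); last exact: E.
    by rewrite E0 mul0r mulr0 mulr_ge0.
  apply: (le_trans (ler_norm _)); rewrite normrM.
  apply: (@le_trans _ _ (1 * s)).
    apply: ler_pM => //; rewrite normrM -[leRHS]mulr1; exact: ler_pM.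
  rewrite mul1r ler_peMr//; move: ovl; rewrite !negb_and !negbK /ov.
  by case: (x.1 == y.1); case: (x.1 == y.2); case: (x.2 == y.1);
    case: (x.2 == y.2) => //= _; rewrite ?mulr1n ?mulr0n; lra.
rewrite big_mkcond/=.
apply: (@le_trans _ _ (\sum_(x : 'I_n * 'I_n) s * (4 * n%:R))); last first.
  rewrite sumr_const card_prod !card_ord -[X in X <= _]mulr_natr natrM.
  by rewrite le_eqVlt; apply/orP; left; apply/eqP; ring.
apply: ler_sum => x _; case: ifPn => xx; last by rewrite !mulr_ge0.
rewrite big_mkcond/=.
apply: (@le_trans _ _ (\sum_(y : 'I_n * 'I_n) s * ov x y)).
  apply: ler_sum => y _; case: ifPn => yy; first exact: le1.
  by rewrite mulr_ge0.
rewrite -mulr_sumr ler_wpM2l//.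
have E1 (i : 'I_n) : \sum_(y : 'I_n * 'I_n) (i == y.1)%:R = n%:R :> R.
  rewrite -(pair_bigA _ (fun a b => (i == a)%:R))/= (bigD1 i)//= [X in _ + X]big1 ?addr0.
    by rewrite eqxx sumr_const card_ord.
  by move=> j /negbTE ji; rewrite eq_sym ji big1.
have E2 (i : 'I_n) : \sum_(y : 'I_n * 'I_n) (i == y.2)%:R = n%:R :> R.
  rewrite -(pair_bigA _ (fun a b => (i == b)%:R))/= exchange_big/=.
  rewrite (bigD1 i)//= [X in _ + X]big1 ?addr0.
    by rewrite eqxx sumr_const card_ord.
  by move=> j /negbTE ji; rewrite eq_sym ji big1.
by rewrite /ov !big_split/= !E1 !E2; lra.
Qed.

End kernels.

(** * Weak convergence from characteristic functions *)

Section taylor.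
Context {R : realType}.
Implicit Types (x y : R).

(** Each Taylor bound for sine and cosine below follows from the preceding one through this
    criterion, one order at a time. *)
Lemma ge0_of_derive (f f' : R -> R) : (forall x, is_derive x 1 f (f' x)) ->
  (forall x, 0 <= x -> 0 <= f' x) -> 0 <= f 0 -> forall x, 0 <= x -> 0 <= f x.
Proof.
move=> df f'0 f0 x; rewrite le_eqVlt => /orP[/eqP <-//|x0].
have [|c cx E] := @MVT R f f' 0 x x0 (fun y _ => df y).
  apply: continuous_subspaceT => y; apply: differentiable_continuous.
  by apply/derivable1_diffP; exact: (@ex_derive _ _ _ _ _ _ _ (df y)).
have c0 : 0 <= c by move: cx; rewrite in_itv/= => /andP[/ltW].
have := mulr_ge0 (f'0 _ c0) (ltW x0); rewrite -[x in f' c * x]subr0 -E; lra.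
Qed.

Lemma sin_le x : 0 <= x -> sin x <= x.
Proof.
move=> x0; rewrite -subr_ge0.
apply: (@ge0_of_derive (fun x => x - sin x) (fun x => 1 - cos x)) => //.
by rewrite sin0 subr0.
Qed.

Lemma cos_ge x : 1 - x ^+ 2 / 2 <= cos x.
Proof.
wlog x0 : x / 0 <= x.
  move=> h; case: (leP 0 x) => [/h//|x0].
  by rewrite -cosN -sqrrN; apply: h; rewrite oppr_ge0 ltW.
rewrite -subr_ge0.
apply: (@ge0_of_derive (fun x => cos x - (1 - x ^+ 2 / 2)) (fun x => x - sin x)) => //.
- move=> y; apply: is_derive_eq; rewrite /GRing.scale/= ?expr1; lra.
- by move=> y y0; rewrite subr_ge0 sin_le.
- by rewrite cos0 expr0n/=; lra.
Qed.

Lemma sin_ge x : 0 <= x -> x - x ^+ 3 / 6 <= sin x.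
Proof.
move=> x0; rewrite -subr_ge0.
apply: (@ge0_of_derive (fun x => sin x - (x - x ^+ 3 / 6))
  (fun x => cos x - (1 - x ^+ 2 / 2))) => //.
- move=> y; apply: is_derive_eq; rewrite /GRing.scale/=; lra.
- by move=> y y0; rewrite subr_ge0 cos_ge.
- by rewrite sin0 expr0n/=; lra.
Qed.

Lemma cos_le x : cos x <= 1 - x ^+ 2 / 2 + x ^+ 4 / 24.
Proof.
wlog x0 : x / 0 <= x.
  move=> h; case: (leP 0 x) => [/h//|x0].
  have := h (- x); rewrite cosN -(sqrrN x) (_ : (- x) ^+ 4 = x ^+ 4); last by ring.
  by apply; rewrite oppr_ge0 ltW.
rewrite -subr_ge0.
apply: (@ge0_of_derive (fun x => 1 - x ^+ 2 / 2 + x ^+ 4 / 24 - cos x)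
  (fun x => sin x - (x - x ^+ 3 / 6))) => //.
- move=> y; apply: is_derive_eq; rewrite /GRing.scale/= ?expr1; lra.
- by move=> y y0; rewrite subr_ge0 sin_ge.
- by rewrite cos0 !expr0n/=; lra.
Qed.

Lemma expRN_le x : 0 <= x -> expR (- x) <= 1 - x + x ^+ 2 / 2.
Proof.
move=> x0; rewrite -subr_ge0.
apply: (@ge0_of_derive (fun x => 1 - x + x ^+ 2 / 2 - expR (- x))
  (fun x => -1 + x + expR (- x))) => //.
- move=> y; apply: is_derive_eq; rewrite /GRing.scale/= ?expr1; lra.
- by move=> y y0; have := expR_ge1Dx (- y); lra.
Qed.

Lemma sin_sub_cube x : `|sin x - x| <= `|x| ^+ 3.
Proof.
wlog x0 : x / 0 <= x.
  move=> h; case: (leP 0 x) => [/h//|x0].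
  by have := h (- x); rewrite sinN -opprD !normrN; apply; rewrite oppr_ge0 ltW.
rewrite (ger0_norm x0) ler_norml; have := sin_le x0; have := sin_ge x0.
have := exprn_ge0 3 x0; lra.
Qed.

(** A quadratic error valid on the whole line, unlike the cubic one, keeps the later estimates
    within reach of second moments alone. *)
Lemma sin_sub_sqr x : `|sin x - x| <= 2 * x ^+ 2.
Proof.
have [x1|x1] := leP `|x| 1.
  apply: (le_trans (sin_sub_cube x)); rewrite -(real_normK (num_real x)).
  have n0 := normr_ge0 x; rewrite exprS; have := sqr_ge0 `|x|; nra.
apply: (le_trans (ler_normB _ _)); have := sin_max x.
rewrite -(real_normK (num_real x)); nra.
Qed.

Lemma cos_sub_exp x y : 0 <= y ->
  `|cos x - (1 - x ^+ 2 / 2)| <= x ^+ 4 /\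
  `|expR (- y) - (1 - y)| <= y ^+ 2.
Proof.
move=> y0; split; rewrite ler_norml.
- have := cos_ge x; have := cos_le x.
  have : 0 <= x ^+ 4 by rewrite exprn_even_ge0.
  by move=> ? ? ?; apply/andP; split; lra.
- have := expRN_le y0; have := expR_ge1Dx (- y); have := sqr_ge0 y.
  by move=> ? ? ?; apply/andP; split; lra.
Qed.

End taylor.

Section characteristic_function.
Context d (T : measurableType d) (R : realType) (P : probability T R).
Variable e : nat -> T -> R.
Hypothesis ie : mutually_independent P e.

(** The factors E cos are replaced by [c i] one at a time, and the sine terms are counted as errors
    because they are small or zero for centred summands. The free phase [phi] lets real cosines
    carry both the real and the imaginary part of the characteristic function. *)
Lemma cf_indep_sum (g : nat -> R -> R) (c : nat -> R) (r : seq nat) (phi : R) :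
  (forall i, measurable_fun setT (g i)) -> (forall i, 0 <= c i <= 1) -> uniq r ->
  `|Ex P (fun w => cos (\sum_(i <- r) g i (e i w) + phi))
    - cos phi * \prod_(i <- r) c i| <=
  \sum_(i <- r) (`|Ex P (fun w => cos (g i (e i w))) - c i|
               + `|Ex P (fun w => sin (g i (e i w)))|).
Proof.
move=> mg c01; elim: r phi => [|i r IH] phi /=.
  move=> _; rewrite !big_nil mulr1.
  under [X in Ex P X]eq_fun do rewrite big_nil add0r.
  by rewrite Ex_cst subrr normr0.
move=> /andP[ir ur]; rewrite !big_cons.
pose S w := \sum_(j <- r) g j (e j w) + phi.
have mgi : measurable_fun setT (fun w => g i (e i w)) by apply: measurableT_comp => //; exact: ie.1.
have iS : indep P S (fun w => g i (e i w)).
  have h := indep_sum ie mg ir.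
  have madd : measurable_fun setT (fun x : R => x + phi) by exact: measurable_funD.
  exact: (indep_comp h madd (mg i)).
have mS : measurable_fun setT S by case: iS.
have mcos : measurable_fun setT (@cos R) by apply: continuous_measurable_fun; exact: continuous_cos.
have msin : measurable_fun setT (@sin R) by apply: continuous_measurable_fun; exact: continuous_sin.
have lc := bdm_L1 P (bdm_cos mS); have ls := bdm_L1 P (bdm_sin mS).
have lci := bdm_L1 P (bdm_cos mgi); have lsi := bdm_L1 P (bdm_sin mgi).
have [l1 e1] := indep_ExM (indep_comp iS mcos mcos) lc lci.
have [l2 e2] := indep_ExM (indep_comp iS msin msin) ls lsi.
have E : Ex P (fun w => cos (\sum_(j <- i :: r) g j (e j w) + phi)) =
    Ex P (fun w => cos (S w)) * Ex P (fun w => cos (g i (e i w)))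
  - Ex P (fun w => sin (S w)) * Ex P (fun w => sin (g i (e i w))).
  rewrite -[X in _ = X - _]e1 -[X in _ = _ - X]e2 -ExB//.
  by congr Ex; apply/funext => w; rewrite big_cons/= -cosD /S; congr cos; ring.
rewrite E; have := IH phi ur; rewrite -/S.
set CS := Ex P (fun w => cos (S w)); set SS := Ex P (fun w => sin (S w)).
set ci := Ex P (fun w => cos _); set si := Ex P (fun w => sin _).
set W := \prod_(j <- r) c j; set D := \sum_(j <- r) _ => h.
have SS1 : `|SS| <= 1 by apply: Ex_norm_le => // w; exact: sin_max.
have ci1 : `|ci| <= 1 by apply: Ex_norm_le => // w; exact: cos_max.
have W1 : `|cos phi * W| <= 1.
  rewrite normrM -[leRHS]mulr1; apply: ler_pM => //; first exact: cos_max.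
  rewrite /W; elim: (r) => [|j s IHs]; first by rewrite big_nil normr1.
  rewrite big_cons normrM -[leRHS]mulr1; apply: ler_pM => //.
  by have /andP[c0 c1] := c01 j; rewrite ger0_norm.
rewrite (_ : _ - _ = (CS - cos phi * W) * ci + cos phi * W * (ci - c i) - SS * si); last by ring.
apply: (le_trans (ler_normB _ _)); rewrite addrAC addrC.
have h1 : `|SS * si| <= `|si| by rewrite normrM ler_piMl.
have h2 : `|(CS - cos phi * W) * ci| <= D by rewrite normrM (le_trans _ h)// ler_piMr.
have h3 : `|cos phi * W * (ci - c i)| <= `|ci - c i| by rewrite normrM ler_piMl.
have := ler_normD ((CS - cos phi * W) * ci) (cos phi * W * (ci - c i)).
lra.
Qed.

End characteristic_function.

(** * Random walks with small biased steps *)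

Section random_walk.
Context {R : realType}.
Implicit Types (l : seq nat) (dl : R) (psi : (nat -> R) -> R) (u y z : nat -> R).

Definition step_coord y (j : nat) dl : nat -> R := fun i => if i == j then y i + dl else y i.

(* Expectation of [psi] at the end point of a walk started at [y] whose steps
   change the coordinates listed in [l] by [dl] (probability [u j]) or [- dl]. *)
Fixpoint walk l dl psi u y : R :=
  if l is j :: l' then u j * walk l' dl psi u (step_coord y j dl)
                       + (1 - u j) * walk l' dl psi u (step_coord y j (- dl))
  else psi y.

Variable u : nat -> R.
Hypothesis u01 : forall j, 0 <= u j <= 1.

Lemma le_walk l dl psi1 psi2 y : (forall y, psi1 y <= psi2 y) ->
  walk l dl psi1 u y <= walk l dl psi2 u y.
Proof.
move=> h; elim: l y => [|j l IH] y //=; have /andP[u0 u1] := u01 j.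
by apply: lerD; apply: ler_wpM2l; rewrite ?subr_ge0.
Qed.

Lemma walk_cst l dl (a : R) y : walk l dl (fun=> a) u y = a.
Proof. by elim: l y => [|j l IH] y //=; rewrite !IH; ring. Qed.

Lemma walkD l dl psi1 psi2 y : walk l dl (fun y => psi1 y + psi2 y) u y =
  walk l dl psi1 u y + walk l dl psi2 u y.
Proof. by elim: l y => [|j l IH] y //=; rewrite !IH; ring. Qed.

Lemma walkZ l dl (a : R) psi y : walk l dl (fun y => a * psi y) u y = a * walk l dl psi u y.
Proof. by elim: l y => [|j l IH] y //=; rewrite !IH; ring. Qed.

Lemma walk_sum l dl M (psi : nat -> (nat -> R) -> R) y :
  walk l dl (fun y => \sum_(j < M) psi j y) u y = \sum_(j < M) walk l dl (psi j) u y.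
Proof.
elim: M => [|M IH].
  rewrite big_ord0 -[RHS](walk_cst l dl 0 y).
  by congr walk; apply/funext => z; rewrite big_ord0.
rewrite big_ord_recr/= -IH -walkD.
by congr walk; apply/funext => z; rewrite big_ord_recr.
Qed.

(** Squared bias plus variance: a step in coordinate [j] has mean dl (2 u_j - 1) and variance 4 dl^2
    u_j (1 - u_j). *)
Lemma walk_sqr l dl j (z : R) y :
  walk l dl (fun y => (y j - z) ^+ 2) u y =
  (y j + (count_mem j l)%:R * (dl * (2 * u j - 1)) - z) ^+ 2
  + (count_mem j l)%:R * (dl ^+ 2 * (4 * u j * (1 - u j))).
Proof.
elim: l y => [|i l IH] y /=; first by rewrite !mul0r !addr0.
rewrite !IH /step_coord; have [->|ij] := eqVneq i j.
  by rewrite add1n -natr1; ring.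
by rewrite add0n; ring.
Qed.

(** A quantitative law of large numbers. Every coordinate below [M] is moved [N] times by 1/N, so
    its final position has mean 2 u_j - 1 and variance at most 1/N. *)
Lemma walk_dev M N (K eta : R) psi : 0 <= K -> 0 < eta -> (0 < N)%N ->
  N%:R^-1 <= eta ^+ 2 ->
  (forall y z, `|psi y - psi z| <= K * \sum_(j < M) `|y j - z j|) ->
  `|walk (flatten (nseq N (iota 0 M))) N%:R^-1 psi u (fun=> 0)
    - psi (fun j => 2 * u j - 1)| <= K * (M%:R * eta).
Proof.
move=> K0 eta0 N0 Neta psiK; set l := flatten _; set z := fun j => 2 * u j - 1.
have cl (j : nat) : (j < M)%N -> count_mem j l = N.
  move=> jM; rewrite /l; elim: (N) => [|n IH] //=.
  rewrite count_cat IH count_uniq_mem ?iota_uniq// mem_iota add0n jM//.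
(* The inequality |y| <= eta/2 + y^2/(2 eta) replaces the absolute deviation by its square, whose
   walk expectation is explicit. *)
pose dv y := K * \sum_(j < M) (2^-1 * eta + (2 * eta)^-1 * (y j - z j) ^+ 2).
have psidv y : `|psi y - psi z| <= dv y.
  apply: (le_trans (psiK _ _)); apply: ler_wpM2l => //; apply: ler_sum => j _.
  have h := sqr_ge0 (`|y j - z j| - eta).
  rewrite -(real_normK (num_real (y j - z j))) -(ler_pM2l (_ : 0 < 2 * eta)) ?mulr_gt0//.
  have E X : 2 * eta * (2^-1 * eta + (2 * eta)^-1 * X) = eta ^+ 2 + X.
    by field; rewrite gt_eqF.
  rewrite E; nra.
have hp : walk l N%:R^-1 psi u (fun=> 0) - psi z <= walk l N%:R^-1 dv u (fun=> 0).
  rewrite lerBlDr -[X in _ <= _ + X](walk_cst l N%:R^-1 (psi z) (fun=> 0)) -walkD.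
  apply: le_walk => y; rewrite -lerBlDr; apply: le_trans (psidv y); exact: ler_norm.
have hm : psi z - walk l N%:R^-1 psi u (fun=> 0) <= walk l N%:R^-1 dv u (fun=> 0).
  rewrite lerBlDr -[X in X <= _](walk_cst l N%:R^-1 (psi z) (fun=> 0)) -walkD.
  apply: le_walk => y; rewrite -lerBlDr; apply: le_trans (psidv y).
  by rewrite distrC; exact: ler_norm.
have dvE : walk l N%:R^-1 dv u (fun=> 0) <= K * (M%:R * eta).
  rewrite walkZ ler_wpM2l//.
  rewrite (walk_sum l _ M (fun j y => 2^-1 * eta + (2 * eta)^-1 * (y j - z j) ^+ 2)).
  apply: (@le_trans _ _ (\sum_(j < M) eta)); last by rewrite sumr_const card_ord mulr_natl.
  apply: ler_sum => j _.
  rewrite walkD walk_cst walkZ walk_sqr cl// add0r.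
  have Nn0 : (N%:R : R) != 0 by rewrite pnatr_eq0 -lt0n.
  have -> : N%:R * (N%:R^-1 * (2 * u j - 1)) - z j = 0 by rewrite /z; field.
  rewrite expr0n/= add0r.
  have -> : N%:R * (N%:R^-1 ^+ 2 * (4 * u j * (1 - u j))) = N%:R^-1 * (4 * u j * (1 - u j)).
    by field.
  have u1 : 4 * u j * (1 - u j) <= 1 by have := sqr_ge0 (2 * u j - 1); nra.
  have h : N%:R^-1 * (4 * u j * (1 - u j)) <= eta ^+ 2.
    by apply: le_trans Neta; rewrite ler_piMr// invr_ge0.
  have : (2 * eta)^-1 * (N%:R^-1 * (4 * u j * (1 - u j))) <= (2 * eta)^-1 * eta ^+ 2.
    by apply: ler_wpM2l => //; rewrite invr_ge0 mulr_ge0// ltW.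
  have -> : (2 * eta)^-1 * eta ^+ 2 = 2^-1 * eta by field; rewrite gt_eqF.
  lra.
by rewrite ler_norml; apply/andP; split; lra.
Qed.

End random_walk.

Section weak_convergence.
Context d (T : measurableType d) (R : realType) (P : probability T R).
Context d' (T' : measurableType d') (Q : probability T' R).
Variables (X : nat -> nat -> T -> R) (Z : nat -> T' -> R) (M : nat) (C : R).
Hypothesis mX : forall n j, measurable_fun setT (X n j).
Hypothesis mZ : forall j, measurable_fun setT (Z j).
Hypothesis X2 : forall n j, (j < M)%N ->
  L1 P (fun w => X n j w ^+ 2) /\ Ex P (fun w => X n j w ^+ 2) <= C.
Hypothesis Z2 : forall j, (j < M)%N ->
  L1 Q (fun w => Z j w ^+ 2) /\ Ex Q (fun w => Z j w ^+ 2) <= C.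
Hypothesis cfXZ : forall (a : nat -> R) (phi : R),
  Ex P (fun w => cos (\sum_(j < M) a j * X n j w + phi)) @[n --> \oo] -->
  Ex Q (fun w => cos (\sum_(j < M) a j * Z j w + phi)).

Definition converges_in_mean (f : (nat -> R) -> R) : Prop :=
  [/\ forall n, bdm (fun w => f (X n ^~ w)), bdm (fun w => f (Z ^~ w)) &
   Ex P (fun w => f (X n ^~ w)) @[n --> \oo] --> Ex Q (fun w => f (Z ^~ w))].

Lemma converges_lin (a b : R) f g : converges_in_mean f -> converges_in_mean g ->
  converges_in_mean (fun x => a * f x + b * g x).
Proof.
move=> [f1 f2 f3] [g1 g2 g3]; split.
- by move=> n; apply: bdmD; apply: bdmZ.
- by apply: bdmD; apply: bdmZ.
- have eP n : Ex P (fun w => a * f (X n ^~ w) + b * g (X n ^~ w)) =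
      a * Ex P (fun w => f (X n ^~ w)) + b * Ex P (fun w => g (X n ^~ w)).
    by rewrite ExD ?ExZ//; do ?apply: L1Z; exact: bdm_L1.
  rewrite ExD ?ExZ//; try (do ?apply: L1Z; exact: bdm_L1).
  under eq_fun do rewrite eP.
  by apply: cvgD; apply: cvgM => //; exact: cvg_cst.
Qed.

(** The probability of an upward step for which the mean displacement, 2 coin - 1, equals sin(th
    x_j). *)
Definition coin (th : R) (x : nat -> R) (j : nat) : R := 2^-1 * (1 + sin (th * x j)).

Lemma coin01 th x j : 0 <= coin th x j <= 1.
Proof.
by rewrite /coin; have := sin_geN1 (th * x j); have := sin_le1 (th * x j); lra.
Qed.

(** The cosine prefactor closes the induction: each step multiplies by sin(th x_j), and cos times
    sin is a difference of two cosines with a_j shifted by th and -th and the phase shifted by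
    -pi/2. For an empty list this is the hypothesis on characteristic functions. *)
Lemma converges_cos_walk th l dl psi y (a : nat -> R) phi :
  all (fun j => j < M)%N l ->
  converges_in_mean (fun x => cos (\sum_(j < M) a j * x j + phi)
                              * walk l dl psi (coin th x) y).
Proof.
elim: l y a phi => [|j l IH] y a phi /=.
  move=> _.
  suff h : converges_in_mean (fun x => cos (\sum_(j < M) a j * x j + phi)).
    have := converges_lin (psi y) 0 h h; congr converges_in_mean.
    by apply/funext => x; ring.
  split => //; first by move=> n; apply: bdm_cos; apply: measurable_funD => //;
    apply: measurable_sum => i; apply: measurable_funM.
  by apply: bdm_cos; apply: measurable_funD => //;
    apply: measurable_sum => i; apply: measurable_funM.
move=> /andP[jM lM].
pose ap := fun i => if i == j then a i + th else a i.
pose am := fun i => if i == j then a i - th else a i.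
have sE (x : nat -> R) b : \sum_(i < M) (if i == j :> nat then a i + b else a i) * x i =
    \sum_(i < M) a i * x i + b * x j.
  rewrite (bigD1 (Ordinal jM))//= eqxx [in RHS](bigD1 (Ordinal jM))//=.
  rewrite (eq_bigr (fun i : 'I_M => a i * x i)); first by ring.
  by move=> i ij; rewrite ifN//.
have h1 yy : converges_in_mean (fun x => cos (\sum_(j < M) a j * x j + phi) * sin (th * x j)
                              * walk l dl psi (coin th x) yy).
  have hp := IH yy ap (phi - pi / 2) lM.
  have hm := IH yy am (phi - pi / 2) lM.
  have := converges_lin (2^-1) (- 2^-1) hp hm; congr converges_in_mean.
  apply/funext => x; rewrite /ap /am (sE x th) (sE x (- th)).
  set A := \sum_(i < M) _.
  rewrite (_ : A + th * x j + (phi - pi / 2) = (A + phi + th * x j) - pi / 2); last by ring.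
  rewrite (_ : A + - th * x j + (phi - pi / 2) = (A + phi - th * x j) - pi / 2); last by ring.
  rewrite !cosBpihalf.
  by rewrite sinD sinB; field.
have h0 yy := IH yy a phi lM.
have hs yy (s : R) := converges_lin (2^-1) s (h0 yy) (h1 yy).
have := converges_lin 1 1 (hs (step_coord y j dl) (2^-1)) (hs (step_coord y j (- dl)) (- 2^-1)).
by congr converges_in_mean; apply/funext => x; rewrite /coin; field.
Qed.

(* Bernstein's argument: a walk of many small steps with bias [sin (th * x j)]
   ends, with high probability, near [sin (th * x j) / th], which is close to
   [x j]; for a fixed starting point its expectation is a trigonometric
   polynomial in [x]. *)
Lemma weak_cvg_lipschitz (f : (nat -> R) -> R) (K : R) : 0 <= K ->
  (forall x y, `|f x - f y| <= K * \sum_(j < M) `|x j - y j|) ->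
  (forall n, bdm (fun w => f (X n ^~ w))) -> bdm (fun w => f (Z ^~ w)) ->
  Ex P (fun w => f (X n ^~ w)) @[n --> \oo] --> Ex Q (fun w => f (Z ^~ w)).
Proof.
move=> K0 fK bX bZ; apply/cvgrPdist_le => eps eps0.
have C0 : (0 < M)%N -> 0 <= C.
  by move=> M0; apply: le_trans (X2 0%N M0).2; apply: Ex_ge0 => w; exact: sqr_ge0.
pose D := K * (M%:R * (2 * C)) + 1.
have D0 : 0 < D.
  rewrite /D; case: (posnP M) => [->|/C0 C0']; first by rewrite mul0r mulr0 add0r.
  by apply: ltr_wpDl => //; rewrite !mulr_ge0.
(* [th] makes the bound on the mean error of sin(th x)/th against x at most eps/6, and [eta] below
   does the same for the deviation of the walk. The total of eps/3 is spent once for [X], once for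
   [Z], and a third time on the convergence for the walk. The added 1 in [D] and [D2] keeps them
   positive. *)
pose th := eps / (6 * D).
have th0 : 0 < th by rewrite divr_gt0// mulr_gt0.
pose D2 := K / th * M%:R + 1.
have D20 : 0 < D2 by apply: ltr_wpDl => //; rewrite !mulr_ge0// invr_ge0 ltW.
pose eta := eps / (6 * D2).
have eta0 : 0 < eta by rewrite divr_gt0// mulr_gt0.
pose N := (Num.truncn ((eta ^+ 2)^-1)).+1.
have eta20 : 0 < eta ^+ 2 by rewrite exprn_gt0.
have Neta : N%:R^-1 <= eta ^+ 2.
  rewrite -[leRHS]invrK lef_pV2 ?posrE ?invr_gt0 ?ltr0n//.
  by apply: ltW; exact: truncnS_gt.
pose psi (y : nat -> R) := f (fun j => y j / th).
have psiK y z : `|psi y - psi z| <= K / th * \sum_(j < M) `|y j - z j|.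
  apply: (le_trans (fK _ _)); rewrite -mulrA ler_wpM2l// mulr_sumr.
  apply: ler_sum => j _; rewrite -mulrBl normrM mulrC ler_wpM2r//.
  by rewrite gtr0_norm// invr_gt0.
pose W x := walk (flatten (nseq N (iota 0 M))) N%:R^-1 psi (coin th x) (fun=> 0).
have all_l : all (fun j => j < M)%N (flatten (nseq N (iota 0 M))).
  apply/allP => j /flattenP[s]; rewrite mem_nseq => /andP[_ /eqP ->].
  by rewrite mem_iota.
have [W1 W2 W3] : converges_in_mean W.
  have := converges_cos_walk th N%:R^-1 psi (fun=> 0) (fun=> 0) 0 all_l.
  congr converges_in_mean; apply/funext => x.
  rewrite big1 ?addr0 ?cos0 ?mul1r// => i _; by rewrite mul0r.
have Wf x : `|f x - W x| <= K * \sum_(j < M) (2 * th * x j ^+ 2) + eps / 6.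
  have h1 : `|W x - psi (fun j => sin (th * x j))| <= eps / 6.
    have -> : (fun j => sin (th * x j)) = (fun j => 2 * coin th x j - 1).
      by apply/funext => j; rewrite /coin; field.
    apply: (le_trans (walk_dev (coin01 th x) _ eta0 _ Neta psiK)) => //.
      by rewrite divr_ge0// ltW.
    rewrite mulrA -[leRHS](_ : D2 * eta = _); last by rewrite /eta; field; rewrite gt_eqF.
    by rewrite ler_pM2r// /D2 lerDl.
  have h2 : `|f x - psi (fun j => sin (th * x j))| <= K * \sum_(j < M) (2 * th * x j ^+ 2).
    apply: (le_trans (fK _ _)); apply: ler_wpM2l => //; apply: ler_sum => j _.
    have h := sin_sub_sqr (th * x j).
    rewrite (_ : x j - sin (th * x j) / th = - (sin (th * x j) - th * x j) / th); last first.
      by field; rewrite gt_eqF.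
    rewrite normrM normrN (gtr0_norm (_ : 0 < th^-1)) ?invr_gt0// ler_pdivrMr//.
    by apply: le_trans h _; rewrite exprMn; nra.
  rewrite (_ : f x - W x = (f x - psi (fun j => sin (th * x j)))
     - (W x - psi (fun j => sin (th * x j)))); last by ring.
  by apply: (le_trans (ler_normB _ _)); apply: lerD.
have dist d1 (S : measurableType d1) (p : probability S R) (Y : nat -> S -> R) :
    (forall j, (j < M)%N -> L1 p (fun w => Y j w ^+ 2) /\ Ex p (fun w => Y j w ^+ 2) <= C) ->
    bdm (fun w => f (Y ^~ w)) -> bdm (fun w => W (Y ^~ w)) ->
    `|Ex p (fun w => f (Y ^~ w)) - Ex p (fun w => W (Y ^~ w))| <= eps / 3.
  move=> Y2 bf bW.
  have lY : L1 p (fun w => \sum_(j < M) (2 * th * Y j w ^+ 2)).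
    by apply: L1_sum => j _; apply: L1Z; exact: (Y2 j (ltn_ord j)).1.
  rewrite -ExB; [|exact: bdm_L1..].
  apply: (le_trans (norm_Ex_le (Y := fun w => K * \sum_(j < M) (2 * th * Y j w ^+ 2) + eps / 6) _ _ _)).
  - by apply: bdm_L1; exact: bdmB.
  - by apply: L1D; [exact: L1Z|exact: L1_cst].
  - by move=> w; exact: Wf.
  rewrite ExD; [|exact: L1Z|exact: L1_cst].
  rewrite Ex_cst ExZ// Ex_sum; last first.
    by move=> j _; apply: L1Z; exact: (Y2 j (ltn_ord j)).1.
  have : K * \sum_(j < M) Ex p (fun w => 2 * th * Y j w ^+ 2) <= K * \sum_(j < M) (2 * th * C).
    apply: ler_wpM2l => //; apply: ler_sum => j _; have [l1 l2] := Y2 j (ltn_ord j).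
    by rewrite ExZ// ler_wpM2l// mulr_ge0// ltW.
  rewrite sumr_const card_ord -[X in _ <= K * X -> _]mulr_natl.
  have -> : K * (M%:R * (2 * th * C)) = th * (D - 1) by rewrite /D; ring.
  have : th * D = eps / 6 by rewrite /th; field; rewrite gt_eqF.
  by move=> h1 h2; rewrite mulrBr mulr1 h1 in h2; lra.
have dX n := dist _ _ P (X n) (X2 n) (bX n) (W1 n).
have dZ := dist _ _ Q Z Z2 bZ W2.
move/cvgrPdist_le : W3 => /(_ (eps / 3)); rewrite divr_gt0// => /(_ isT).
apply: filterS => n hn; have := dX n.
move: dZ hn; rewrite !ler_norml => /andP[a1 a2] /andP[a3 a4] /andP[a5 a6].
by apply/andP; split; lra.
Qed.

End weak_convergence.

(** * Maximal inequality for averages *)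

Section tail.
Context d (T : measurableType d) (R : realType) (P : probability T R).

Lemma pr_bigcup_seq (I : choiceType) (r : seq I) (A : I -> set T) (B : set T) :
  (forall i, measurable (A i)) -> measurable B ->
  (forall w, B w -> exists2 i, i \in r & A i w) ->
  pr P B <= \sum_(i <- r) pr P (A i).
Proof.
move=> mA mB BA.
have mU : measurable (\big[setU/set0]_(i <- r) A i).
  by apply: bigsetU_measurable.
apply: (@le_trans _ _ (pr P (\big[setU/set0]_(i <- r) A i))).
  apply: le_pr => // w /BA[i ir Aiw].
  by rewrite -(bigcup_seq r A); exists i.
elim: r {BA mU} => [|i r IH]; first by rewrite !big_nil /pr measure0.
rewrite !big_cons; apply: (le_trans (pr_setU _ _ _)) => //.
  exact: bigsetU_measurable.
by rewrite lerD2l.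
Qed.

(** Comparison with a telescoping sum: 1/k^2 <= 2/(k (k+1)) = 2/k - 2/(k+1). *)
Lemma sum_inv_sqr_le (K N : nat) : (0 < K)%N ->
  \sum_(K <= k < N) (k%:R ^+ 2)^-1 <= 2 / K%:R :> R.
Proof.
move=> K0; have [NK|KN] := leqP N K.
  by rewrite big_geq// divr_ge0.
suff : \sum_(K <= k < N) (k%:R ^+ 2)^-1 <= 2 / K%:R - 2 / N%:R :> R.
  by move/le_trans; apply; rewrite gerBl divr_ge0.
have N0 : (0 < N)%N by exact: leq_trans KN.
apply: (@le_trans _ _ (\sum_(K <= k < N) (2 / k%:R - 2 / k.+1%:R))); last first.
  rewrite -[leLHS]opprK -sumrN.
  under eq_bigr do rewrite opprB.
  by rewrite telescope_sumr ?opprB// ltnW.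
rewrite big_nat_cond [leRHS]big_nat_cond; apply: ler_sum => k /andP[/andP[Kk _] _].
have k0 : 1 <= k%:R :> R by rewrite ler1n (leq_trans K0).
have -> : 2 / k%:R - 2 / k.+1%:R = 2 / (k%:R * (k%:R + 1)) :> R.
  by rewrite -natr1; field; apply/andP; split; rewrite gt_eqF//; lra.
rewrite -[leLHS]mul1r ler_pdivrMr; last by nra.
by rewrite mulrAC ler_pdivlMr; nra.
Qed.

Definition psum (X : nat -> T -> R) (m : nat) (w : T) : R :=
  \sum_(1 <= j < m.+1) X j w.

Lemma le_psum (X : nat -> T -> R) m n w : (forall j w, 0 <= X j w) -> (m <= n)%N ->
  psum X m w <= psum X n w.
Proof.
move=> X0 mn; rewrite /psum (@big_cat_nat _ _ _ m.+1 1 n.+1)//= lerDl.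
by apply: sumr_ge0.
Qed.

(* Along [k ^ 2] Chebyshev's bounds are summable, and nonnegativity of the
   summands controls the averages between consecutive squares. *)
Lemma average_tail (X : nat -> T -> R) (N K : nat) (C t : R) :
  0 <= C -> 1 < t -> 6 / (t - 1) <= K%:R ->
  (forall j, measurable_fun setT (X j)) -> (forall j w, 0 <= X j w) ->
  (forall m, (m <= N)%N -> L1 P (fun w => (psum X m w - m%:R) ^+ 2) /\
     Ex P (fun w => (psum X m w - m%:R) ^+ 2) <= C * m%:R) ->
  pr P [set w | exists2 m, (K ^ 2 <= m <= N)%N & t * m%:R <= psum X m w]
    <= 32 * C / (t - 1) ^+ 2 / K%:R.
Proof.
move=> C0 t1 Kt mX X0 Xm.
pose e := (t - 1) / 2; have e0 : 0 < e by rewrite divr_gt0// subr_gt0.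
have K0 : (0 < K)%N.
  by rewrite -(ltr_nat R); apply: lt_le_trans Kt; rewrite divr_gt0// subr_gt0.
have mS m : measurable_fun setT (psum X m).
  by apply: measurable_sum.
(* The next square after [m], capped at [N] because the moment bound is available only up to
   there. *)
pose mk k := minn (k.+1 ^ 2) N.
pose A k := if (k ^ 2 <= N)%N && (K <= k)%N then
  [set w | (e * (k ^ 2)%:R) ^+ 2 <= (psum X (mk k) w - (mk k)%:R) ^+ 2] else set0.
have mle (f : T -> R) (a : R) : measurable_fun setT f -> measurable [set w | a <= f w].
  move=> mf; rewrite -[X in measurable X]setTI.
  exact: measurable_fun_le.
have mA k : measurable (A k).
  rewrite /A; case: ifP => // _; apply: mle.
  by apply: measurable_funX; apply: measurable_funB.
have mB : measurable [set w | exists2 m, (K ^ 2 <= m <= N)%N & t * m%:R <= psum X m w].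
  rewrite (_ : [set w | _] = \bigcup_(m in [set m | (K ^ 2 <= m <= N)%N])
     [set w | t * m%:R <= psum X m w]); last first.
    by apply/seteqP; split => w [m ? ?]; exists m.
  by apply: bigcup_measurable => m _; apply: mle.
apply: (@le_trans _ _ (\sum_(k <- index_iota K N.+1) pr P (A k))).
  apply: pr_bigcup_seq => // w [m /andP[Km mN] tm].
  have exk : exists k, (k ^ 2 <= m)%N by exists 0%N.
  have bk k : (k ^ 2 <= m)%N -> (k <= m)%N.
    by move=> km; apply: leq_trans km; rewrite -mulnn; case: k => // k; rewrite leq_pmulr.
  pose k := ex_maxn exk bk.
  have [km kmax] : (k ^ 2 <= m)%N /\ (m < k.+1 ^ 2)%N.
    rewrite /k; case: ex_maxnP => i im imax; split=> //.
    by rewrite ltnNge; apply/negP => /imax; rewrite ltnn.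
  have Kk : (K <= k)%N.
    rewrite -ltnS -(@ltn_exp2r _ _ 2)//; exact: leq_ltn_trans kmax.
  exists k; first by rewrite mem_index_iota Kk/= ltnS (leq_trans (bk _ km)).
  rewrite /A Kk (leq_trans km mN)/=.
  have mmk : (m <= mk k)%N by rewrite leq_min mN andbT ltnW.
  have Sm : t * m%:R <= psum X (mk k) w by apply: le_trans tm _; exact: le_psum.
  have kR : 6 / (t - 1) <= k%:R :> R by apply: (le_trans Kt); rewrite ler_nat.
  have k6 : 6 <= k%:R * (t - 1) by rewrite -ler_pdivrMr// subr_gt0.
  have k1 : 1 <= k%:R :> R by rewrite ler1n (leq_trans K0).
  have mk1 : (mk k)%:R <= (k%:R + 1) ^+ 2 :> R.
    by rewrite natr1 -natrX ler_nat geq_minl.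
  have m1 : k%:R ^+ 2 <= m%:R :> R by rewrite -natrX ler_nat.
  (* From t k^2 - (k+1)^2 >= (t-1) k^2 / 2, which amounts to (t-1) k^2 / 2 >= 2k + 1. It holds as k
     (t-1) >= 6 gives 3k on the left; this is the origin of the 6 in the hypothesis on [K]. *)
  have h : e * k%:R ^+ 2 <= psum X (mk k) w - (mk k)%:R.
    rewrite /e; nra.
  rewrite /= natrX; rewrite ler_pXn2r// ?nnegrE//.
    by rewrite mulr_ge0 ?sqr_ge0// ltW.
  by apply: le_trans h; rewrite mulr_ge0 ?sqr_ge0// ltW.
(* Chebyshev's bound is C (k+1)^2 / (e k^2)^2 with (k+1)^2 <= 4 k^2 and e = (t-1)/2, which gives the
   16; the sum of the inverse squares doubles it to 32. *)
apply: (@le_trans _ _ (\sum_(K <= k < N.+1) 16 * C / (t - 1) ^+ 2 * (k%:R ^+ 2)^-1)); last first.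
  rewrite -mulr_sumr; apply: (le_trans (ler_wpM2l _ (sum_inv_sqr_le _ K0))).
    by rewrite !mulr_ge0// invr_ge0 sqr_ge0.
  by rewrite le_eqVlt; apply/orP; left; apply/eqP; field; rewrite !gt_eqF ?ltr0n//; lra.
rewrite big_nat_cond [leRHS]big_nat_cond; apply: ler_sum => k /andP[/andP[Kk _] _].
have k1 : 1 <= k%:R :> R by rewrite ler1n (leq_trans K0).
have t10 : 0 < t - 1 by lra.
rewrite /A Kk andbT; case: ifPn => kN; last first.
  by rewrite /pr measure0/= !mulr_ge0// invr_ge0 sqr_ge0.
have mkN : (mk k <= N)%N by rewrite geq_minr.
have [l1 l2] := Xm _ mkN.
apply: (le_trans (markov_pr l1 _ _)) => [w||]; first exact: sqr_ge0.
  by rewrite exprn_gt0// mulr_gt0// ltr0n expn_gt0 (leq_trans K0).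
have ek0 : 0 < (e * (k ^ 2)%:R) ^+ 2 by rewrite exprn_gt0// mulr_gt0// ltr0n expn_gt0 (leq_trans K0).
rewrite ler_pdivrMr//; apply: (le_trans l2).
have -> : 16 * C / (t - 1) ^+ 2 / k%:R ^+ 2 * (e * (k ^ 2)%:R) ^+ 2 = C * (4 * k%:R ^+ 2).
  by rewrite natrX /e; field; apply/andP; split; rewrite gt_eqF//; lra.
apply: ler_wpM2l => //; apply: (@le_trans _ _ ((k%:R + 1) ^+ 2)).
  by rewrite natr1 -natrX ler_nat geq_minl.
nra.
Qed.

End tail.

(** * Gaussian variables and the critical value *)

(** The Radon-Nikodym derivative of [nu] coincides almost everywhere with [f], so the change of
    variables for the derivative transfers to [f]. *)
Lemma ge0_integral_of_density d (S : measurableType d) (R : realType)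
    (nu : {finite_measure set S -> \bar R})
    (mu : {sigma_finite_measure set S -> \bar R}) (f : S -> R) (g : S -> \bar R) :
  (forall x, 0 <= f x) -> measurable_fun setT f ->
  (forall A, measurable A -> nu A = (\int[mu]_(x in A) (f x)%:E)%E) ->
  measurable_fun setT g -> (forall x, 0 <= g x)%E ->
  (\int[nu]_x g x = \int[mu]_x (g x * (f x)%:E))%E.
Proof.
move=> f0 mf nuE mg g0.
have numu : nu `<< mu.
  apply/null_content_dominatesP => A mA A0.
  rewrite nuE//; apply: null_set_integral => //.
  by apply/measurable_funTS/measurable_EFinP.
rewrite -(Radon_Nikodym_SigmaFinite.change_of_variables numu)//.
apply: ae_eq_integral => //.
- apply: emeasurable_funM => //.
  exact: measurable_int (Radon_Nikodym_SigmaFinite.f_integrable numu).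
- by apply: emeasurable_funM => //; exact/measurable_EFinP.
- apply: ae_eqe_mul2l; apply: integral_ae_eq => //.
  + exact: Radon_Nikodym_SigmaFinite.f_integrable.
  + exact/measurable_EFinP.
  + by move=> A _ mA; rewrite -nuE//= -Radon_Nikodym_SigmaFinite.f_integral.
Qed.

Section density.
Context d (T : measurableType d) (R : realType) (P : probability T R).
Local Notation mu := (@lebesgue_measure R).
Variables (X : T -> R) (f : R -> R).
Hypothesis mX : measurable_fun setT X.
Hypothesis fX : has_density P X f.

Lemma ge0_integral_density (g : R -> \bar R) : measurable_fun setT g ->
  (forall x, 0 <= g x)%E ->
  (\int[P]_w g (X w) = \int[mu]_x (g x * (f x)%:E))%E.
Proof.
move=> mg g0; have [f0 [mf fE]] := fX.
pose S : measurableType _ := measurableTypeR R.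
have mX' : measurable_fun setT (X : T -> S) by exact: mX.
pose pX : {mfun T >-> S} := HB.pack (X : T -> S) (isMeasurableFun.Build _ _ _ _ (X : T -> S) mX').
pose nu : probability S R := distribution P pX.
transitivity (\int[nu]_x g x)%E; first by rewrite ge0_integral_distribution.
have nuE A : measurable A -> nu A = (\int[mu]_(x in A) (f x)%:E)%E by exact: fE.
exact: (@ge0_integral_of_density _ S R nu mu f g f0 mf nuE mg g0).
Qed.

Lemma Ex_density (g : R -> R) : measurable_fun setT g ->
  mu.-integrable setT (fun x => (g x * f x)%:E) ->
  L1 P (g \o X) /\ Ex P (g \o X) = (\int[mu]_x (g x * f x))%R.
Proof.
move=> mg /integrableP[mgf igf]; have [f0 [mf fE]] := fX.
have l : L1 P (g \o X).
  apply/integrableP; split.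
    by apply/measurable_EFinP; exact: measurableT_comp.
  apply: le_lt_trans igf; rewrite le_eqVlt; apply/orP; left; apply/eqP.
  rewrite (ge0_integral_density (g := fun x => `|(g x)%:E|%E)) => [||x]//; last first.
    by apply: measurableT_comp => //; exact/measurable_EFinP.
  by apply: eq_integral => x _; rewrite /= normrM (ger0_norm (f0 x)) EFinM.
split => //; rewrite /Ex /Rintegral; congr fine.
rewrite integralE [RHS]integralE; congr (_ - _)%E.
- transitivity (\int[P]_w ((EFin \o g)^\+ (X w)))%E; first by apply: eq_integral => w _; rewrite !funeposE.
  rewrite ge0_integral_density => [||x]//; last first.
    by apply: measurable_funepos; exact/measurable_EFinP.
  apply: eq_integral => x _; rewrite !funeposE/= EFinM.
  by rewrite maxe_pMl ?mul0e ?lee_fin.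
- transitivity (\int[P]_w ((EFin \o g)^\- (X w)))%E; first by apply: eq_integral => w _; rewrite !funenegE.
  rewrite ge0_integral_density => [||x]//; last first.
    by apply: measurable_funeneg; exact/measurable_EFinP.
  apply: eq_integral => x _; rewrite !funenegE maxe_pMl ?lee_fin// mul0e mulNe.
  by [].
Qed.

End density.

(** * Stein's identity for the standard normal density *)

Section gauss_density.
Context {R : realType}.
Local Notation mu := (@lebesgue_measure R).
Local Notation D := (@normal_pdf R 0 1).
Let c : R := normal_peak 1.

Lemma std_normal_pdfE x : D x = c * expR (- (x ^+ 2 / 2)).
Proof. by rewrite normal_pdfE ?oner_neq0//= /normal_fun subr0 expr1n mulNr. Qed.

(** Up to a constant the product is the normal density of variance 2. Growth at most exp(x^2/4)
    therefore serves as the common integrability criterion. *)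
Lemma integrable_exp_quarter : mu.-integrable setT (fun x => (expR (x ^+ 2 / 4) * D x)%:E).
Proof.
have s0 : Num.sqrt 2 != 0 :> R by rewrite gt_eqF// sqrtr_gt0.
have := @integrable_normal_pdf R 0 (Num.sqrt 2).
move/(integrableZl measurableT (c / normal_peak (Num.sqrt 2))).
apply: eq_integrable => // x _.
rewrite -EFinM; congr EFin; rewrite std_normal_pdfE normal_pdfE// /normal_fun subr0.
rewrite sqr_sqrtr// [LHS]mulrA divfK; last by rewrite gt_eqF// normal_peak_gt0.
rewrite [RHS]mulrCA -expRD; congr (_ * expR _); by field.
Qed.

Lemma integrable_gauss_growth (g : R -> R) (A : R) : measurable_fun setT g ->
  (forall x, `|g x| <= A * expR (x ^+ 2 / 4)) ->
  mu.-integrable setT (fun x => (g x * D x)%:E).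
Proof.
move=> mg gA; have := integrable_exp_quarter.
move/(integrableZl measurableT A); apply: le_integrable => //.
  by apply/measurable_EFinP; apply: measurable_funM => //; exact: measurable_normal_pdf.
move=> x _; rewrite -EFinM /= lee_fin; have D0 : 0 <= D x by exact: normal_pdf_ge0.
apply: le_trans (ler_norm _); rewrite normrM (ger0_norm D0) mulrA.
exact: ler_wpM2r.
Qed.


(** The integrand is the derivative of -psi times the density. On [-n-1, n+1] the integral reduces
    to boundary terms of order exp(-n^2/4), and dominated convergence passes to the whole line. *)
Lemma stein_integral (psi psi' : R -> R) (A : R) :
  (forall x : R, is_derive x 1 psi (psi' x)) -> continuous psi' ->
  (forall x, `|psi x| <= A * expR (x ^+ 2 / 4)) ->
  (forall x, `|x * psi x| <= A * expR (x ^+ 2 / 4)) ->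
  (forall x, `|psi' x| <= A * expR (x ^+ 2 / 4)) ->
  (\int[mu]_x ((x * psi x - psi' x) * D x)%:E = 0)%E.
Proof.
move=> dpsi cpsi' psiA xpsiA psi'A.
have A0 : 0 <= A by have := psi'A 0; rewrite expr0n/= mul0r expR0 mulr1; apply: le_trans.
have cpsi : continuous psi.
  move=> x; apply: differentiable_continuous; apply/derivable1_diffP.
  exact: (@ex_derive _ _ _ _ _ _ _ (dpsi x)).
pose K x : R := c * expR (- (x ^+ 2 / 2)).
pose g x := (x * psi x - psi' x) * K x.
pose G x : R := - (psi x * K x).
have K0 x : 0 <= K x by rewrite mulr_ge0 ?expR_ge0// normal_peak_ge0.
have dG (x : R) : is_derive x 1 G (g x).
  by apply: is_derive_eq; rewrite /g /K /GRing.scale/= ?expr1; field.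
have cG : continuous G.
  move=> x; apply: differentiable_continuous; apply/derivable1_diffP.
  exact: (@ex_derive _ _ _ _ _ _ _ (dG x)).
have cK : continuous K.
  move=> x; apply: differentiable_continuous; apply/derivable1_diffP.
  have : is_derive x 1 K (- x * K x).
    by apply: is_derive_eq; rewrite /K /GRing.scale/= ?expr1; field.
  by move=> h; exact: (@ex_derive _ _ _ _ _ _ _ h).
have cg : continuous g.
  move=> x; apply: cvgM; last exact: cK.
  by apply: cvgB; [apply: cvgM; [exact: cvg_id|exact: cpsi]|exact: cpsi'].
have gE x : (x * psi x - psi' x) * D x = g x by rewrite std_normal_pdfE.
under eq_integral do rewrite gE.
have gA x : `|x * psi x - psi' x| <= 2 * A * expR (x ^+ 2 / 4).
  by apply: (le_trans (ler_normB _ _)); have := xpsiA x; have := psi'A x; lra.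
have mg : measurable_fun setT g by exact: continuous_measurable_fun.
have ig : mu.-integrable setT (EFin \o g).
  have : mu.-integrable setT (fun x => ((x * psi x - psi' x) * D x)%:E).
    apply: (integrable_gauss_growth _ gA).
    apply: continuous_measurable_fun => x; apply: cvgB; last exact: cpsi'.
    by apply: cvgM; [exact: cvg_id|exact: cpsi].
  by apply: eq_integrable => // x _; rewrite /= gE.
pose I n := [set` `[- n.+1%:R, n.+1%:R : R]].
pose gn n x := (\1_(I n) x * g x)%:E.
have mI n : measurable (I n) by exact: measurable_itv.
have mgn n : measurable_fun setT (gn n).
  by apply/measurable_EFinP; apply: measurable_funM => //; exact/measurable_indicP.
have gng : {ae mu, forall x, setT x -> gn ^~ x @ \oo --> (g x)%:E}.
  apply: aeW => x _; apply: cvg_near_cst.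
  exists (Num.truncn `|x|) => // n /= xn.
  rewrite /gn indicE mem_set ?mul1r// /I /= in_itv/=.
  rewrite -ler_norml ltW//; apply: lt_le_trans (truncnS_gt _) _.
  by rewrite ler_nat ltnS.
have gnb : {ae mu, forall x n, setT x -> (`|gn n x| <= `|(g x)%:E|)%E}.
  apply: aeW => x n _; rewrite /gn indicE lee_fin normrM.
  by case: (x \in I n); rewrite ?normr1 ?mul1r// normr0 mul0r.
have [_ _ cv] := @dominated_convergence _ _ _ mu _ measurableT gn (EFin \o g)
  (fun x => `|(g x)%:E|%E) mgn ltac:(by apply: measurableT_comp => //; exact/measurable_EFinP) gng (integrable_abse ig) gnb.
have e n : (\int[mu]_x gn n x = (G n.+1%:R - G (- n.+1%:R))%:E)%E.
  rewrite EFinB -(@continuous_FTC2 _ g G).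
  - rewrite [RHS]integral_mkcond; apply: eq_integral => x _.
    by rewrite /gn indicE patchE; case: (x \in I n); rewrite ?mul1r ?mul0r.
  - by rewrite (@lt_trans _ _ 0)// ?ltr0n// oppr_lt0 ltr0n.
  - exact: continuous_subspaceT.
  - split.
    + by move=> x _; exact: (@ex_derive _ _ _ _ _ _ _ (dG x)).
    + by apply: cvg_at_right_filter; exact: cG.
    + by apply: cvg_at_left_filter; exact: cG.
  - by move=> x _; rewrite derive1E; exact: derive_val.
have Gb x : `|G x| <= A * c * expR (- (x ^+ 2 / 4)).
  rewrite /G normrN normrM (ger0_norm (K0 x)) /K.
  have -> : expR (- (x ^+ 2 / 4)) = expR (x ^+ 2 / 4) * expR (- (x ^+ 2 / 2)) :> R.
    by rewrite -expRD; congr expR; field.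
  have := ler_wpM2r (K0 x) (psiA x); rewrite /K => h; apply: (le_trans h).
  by rewrite le_eqVlt; apply/orP; left; apply/eqP; ring.
have Gh n : `|G n.+1%:R - G (- n.+1%:R)| <= 2 * (A * c) * (4 * n.+1%:R^-1).
  apply: (le_trans (ler_normB _ _)).
  have := Gb n.+1%:R; have := Gb (- n.+1%:R); rewrite sqrrN => h1 h2.
  have h3 : expR (- (n.+1%:R ^+ 2 / 4)) <= 4 * n.+1%:R^-1 :> R.
    have n1 : 1 <= n.+1%:R :> R by rewrite ler1n.
    rewrite expRN -[leLHS]div1r ler_pdivrMr ?expR_gt0// mulrAC ler_pdivlMr ?ltr0n//.
    by rewrite mul1r; have := expR_ge1Dx (n.+1%:R ^+ 2 / 4 : R); nra.
  have Ac0 : 0 <= A * c by rewrite mulr_ge0// normal_peak_ge0.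
  have h4 := ler_wpM2l Ac0 h3.
  apply: (le_trans (lerD (le_trans h2 h4) (le_trans h1 h4))).
  by rewrite le_eqVlt; apply/orP; left; apply/eqP; ring.
have cv0 : (fun n => (G n.+1%:R - G (- n.+1%:R))%:E) @ \oo --> 0%E.
  apply/cvg_EFin; first exact: nearW.
  apply: norm_cvg0; apply: (@squeeze_cvgr _ _ _ _ (fun=> 0) (fun n => 2 * (A * c) * (4 * n.+1%:R^-1))).
  - by apply: nearW => n; rewrite normr_ge0/=; exact: Gh.
  - exact: cvg_cst.
  - rewrite [X in _ --> X](_ : 0 = 2 * (A * c) * (4 * 0)); last by rewrite !mulr0.
    apply: cvgM; first exact: cvg_cst.
    by apply: cvgM; [exact: cvg_cst|exact: cvg_harmonic].
rewrite (_ : [sequence _]_n = (fun n => (G n.+1%:R - G (- n.+1%:R))%:E)) in cv; last first.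
  by apply/funext => n; exact: e.
exact: (cvg_unique _ cv cv0).
Qed.

End gauss_density.

Section gauss.
Context d (T : measurableType d) (R : realType) (Q : probability T R).
Variable Z : T -> R.
Hypothesis mZ : measurable_fun setT Z.
Hypothesis Zn : has_density Q Z (normal_pdf 0 1).

Lemma L1_gauss (g : R -> R) (A : R) : measurable_fun setT g ->
  (forall x, `|g x| <= A * expR (x ^+ 2 / 4)) -> L1 Q (fun w => g (Z w)).
Proof.
by move=> mg gA; have [] := Ex_density mZ Zn mg (integrable_gauss_growth mg gA).
Qed.

Lemma stein (psi psi' : R -> R) (A : R) :
  (forall x : R, is_derive x 1 psi (psi' x)) -> continuous psi' ->
  (forall x, `|psi x| <= A * expR (x ^+ 2 / 4)) ->
  (forall x, `|x * psi x| <= A * expR (x ^+ 2 / 4)) ->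
  (forall x, `|psi' x| <= A * expR (x ^+ 2 / 4)) ->
  Ex Q (fun w => Z w * psi (Z w)) = Ex Q (fun w => psi' (Z w)).
Proof.
move=> dpsi cpsi' h1 h2 h3.
have mpsi' : measurable_fun setT psi' by exact: continuous_measurable_fun.
have mpsi : measurable_fun setT psi.
  apply: continuous_measurable_fun => x.
  apply: differentiable_continuous; apply/derivable1_diffP.
  exact: (@ex_derive _ _ _ _ _ _ _ (dpsi x)).
have mxpsi : measurable_fun setT (fun x : R => x * psi x) by apply: measurable_funM.
have l2 := L1_gauss mxpsi h2; have l3 := L1_gauss mpsi' h3.
apply/eqP; rewrite -subr_eq0 -ExB//; apply/eqP.
have hb x : `|x * psi x - psi' x| <= 2 * A * expR (x ^+ 2 / 4).
  by apply: (le_trans (ler_normB _ _)); have := h2 x; have := h3 x; lra.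
have mg : measurable_fun setT (fun x : R => x * psi x - psi' x) by apply: measurable_funB.
have [_ E] := Ex_density mZ Zn mg (integrable_gauss_growth mg hb).
by rewrite [LHS]E /Rintegral (stein_integral dpsi cpsi' h1 h2 h3).
Qed.

(** From y^k / k! < e^y at y = x^2/4; the additive 1 covers |x| <= 1. *)
Lemma gauss_growth_pow (x : R) k : `|x ^+ k| <= (k`!%:R * 4 ^+ k + 1) * expR (x ^+ 2 / 4).
Proof.
have e1 : 1 <= expR (x ^+ 2 / 4) by rewrite -expR0 ler_expR divr_ge0// sqr_ge0.
have [x1|x1] := leP `|x| 1.
  rewrite normrX; apply: (@le_trans _ _ 1); first exact: exprn_ile1.
  apply: (le_trans e1); rewrite ler_peMl ?expR_ge0// lerDr.
  by rewrite mulr_ge0// exprn_ge0.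
have y0 : 0 <= x ^+ 2 / 4 by rewrite divr_ge0// sqr_ge0.
case: k => [|k]; first by rewrite expr0 normr1 fact0 expr0 mulr1; lra.
have h : (x ^+ 2 / 4) ^+ k.+1 <= (k.+1)`!%:R * expR (x ^+ 2 / 4).
  have f0 : 0 < (k.+1)`!%:R :> R by rewrite ltr0n fact_gt0.
  have := expR_ge1Dxn k y0; rewrite -ler_pdivrMl// mulrC; lra.
have -> : `|x ^+ k.+1| = `|x| ^+ k.+1 by rewrite normrX.
apply: (@le_trans _ _ (`|x| ^+ (2 * k.+1))).
  by rewrite mul2n -addnn exprD ler_peMr ?exprn_ge0// exprn_ege1// ltW.
have -> : `|x| ^+ (2 * k.+1) = 4 ^+ k.+1 * (x ^+ 2 / 4) ^+ k.+1.
  by rewrite -exprMn mulrC divfK// exprM real_normK// num_real.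
have p4 : 0 <= 4 ^+ k.+1 :> R by rewrite exprn_ge0.
apply: (le_trans (ler_wpM2l p4 h)); rewrite mulrDl mul1r mulrA [4 ^+ _ * _]mulrC.
by rewrite lerDl expR_ge0.
Qed.

Lemma L1_gauss_pow k : L1 Q (fun w => Z w ^+ k).
Proof.
apply: (L1_gauss (g := fun x => x ^+ k)) => [|x]; last exact: gauss_growth_pow.
exact: measurable_funX.
Qed.

Let growth0 (x : R) : 1 <= expR (x ^+ 2 / 4).
Proof. by rewrite -expR0 ler_expR divr_ge0// sqr_ge0. Qed.

Lemma gauss_second_moment : Ex Q (fun w => Z w ^+ 2) = 1.
Proof.
transitivity (Ex Q (fun w => Z w * Z w)).
  by congr Ex; apply/funext => w; rewrite expr2.
pose A : R := (1`!%:R * 4 ^+ 1 + 1) + (2`!%:R * 4 ^+ 2 + 1).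
rewrite (@stein id (fun=> 1) A) ?Ex_cst// => [x|x|x|x].
- exact: cvg_cst.
- have := gauss_growth_pow x 1; have := expR_ge0 (x ^+ 2 / 4).
  by rewrite /A !factS fact0 expr1 => ? ?; lra.
- have := gauss_growth_pow x 2; have := expR_ge0 (x ^+ 2 / 4).
  by rewrite /A -expr2 !factS fact0 => ? ?; lra.
- by rewrite normr1 /A !factS fact0; have := growth0 x; lra.
Qed.

Lemma gauss_fourth_moment : Ex Q (fun w => Z w ^+ 4) = 3.
Proof.
transitivity (Ex Q (fun w => Z w * Z w ^+ 3)).
  by congr Ex; apply/funext => w; rewrite exprS.
pose B k : R := k`!%:R * 4 ^+ k + 1.
have B0 k : 0 <= B k by rewrite addr_ge0// mulr_ge0// exprn_ge0.
transitivity (Ex Q (fun w => 3 * Z w ^+ 2)); last first.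
  by rewrite ExZ; [rewrite gauss_second_moment mulr1|exact: L1_gauss_pow].
apply: (@stein (fun x => x ^+ 3) (fun x => 3 * x ^+ 2) (3 * B 2%N + B 3%N + B 4%N)).
- by move=> x; apply: is_derive_eq; rewrite /GRing.scale/=; ring.
- by move=> x; apply: cvgM; [exact: cvg_cst|exact: exprn_continuous].
- move=> x; apply: (le_trans (gauss_growth_pow x 3)); rewrite ler_wpM2r ?expR_ge0//.
  by rewrite -/(B 3%N); have := B0 2%N; have := B0 4%N; lra.
- move=> x; rewrite -exprS; apply: (le_trans (gauss_growth_pow x 4)); rewrite ler_wpM2r ?expR_ge0//.
  by rewrite -/(B 4%N); have := B0 2%N; have := B0 3%N; lra.
- move=> x; rewrite normrM ger0_norm//.
  have := gauss_growth_pow x 2; rewrite -/(B 2%N) => h.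
  apply: (@le_trans _ _ (3 * (B 2%N * expR (x ^+ 2 / 4)))); first by rewrite ler_wpM2l.
  rewrite mulrA ler_wpM2r ?expR_ge0//.
  by have := B0 3%N; have := B0 4%N; lra.
Qed.

Lemma gauss_cos_ode (a th : R) :
  Ex Q (fun w => Z w * sin (th * Z w + a)) = th * Ex Q (fun w => cos (th * Z w + a)).
Proof.
have mc : measurable_fun setT (fun w => th * Z w + a).
  by apply: measurable_funD => //; exact: measurable_funM.
rewrite -ExZ; last by apply: bdm_L1; exact: bdm_cos.
pose A : R := 1 + `|th| + (1`!%:R * 4 ^+ 1 + 1).
have s1 (x : R) : `|sin (th * x + a)| <= 1 by exact: sin_max.
apply: (@stein (fun x => sin (th * x + a)) (fun x => th * cos (th * x + a)) A).
- by move=> x; apply: is_derive_eq; rewrite /GRing.scale/=; ring.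
- move=> x; apply: cvgM; first exact: cvg_cst.
  apply: (@cvg_comp _ _ _ (fun x => th * x + a) cos); last exact: continuous_cos.
  by apply: cvgD; [apply: cvgM; [exact: cvg_cst|exact: cvg_id]|exact: cvg_cst].
- move=> x; apply: (le_trans (s1 x)); have := growth0 x; have := normr_ge0 th.
  by rewrite /A !factS fact0; nra.
- move=> x; rewrite normrM.
  have h := gauss_growth_pow x 1; rewrite expr1 in h.
  have : `|x| * `|sin (th * x + a)| <= `|x| by rewrite ler_piMr.
  move/le_trans; apply; apply: (le_trans h); rewrite ler_wpM2r ?expR_ge0// /A.
  by have := normr_ge0 th; lra.
- move=> x; rewrite normrM; have h := cos_max (th * x + a).
  have : `|th| * `|cos (th * x + a)| <= `|th| by rewrite ler_piMr.
  move/le_trans; apply; have := growth0 x; have := normr_ge0 th.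
  by rewrite /A !factS fact0; nra.
Qed.

(** Stein's identity turns the derivative of g(t) = E cos(tZ + a) into -t g(t), so g(t) exp(t^2/2)
    is constant. *)
Lemma gauss_cf (a th : R) : Ex Q (fun w => cos (th * Z w + a)) = expR (- (th ^+ 2 / 2)) * cos a.
Proof.
pose g t := Ex Q (fun w => cos (t * Z w + a)).
have mc t : measurable_fun setT (fun w => t * Z w + a).
  by apply: measurable_funD => //; exact: measurable_funM.
have lc t := bdm_L1 Q (bdm_cos (mc t)).
have ls t : L1 Q (fun w => Z w * sin (t * Z w + a)).
  apply: (L1_le (Y := Z)).
  - by apply: measurable_funM => //; case: (bdm_sin (mc t)).
  - by have := L1_gauss_pow 1; under eq_fun do rewrite expr1.
  - by move=> w; rewrite normrM ler_piMr// sin_max.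
have cosb (y h : R) : `|cos (y + h) - cos y + h * sin y| <= 3 * h ^+ 2.
  rewrite cosD [X in `|X|](_ : _ = cos y * (cos h - 1) - sin y * (sin h - h)); last by ring.
  apply: (le_trans (ler_normB _ _)); rewrite !normrM.
  have h1 : `|cos h - 1| <= h ^+ 2.
    have := cos_ge h; have := cos_le1 h; have := sqr_ge0 h.
    by move=> *; rewrite ler_norml; apply/andP; split; lra.
  have h2 := sin_sub_sqr h.
  have : `|cos y| * `|cos h - 1| <= 1 * h ^+ 2 by apply: ler_pM => //; exact: cos_max.
  have : `|sin y| * `|sin h - h| <= 1 * (2 * h ^+ 2) by apply: ler_pM => //; exact: sin_max.
  lra.
(* A first-order expansion with remainder at most 3 h^2 Z^2 inside the expectation; as E Z^2 = 1, it
   yields the derivative of [g] by a direct estimate. *)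
have gq t h : `|g (t + h) - g t + h * (t * g t)| <= 3 * h ^+ 2.
  rewrite /g -gauss_cos_ode -!ExZ -?ExB -?ExD//; try (by apply: L1Z); try (by apply: L1B).
  apply: (le_trans (norm_Ex_le (Y := fun w => 3 * h ^+ 2 * Z w ^+ 2) _ _ _)).
  - by apply: L1D; [apply: L1B|apply: L1Z].
  - by apply: L1Z; exact: L1_gauss_pow.
  - move=> w; have := cosb (t * Z w + a) (h * Z w).
    rewrite (_ : t * Z w + a + h * Z w = (t + h) * Z w + a); last by ring.
    by rewrite exprMn !mulrA.
  by rewrite ExZ ?gauss_second_moment ?mulr1//; exact: L1_gauss_pow.
have dg (t : R) : is_derive t 1 g (- (t * g t)).
  have cv : h^-1 *: ((g \o shift t) (h *: (1 : R)) - g t) @[h --> (0 : R)^'] --> - (t * g t).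
    apply/cvgrPdist_le => e e0.
    near=> h.
    have h0 : h != 0 by near: h; exact: nbhs_dnbhs_neq.
    have he : `|h| <= e / 3.
      near: h; apply: dnbhs0_le; rewrite divr_gt0//.
    rewrite /= /shift /GRing.scale/= mulr1 addrC.
    rewrite (_ : _ - _ = - (h^-1 * (g (t + h) - g t + h * (t * g t)))); last first.
      by rewrite [h + t]addrC; field.
    rewrite normrN normrM normfV ler_pdivrMl ?normr_gt0//.
    apply: (le_trans (gq t h)); rewrite -(real_normK (num_real h)).
    have := normr_ge0 h; nra.
  apply: DeriveDef; first by apply/cvg_ex; exists (- (t * g t)).
  exact: cvg_lim cv.
pose H t := g t * expR (t ^+ 2 / 2).
have dH (t : R) : is_derive t 1 H 0.
  by apply: is_derive_eq; rewrite /GRing.scale/= ?expr1; field.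
have := is_derive_0_is_cst th 0 dH; rewrite /H expr0n/= mul0r expR0 mulr1.
have -> : g 0 = cos a.
  rewrite -[RHS](Ex_cst Q); congr Ex; apply/funext => w; by rewrite mul0r add0r.
move=> <-; rewrite mulrC expRN mulfK//.
by rewrite gt_eqF// expR_gt0.
Unshelve. all: by end_near.
Qed.

End gauss.

(** * Moments and tails of centred chi-squared sums *)

Section chi_square.
Context d (T : measurableType d) (R : realType) (Q : probability T R).
Variable Z : nat -> T -> R.
Hypothesis iZ : mutually_independent Q Z.
Hypothesis nZ : forall j, has_density Q (Z j) (normal_pdf 0 1).

Let mZ j : measurable_fun setT (Z j). Proof. exact: iZ.1. Qed.

Let xi j w : R := Z j w ^+ 2 - 1.

Let mxi j : measurable_fun setT (xi j).
Proof. by apply: measurable_funB => //; exact: measurable_funX. Qed.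

Let L1_xi_pow j k : L1 Q (fun w => xi j w ^+ k).
Proof.
rewrite /xi; under eq_fun do rewrite exprBn.
apply: L1_sum => i _; under eq_fun do rewrite expr1n mulr1 -exprM -mulr_natr mulrC.
by apply: L1Z; apply: L1Z; apply: L1_gauss_pow => //.
Qed.

Let L1_xi j : L1 Q (xi j).
Proof. by have := L1_xi_pow j 1; under eq_fun do rewrite expr1. Qed.

Let Ex_xi j : Ex Q (xi j) = 0.
Proof.
rewrite /xi ExB; [|by apply: L1_gauss_pow|exact: L1_cst].
by rewrite gauss_second_moment// Ex_cst subrr.
Qed.

Let Ex_xi2 j : Ex Q (fun w => xi j w ^+ 2) = 2.
Proof.
transitivity (Ex Q (fun w => (Z j w ^+ 4 - 2 * Z j w ^+ 2) + 1)).
  by congr Ex; apply/funext => w; rewrite /xi; ring.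
have l4 := L1_gauss_pow (mZ j) (nZ j) 4; have l2 := L1_gauss_pow (mZ j) (nZ j) 2.
rewrite ExD ?ExB ?ExZ ?Ex_cst//; [|exact: L1Z|by apply: L1B => //; exact: L1Z|exact: L1_cst].
by rewrite gauss_second_moment// gauss_fourth_moment//; lra.
Qed.

Let msq1 : measurable_fun setT (fun x : R => x ^+ 2 - 1).
Proof. by apply: measurable_funB => //; exact: measurable_funX. Qed.

Let indep_xi i j : i != j -> indep Q (xi i) (xi j).
Proof. by move=> ij; exact: (indep_comp (indep_coord iZ ij) msq1 msq1). Qed.

Lemma chi2_second_moment (r : seq nat) : uniq r ->
  L1 Q (fun w => (\sum_(j <- r) xi j w) ^+ 2) /\
  Ex Q (fun w => (\sum_(j <- r) xi j w) ^+ 2) = 2 * (size r)%:R.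
Proof.
move=> ur.
have l i j : L1 Q (fun w => xi i w * xi j w).
  have [->|ij] := eqVneq i j.
    by have := L1_xi_pow j 2; under eq_fun do rewrite expr2.
  exact: (indep_ExM (indep_xi ij) (L1_xi i) (L1_xi j)).1.
split; first exact: (Ex_sqr_sum r (p := predT) (fun i j _ _ => l i j)).1.
rewrite Ex_sqr_uncorrelated//.
  by under eq_bigr do rewrite Ex_xi2; rewrite big_const_seq count_predT iter_addr_0 mulr_natr.
by move=> i j ij; rewrite (indep_ExM (indep_xi ij) (L1_xi i) (L1_xi j)).2 Ex_xi mul0r.
Qed.

Let X j w : R := \sum_(0 <= k < j) xi k w.

Let indepX j : indep Q (X j) (xi j).
Proof.
have jn : j \notin index_iota 0 j by rewrite mem_index_iota ltnn andbF.
have h := indep_sum iZ (g := fun _ x => x ^+ 2 - 1) (fun _ => msq1) jn.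
have mid : measurable_fun setT (@idfun R) by exact: measurable_id.
exact: (indep_comp h mid msq1).
Qed.

Let L1_X_pow j k : L1 Q (fun w => X j w ^+ k).
Proof.
elim: j k => [|j IH] k.
  by rewrite /X; under eq_fun do rewrite big_geq//; exact: L1_cst.
rewrite /X; under eq_fun do rewrite big_nat_recr//= exprDn.
apply: L1_sum => i _; under eq_fun do rewrite -mulr_natl; apply: L1Z.
have me n : measurable_fun setT (fun x : R => x ^+ n) by exact: measurable_funX.
exact: (indep_ExM (indep_comp (indepX j) (me _) (me _)) (IH _) (L1_xi_pow _ _)).1.
Qed.

Let Ex_X j : Ex Q (X j) = 0.
Proof. by rewrite /X Ex_sum ?big1. Qed.

Let Ex_X2 j : Ex Q (fun w => X j w ^+ 2) = 2 * j%:R.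
Proof.
by rewrite (chi2_second_moment (iota_uniq _ _)).2 size_iota subn0.
Qed.

(** By independence and centring, adding a term increases the fourth moment by 6 E X_j^2 E xi^2 + E
    xi^4 = 24 j plus a constant, so the growth is quadratic in [j]. *)
Lemma chi2_fourth_moment : exists K : R, forall j,
  Ex Q (fun w => (\sum_(0 <= k < j) (Z k w ^+ 2 - 1)) ^+ 4) <= K * j%:R ^+ 2.
Proof.
pose A : R := (8`!%:R * 4 ^+ 8 + 1).
have [K0 K0P] : exists K, forall j, Ex Q (fun w => xi j w ^+ 4) <= K.
  exists (8 * Ex Q (fun w => Z 0 w ^+ 8) + 8) => j.
  have -> : Ex Q (fun w => Z 0 w ^+ 8) = Ex Q (fun w => Z j w ^+ 8).
    have mg : measurable_fun setT (fun x : R => x ^+ 8) by exact: measurable_funX.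
    have ig := integrable_gauss_growth mg (fun x => gauss_growth_pow x 8).
    have [_ e0] := Ex_density (mZ 0) (nZ 0) mg ig.
    have [_ ej] := Ex_density (mZ j) (nZ j) mg ig.
    exact: etrans e0 (esym ej).
  have l8 := L1_gauss_pow (mZ j) (nZ j) 8.
  rewrite -ExZ// -[X in _ + X](Ex_cst Q) -ExD; [|exact: L1Z|exact: L1_cst].
  apply: le_Ex => //; first by apply: L1D; [exact: L1Z|exact: L1_cst].
  move=> w; rewrite /xi (_ : Z j w ^+ 8 = (Z j w ^+ 2) ^+ 4); last by ring.
  set y := Z j w ^+ 2; have y0 : 0 <= y by exact: sqr_ge0.
  have h1 : (y - 1) ^+ 2 <= y ^+ 2 + 1 by nra.
  have h2 : ((y - 1) ^+ 2) ^+ 2 <= (y ^+ 2 + 1) ^+ 2.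
    by rewrite ler_pXn2r// nnegrE ?sqr_ge0// addr_ge0// sqr_ge0.
  rewrite (_ : (y - 1) ^+ 4 = ((y - 1) ^+ 2) ^+ 2); last by ring.
  rewrite (_ : y ^+ 4 = (y ^+ 2) ^+ 2); last by ring.
  have := sqr_ge0 (y ^+ 2 - 1); nra.
have K00 : 0 <= K0.
  by apply: le_trans (K0P 0%N); apply: Ex_ge0 => w; rewrite exprn_even_ge0.
exists (12 + K0); elim=> [|j IH].
  by under [X in Ex Q X]eq_fun do rewrite big_geq// expr0n; rewrite Ex_cst expr0n/= mulr0.
rewrite -/(X _) in IH *.
have me n : measurable_fun setT (fun x : R => x ^+ n) by exact: measurable_funX.
have iXx a b := indep_ExM (indep_comp (indepX j) (me a) (me b)) (L1_X_pow j a) (L1_xi_pow j b).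
have lp a b : L1 Q (fun w => X j w ^+ a * xi j w ^+ b) by exact: (iXx a b).1.
have ep a b : Ex Q (fun w => X j w ^+ a * xi j w ^+ b) =
  Ex Q (fun w => X j w ^+ a) * Ex Q (fun w => xi j w ^+ b) by exact: (iXx a b).2.
have -> : Ex Q (fun w => (\sum_(0 <= k < j.+1) (Z k w ^+ 2 - 1)) ^+ 4) =
   Ex Q (fun w => X j w ^+ 4) + 12 * (2 * j%:R) + Ex Q (fun w => xi j w ^+ 4).
  transitivity (Ex Q (fun w => (((X j w ^+ 4 + 4 * (X j w ^+ 3 * xi j w ^+ 1))
     + 6 * (X j w ^+ 2 * xi j w ^+ 2)) + 4 * (X j w ^+ 1 * xi j w ^+ 3)) + xi j w ^+ 4)).
    by congr Ex; apply/funext => w; rewrite big_nat_recr//= -/(X j w) -/(xi j w); ring.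
  rewrite !ExD ?ExZ//; try (by do ?apply: L1D => //; apply: L1Z).
  rewrite !ep.
  rewrite Ex_X2 Ex_xi2.
  have -> : Ex Q (fun w => X j w ^+ 1) = 0 by under [X in Ex Q X]eq_fun do rewrite expr1; exact: Ex_X.
  have -> : Ex Q (fun w => xi j w ^+ 1) = 0 by under [X in Ex Q X]eq_fun do rewrite expr1; exact: Ex_xi.
  by ring.
have := K0P j; rewrite -natr1; have : 0 <= j%:R :> R by []; nra.
Qed.

(* A quartic that is nonpositive on the negative axis and has positive
   expectation bounds the upper tail probability from below. *)
Lemma chi2_tail_lower : exists c dl : R, [/\ 0 < c, 0 < dl & forall j, (0 < j)%N ->
  c <= pr Q [set w | dl * Num.sqrt j%:R < \sum_(0 <= k < j) (Z k w ^+ 2 - 1)]].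
Proof.
have [K' K'P] := chi2_fourth_moment.
pose K := Num.max K' 1; have K1 : 1 <= K by rewrite le_max lexx orbT.
have KP j : Ex Q (fun w => X j w ^+ 4) <= K * j%:R ^+ 2.
  apply: (le_trans (K'P j)); rewrite ler_wpM2r ?sqr_ge0//.
  by rewrite le_max lexx.
pose pm := 4 * K ^+ 3.
have pm0 : 0 < pm by rewrite mulr_gt0// exprn_gt0//; lra.
exists (1 / (2 * pm)), ((4 * K)^-1); split; first by rewrite divr_gt0// mulr_gt0.
  by rewrite invr_gt0; lra.
move=> j j0; set dl := (4 * K)^-1; set s := Num.sqrt j%:R.
have jR : 0 < j%:R :> R by rewrite ltr0n.
have s0 : 0 < s by rewrite sqrtr_gt0.
have s2 : s ^+ 2 = j%:R by rewrite sqr_sqrtr// ltW.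
pose B w : bool := dl * s < X j w.
have mX : measurable_fun setT (X j) by case: (indepX j).
have mB : measurable_fun setT B by apply: measurable_fun_ltr.
have lB := bdm_L1 Q (bdm_bool R mB).
rewrite -(Ex_bool Q mB).
(* With y = X_j / sqrt j the quartic is K y + y^2 - y^4 / K. Its mean is at least 2 - 1, as y has
   mean 0, second moment 2 and fourth moment at most K. It stays below 1/2 for y <= 1/(4K) and below
   [pm] plus 1/2 elsewhere, so [pm] times the tail probability is at least 1/2. *)
have poly w : K / s * X j w + (s ^+ 2)^-1 * X j w ^+ 2 - (K * s ^+ 4)^-1 * X j w ^+ 4
    <= 2^-1 + pm * (B w)%:R.
  have -> : X j w = s * (X j w / s) by rewrite mulrC divfK// gt_eqF.
  set y := X j w / s.
  have -> : K / s * (s * y) + (s ^+ 2)^-1 * (s * y) ^+ 2 - (K * s ^+ 4)^-1 * (s * y) ^+ 4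
     = K * y + y ^+ 2 - y ^+ 4 / K.
    by field; rewrite !gt_eqF//; lra.
  have y4 : y ^+ 4 / K * K = (y ^+ 2) ^+ 2.
    by rewrite divfK; [ring|rewrite gt_eqF//; lra].
  have q0 : 0 <= y ^+ 4 / K by rewrite divr_ge0// ?exprn_even_ge0//; lra.
  have := sqr_ge0 y; set Y := y ^+ 2 in y4 *; set q := y ^+ 4 / K in y4 q0 * => Y0.
  rewrite /B; case: ltP => By /=; rewrite ?mulr1 ?mulr0 ?addr0.
    have yY : y <= 1 + Y by rewrite /Y; have := sqr_ge0 (y - 1); nra.
    have h1 : K * y <= K + K * Y by nra.
    have h2 : (K + 1) * Y <= q + K ^+ 3.
      have h3 : 4 * ((K + 1) * Y) <= 4 * q + 4 * K ^+ 3.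
        have : K * (4 * ((K + 1) * Y)) <= K * (4 * q + 4 * K ^+ 3).
          have hK : K ^+ 2 * (K + 1) ^+ 2 <= K ^+ 2 * (4 * K ^+ 2).
            by apply: ler_wpM2l; [exact: sqr_ge0|nra].
          have hY := sqr_ge0 (2 * Y - K * (K + 1)).
          have -> : K * (4 * q + 4 * K ^+ 3) = 4 * Y ^+ 2 + K ^+ 2 * (4 * K ^+ 2).
            by rewrite -y4; ring.
          apply: le_trans (lerD (lexx _) hK); rewrite -subr_ge0; apply: le_trans hY _.
          by rewrite le_eqVlt; apply/orP; left; apply/eqP; ring.
        by rewrite ler_pM2l//; lra.
      lra.
    have K3 : K <= K ^+ 3 by rewrite exprS ler_peMr//; [lra|rewrite exprn_ege1].
    by rewrite /pm; nra.
  have yd : y <= dl by rewrite /y ler_pdivrMr.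
  have dK : 4 * K * dl = 1 by rewrite /dl mulfV// gt_eqF//; lra.
  have [y0|y0] := leP 0 y.
    have d1 : dl <= 1 by rewrite /dl invf_le1//; lra.
    have : Y <= y * dl by rewrite /Y expr2; apply: ler_wpM2l.
    have : K * y <= K * dl by apply: ler_wpM2l => //; lra.
    have : y * dl <= dl * dl by apply: ler_wpM2r => //; rewrite /dl invr_ge0; lra.
    have : dl <= 4^-1 by nra.
    by nra.
  have [yK|yK] := leP (- K) y.
    have : Y <= - K * y by rewrite /Y; nra.
    by lra.
  have KY : K <= Y by rewrite /Y; nra.
  have : Y * K <= q * K by rewrite y4 expr2; apply: ler_wpM2l.
  by rewrite ler_pM2r; [nra|lra].
have l1 := L1_X_pow j 1; have l2 := L1_X_pow j 2; have l4 := L1_X_pow j 4.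
have lX : L1 Q (X j) by move: l1; under eq_fun do rewrite expr1.
have a1 : L1 Q (fun w => K / s * X j w + (s ^+ 2)^-1 * X j w ^+ 2) by apply: L1D; apply: L1Z.
have a2 : L1 Q (fun w => (K * s ^+ 4)^-1 * X j w ^+ 4) by apply: L1Z.
have a3 : L1 Q (fun w => pm * (B w)%:R) by apply: L1Z.
have H := le_Ex (L1B a1 a2) (L1D (L1_cst Q 2^-1) a3) poly.
rewrite (ExB a1 a2) (ExD (L1_cst Q 2^-1) a3) ExD ?ExZ// in H; try exact: L1Z.
rewrite Ex_cst Ex_X Ex_X2 in H.
have h4 : (K * s ^+ 4)^-1 * Ex Q (fun w => X j w ^+ 4) <= 1.
  rewrite ler_pdivrMl ?mulr_gt0 ?exprn_gt0//; last by lra.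
  by rewrite mulr1 (_ : s ^+ 4 = (s ^+ 2) ^+ 2); [rewrite s2|ring].
have h2 : (s ^+ 2)^-1 * (2 * j%:R) = 2 by rewrite s2; field; rewrite gt_eqF.
rewrite h2 mulr0 add0r in H.
by rewrite ler_pdivrMr ?mulr_gt0//; lra.
Qed.

End chi_square.

Lemma measurable_set_bool d (T : measurableType d) (p : T -> bool) :
  measurable_fun setT p -> measurable [set w | p w].
Proof. by move=> mp; have := mp measurableT [set true] I; rewrite setTI. Qed.

(** * The critical value exceeds one *)

Section quantile.
Context d (T : measurableType d) (R : realType) (Q : probability T R).
Variable Z : nat -> T -> R.
Hypothesis iZ : mutually_independent Q Z.
Hypothesis nZ : forall j, has_density Q (Z j) (normal_pdf 0 1).

Let S j w : R := \sum_(k < j) Z k w ^+ 2.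

Let mS j : measurable_fun setT (S j).
Proof. by apply: measurable_sum => k; apply: measurable_funX; exact: iZ.1. Qed.

Let mtail j (x : R) : measurable [set w | x < S j w].
Proof. by apply: measurable_set_bool; apply: measurable_fun_ltr. Qed.

Lemma EFin_chi2_tail j x : chi2_tail Q Z j x = (pr Q [set w | x < S j w])%:E.
Proof. by rewrite EFin_pr. Qed.

Lemma sum_sqr_sub1 j w : \sum_(0 <= k < j) (Z k w ^+ 2 - 1) = S j w - j%:R.
Proof. by rewrite sumrB big_mkord sumr_const_nat subn0. Qed.

Lemma chi2_tail_upper j (t : R) : (0 < j)%N -> 1 < t ->
  pr Q [set w | j%:R * t < S j w] <= 2 / (t - 1) ^+ 2 * j%:R^-1.
Proof.
move=> j0 t1; have jR : 0 < j%:R :> R by rewrite ltr0n.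
have [l e] := chi2_second_moment iZ nZ (iota_uniq 0 j); rewrite size_iota in e.
have c0 : 0 < (j%:R * (t - 1)) ^+ 2 by rewrite exprn_gt0// mulr_gt0// subr_gt0.
have mf := L1_measurable l.
have := markov_pr l (fun w => sqr_ge0 _) c0; rewrite e => h.
apply: le_trans (le_trans h _).
  apply: le_pr => //.
    by rewrite -[X in measurable X]setTI; apply: measurable_fun_le.
  move=> w /= jt; have := sum_sqr_sub1 j w; rewrite /index_iota subn0 => ->.
  have h1 : j%:R * (t - 1) <= S j w - j%:R by rewrite mulrBr mulr1; lra.
  have h0 : 0 <= j%:R * (t - 1) by rewrite mulr_ge0// subr_ge0 ltW.
  by rewrite ler_pXn2r// nnegrE// (le_trans h0).
rewrite le_eqVlt; apply/orP; left; apply/eqP; field.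
by rewrite !gt_eqF//; lra.
Qed.

(** Chebyshev bounds the series by 2/(t-1)^2 times the sum of 1/j^2. It shows that the set defining
    the quantile is inhabited, so that its [inf] is not a default value. *)
Lemma Gfun_ge (t alpha : R) : 1 < t -> 4 / (t - 1) ^+ 2 <= alpha ->
  ((1 - alpha)%:E <= Gfun Q Z t)%E.
Proof.
move=> t1 ta; rewrite /Gfun.
set s := (\sum_(1 <= j <oo) _)%E.
have t10 : 0 < (t - 1) ^+ 2 by rewrite exprn_gt0// subr_gt0.
have sle : (s <= (4 / (t - 1) ^+ 2)%:E)%E.
  apply: lime_le; first by apply: is_cvg_nneseries => j _ _; rewrite EFin_chi2_tail lee_fin mulr_ge0// pr_ge0.
  apply: nearW => N; rewrite (eq_bigr (fun j => (j%:R^-1 * pr Q [set w | j%:R * t < S j w])%:E)); last first.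
    by move=> j _; rewrite EFin_chi2_tail.
  rewrite sumEFin lee_fin.
  apply: (@le_trans _ _ (\sum_(1 <= j < N) 2 / (t - 1) ^+ 2 * (j%:R ^+ 2)^-1)).
    rewrite big_nat_cond [leRHS]big_nat_cond; apply: ler_sum => j /andP[/andP[j0 _] _].
    have := chi2_tail_upper j0 t1; have jR : 0 < j%:R :> R by rewrite ltr0n.
    move=> /(ler_wpM2l (ltW (_ : 0 < j%:R^-1))); rewrite invr_gt0 => /(_ jR) h.
    apply: (le_trans h); rewrite le_eqVlt; apply/orP; left; apply/eqP; field.
    by rewrite !gt_eqF//; lra.
  rewrite -mulr_sumr; have := sum_inv_sqr_le R N (ltn0Sn 0) => h.
  apply: (le_trans (ler_wpM2l _ h)); first by rewrite divr_ge0// ltW.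
  by rewrite divr1 mulrAC -natrM.
apply: (@le_trans _ _ (expeR (- (4 / (t - 1) ^+ 2)%:E))%E).
  by rewrite /= lee_fin; have := expR_ge1Dx (- (4 / (t - 1) ^+ 2)); lra.
by rewrite lee_expeR leeN2.
Qed.

(** For t < 1 + dl/N and j < N one has j t <= j + dl sqrt j, so each of these tails is at least [c]
    and the series at least [c] times a harmonic sum. [N] makes this exceed L = 1/(1 - alpha), and
    exp(-L) < 1/L. *)
Lemma Gfun_le (alpha : R) : 0 < alpha < 1 ->
  exists2 t0, 1 < t0 & forall t, ((1 - alpha)%:E <= Gfun Q Z t)%E -> t0 <= t.
Proof.
move=> /andP[a0 a1]; have [c [dl [c0 dl0 tl]]] := chi2_tail_lower iZ nZ.
pose L : R := (1 - alpha)^-1.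
have [N [N0 hN]] : exists N, (0 < N)%N /\ L / c < \sum_(1 <= j < N) j%:R^-1 :> R.
  apply/not_existsP => H.
  have nd : nondecreasing_seq (series (@harmonic R)).
    by apply/nondecreasing_seqP => n; rewrite seriesSr lerDl harmonic_ge0.
  apply: (@dvg_harmonic R); apply: nondecreasing_is_cvgn => //.
  exists (L / c) => _ [n _ <-]; rewrite leNgt; apply/negP => h.
  apply: (H n.+1); split => //; apply: (lt_le_trans h).
  by rewrite /series/= big_add1/=.
have NR : 0 < N%:R :> R by rewrite ltr0n.
exists (1 + dl / N%:R); first by rewrite ltrDl divr_gt0.
move=> t; apply: contraTle => tt0; rewrite -ltNge /Gfun.
set s := (\sum_(1 <= j <oo) _)%E.
have nn j : (0 <= (j%:R^-1)%:E * chi2_tail Q Z j (j%:R * t))%E.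
  by rewrite EFin_chi2_tail lee_fin mulr_ge0// pr_ge0.
have sge : (L%:E <= s)%E.
  apply: (@le_trans _ _ (\sum_(1 <= j < N) (j%:R^-1)%:E * chi2_tail Q Z j (j%:R * t))%E); last first.
    by apply: nneseries_lim_ge => j _ _.
  rewrite (eq_bigr (fun j => (j%:R^-1 * pr Q [set w | j%:R * t < S j w])%:E)); last first.
    by move=> j _; rewrite EFin_chi2_tail.
  rewrite sumEFin lee_fin.
  apply: (@le_trans _ _ (\sum_(1 <= j < N) j%:R^-1 * c)).
    by rewrite -mulr_suml -ler_pdivrMr// ltW.
  rewrite big_nat_cond [leRHS]big_nat_cond; apply: ler_sum => j /andP[/andP[j0 jN] _].
  apply: ler_wpM2l; first by rewrite invr_ge0.
  apply: (le_trans (tl j j0)); apply: le_pr => //.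
    apply: measurable_set_bool; apply: measurable_fun_ltr => //.
    by under eq_fun do rewrite sum_sqr_sub1; apply: measurable_funB.
  move=> w /=; rewrite sum_sqr_sub1 => h.
  have jR : 1 <= j%:R :> R by rewrite ler1n.
  have sj : j%:R <= N%:R * Num.sqrt j%:R :> R.
    have s1 : 1 <= Num.sqrt j%:R :> R by rewrite -[leLHS]sqrtr1; apply: ler_wsqrtr.
    have jN' : j%:R <= N%:R :> R by rewrite ler_nat ltnW.
    apply: (le_trans jN'); rewrite ler_peMr// ltW//.
  have : j%:R * t <= j%:R + j%:R * (dl / N%:R).
    by rewrite -[X in X + _]mulr1 -mulrDr; apply: ler_wpM2l => //; exact: ltW.
  have : j%:R * (dl / N%:R) <= dl * Num.sqrt j%:R.
    rewrite mulrA ler_pdivrMr// [leLHS]mulrC -mulrA; apply: ler_wpM2l; first exact: ltW.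
    by rewrite mulrC.
  lra.
apply: (@le_lt_trans _ _ (expeR (- L%:E))%E); first by rewrite lee_expeR leeN2.
rewrite /= lte_fin expRN invf_plt ?posrE ?expR_gt0 ?subr_gt0// -/L.
by have := expR_ge1Dx L; lra.
Qed.

(* The maximal inequality only controls large [m] above a level exceeding [1]. *)
Lemma quantile_gt1 (alpha : R) : 0 < alpha < 1 -> 1 < quantileG Q Z alpha.
Proof.
move=> a01; have [t0 t01 h] := Gfun_le a01; apply: (lt_le_trans t01).
rewrite /quantileG; apply: lb_le_inf; last by move=> t /h.
have /andP[a0 a1] := a01.
exists (1 + 4 / alpha); apply: Gfun_ge.
  by rewrite ltrDl divr_gt0.
rewrite addrAC subrr add0r expr_div_n ler_pdivrMr; last by rewrite divr_gt0// exprn_gt0.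
rewrite mulrA ler_pdivlMr ?exprn_gt0//; nra.
Qed.

End quantile.

(** * Rank kernels *)

Section iid.
Context d (T : measurableType d) (R : realType) (P : probability T R).
Local Notation mu := (@lebesgue_measure R).
Variables (e : nat -> T -> R) (f : R -> R).
Hypothesis ie : mutually_independent P e.
Hypothesis fe : forall i, has_density P (e i) f.

Let me_ j : measurable_fun setT (e j). Proof. exact: ie.1. Qed.

Lemma integrable_density : mu.-integrable setT (EFin \o f).
Proof.
have [f0 [mf fE]] := fe 0; apply/integrableP; split; first exact/measurable_EFinP.
have := fE setT measurableT; rewrite preimage_setT probability_setT => E.
apply: (@le_lt_trans _ _ 1%E); last exact: ltry.
rewrite E le_eqVlt; apply/orP; left; apply/eqP.
by apply: eq_integral => x _; rewrite /= ger0_norm.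
Qed.

Lemma Ex_same_law (g : R -> R) i : bdm g ->
  Ex P (fun w => g (e i w)) = Ex P (fun w => g (e 0%N w)).
Proof.
move=> [mg [B gB]]; have [f0 [mf _]] := fe 0.
have ig : mu.-integrable setT (fun x => (g x * f x)%:E).
  have := integrable_density; move/(integrableZl measurableT B).
  apply: le_integrable => //; first by apply/measurable_EFinP; apply: measurable_funM.
  move=> x _; rewrite -EFinM /= lee_fin; apply: le_trans (ler_norm _).
  by rewrite normrM (ger0_norm (f0 x)); apply: ler_wpM2r.
have [_ E0] := Ex_density (me_ 0) (fe 0) mg ig.
have [_ Ei] := Ex_density (me_ i) (fe i) mg ig.
exact: etrans Ei (esym E0).
Qed.

Lemma bdm_section1 (Phi : R * R -> R) x : bdm Phi -> bdm (fun y => Phi (x, y)).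
Proof.
move=> [mPhi [B PhiB]]; split; last by exists B => y; exact: PhiB.
by apply: (measurableT_comp mPhi); apply: measurable_fun_pair.
Qed.

(** Any two distinct errors are reduced to two copies of [e 0], evaluated at independent sample
    points; all pairs thus share the same expectation. *)
Lemma Ex_pair (Phi : R * R -> R) i k : bdm Phi -> i != k ->
  Ex P (fun w => Phi (e i w, e k w)) =
  Ex P (fun w => Ex P (fun w' => Phi (e 0%N w, e 0%N w'))).
Proof.
move=> bPhi ik; rewrite (Ex_indep (indep_coord ie ik) bPhi).
have bE := bdm_Ex P (me_ 0) bPhi.
rewrite -(Ex_same_law i bE); congr Ex; apply/funext => w.
exact: (Ex_same_law k (bdm_section1 (e i w) bPhi)).
Qed.

Lemma Ex_pair01 (Phi : R * R -> R) i k : bdm Phi -> i != k ->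
  Ex P (fun w => Phi (e i w, e k w)) = Ex P (fun w => Phi (e 0%N w, e 1%N w)).
Proof. by move=> bPhi ik; rewrite !Ex_pair. Qed.

Lemma density_no_atom i x : Ex P (fun w => (e i w == x)%:R) = 0.
Proof.
have [f0 [mf fE]] := fe i.
have mp : measurable_fun setT (fun w => e i w == x).
  rewrite (_ : (fun w => e i w == x) = (fun w => (e i w <= x) && (x <= e i w))); last first.
    by apply/funext => w; rewrite -eq_le.
  by apply: measurable_and; apply: measurable_fun_ler.
rewrite Ex_bool// /pr (_ : [set w | e i w == x] = e i @^-1` [set x]); last first.
  by apply/seteqP; split => w /= /eqP.
by rewrite fE// integral_set1.
Qed.

Definition cdfe (x : R) : R := Ex P (fun w => (e 0%N w <= x)%R%:R).

Let ble : bdm (fun z : R * R => (z.2 <= z.1)%R%:R : R).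
Proof. by apply: bdm_le. Qed.

Lemma bdm_cdfe : bdm cdfe.
Proof. exact: (bdm_Ex P (me_ 0) ble). Qed.

Lemma cdfe_ge0 x : 0 <= cdfe x.
Proof. by apply: Ex_ge0. Qed.

Lemma cdfe_le1 x : cdfe x <= 1.
Proof.
rewrite -(Ex_cst P 1); apply: le_Ex => [||w]; last by case: (e 0%N w <= x); rewrite ?ler01.
  by apply: bdm_L1; apply: bdm_le.
exact: L1_cst.
Qed.

Lemma cdfeE k x : Ex P (fun w => (e k w <= x)%R%:R) = cdfe x.
Proof. by apply: (@Ex_same_law (fun y : R => (y <= x)%R%:R) k); apply: bdm_le. Qed.

(** Exchanging the two errors preserves the probability, and the two opposite inequalities together
    have probability 1 because ties have probability 0. *)
Lemma Ex_le_half i k : i != k -> Ex P (fun w => (e k w <= e i w)%R%:R) = 2^-1.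
Proof.
move=> ik; have ki : k != i by rewrite eq_sym.
pose Phi (z : R * R) : R := (z.2 <= z.1)%R%:R.
pose Psi (z : R * R) : R := (z.2 == z.1)%:R.
have bPsi : bdm Psi.
  rewrite (_ : Psi = (fun z => (z.2 <= z.1)%R%:R * (z.1 <= z.2)%R%:R)); last first.
    by apply/funext => z; rewrite /Psi eq_le; case: (_ <= _); case: (_ <= _); rewrite ?mulr1 ?mulr0.
  by apply: bdmM; apply: bdm_le.
have E1 : Ex P (fun w => Phi (e i w, e k w)) = Ex P (fun w => Phi (e k w, e i w)).
  by rewrite (Ex_pair ble ik) (Ex_pair ble ki).
have E0 : Ex P (fun w => Psi (e i w, e k w)) = 0.
  rewrite (Ex_indep (indep_coord ie ik) bPsi) -[RHS](Ex_cst P); congr Ex; apply/funext => w.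
  exact: density_no_atom.
have E2 : Ex P (fun w => Phi (e i w, e k w) + Phi (e k w, e i w)) = Ex P (fun w => 1 + Psi (e i w, e k w)).
  congr Ex; apply/funext => w; rewrite /Phi /Psi/=.
  by case: (ltgtP (e k w) (e i w)) => //=; rewrite ?addr0 ?add0r.
have l1 := bdm_L1 P (bdm_comp2 ie i k ble); have l2 := bdm_L1 P (bdm_comp2 ie k i ble).
have l3 := bdm_L1 P (bdm_comp2 ie i k bPsi).
rewrite ExD// ExD// in E2; last exact: L1_cst.
by rewrite Ex_cst E0 -E1 /Phi/= in E2; lra.
Qed.

Lemma Ex_cdfe k : Ex P (fun w => cdfe (e k w)) = 2^-1.
Proof.
rewrite (Ex_same_law k bdm_cdfe) -(@Ex_le_half 1 0)//.
by rewrite [RHS](Ex_pair (i := 1%N) (k := 0%N) ble).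
Qed.

(** Given [e i], the two indicators are independent with mean F(e_i). This makes E F^2 a statement
    about the order of three errors. *)
Lemma Ex_cdfe_sqr_triple i j k : i != j -> i != k -> j != k ->
  Ex P (fun w => (e j w <= e i w)%R%:R * (e k w <= e i w)%R%:R) =
  Ex P (fun w => cdfe (e 0%N w) ^+ 2).
Proof.
move=> ij ik jk; rewrite -(Ex_same_law i (bdmX 2 bdm_cdfe)).
have iUV : indep P (e i) (fun w => (e j w, e k w)).
  apply: (indep_subsig ie (A1 := pred1 i) (A2 := mem [:: j; k])).
  - by move=> m /= /eqP ->; rewrite !inE (negbTE ij) (negbTE ik).
  - by apply: measurable_subsig => /=.
  - by apply: measurable_fun_pair; apply: measurable_subsig; rewrite /= !inE eqxx ?orbT.
pose Phi (z : R * (R * R)) : R := (z.2.1 <= z.1)%R%:R * (z.2.2 <= z.1)%R%:R.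
have bPhi : bdm Phi.
  apply: bdmM; apply: bdm_le => //; exact: measurableT_comp.
rewrite [LHS](_ : _ = Ex P (fun w => Phi (e i w, (e j w, e k w))))//.
rewrite (Ex_indep iUV bPhi); congr Ex; apply/funext => w; rewrite /Phi/=.
set x := e i w.
have [mg _] : bdm (fun y : R => (y <= x)%R%:R : R) by apply: bdm_le.
have bg l : bdm (fun w' => (e l w' <= x)%R%:R : R) by apply: bdm_le.
have [_ E] := indep_ExM (indep_comp (indep_coord ie jk) mg mg) (bdm_L1 P (bg j)) (bdm_L1 P (bg k)).
rewrite [LHS]E expr2; congr (_ * _); exact: cdfeE.
Qed.

(* Almost surely exactly one of three errors is the largest. *)
Lemma Ex_cdfe_sqr k : Ex P (fun w => cdfe (e k w) ^+ 2) = 3^-1.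
Proof.
rewrite (Ex_same_law k (bdmX 2 bdm_cdfe)).
pose le_ i k w : R := (e i w <= e k w)%R%:R.
pose tie i k w : R := (e i w <= e k w)%R%:R * (e k w <= e i w)%R%:R.
have ble_ i l : bdm (le_ i l) by apply: bdm_le.
have btie i l : bdm (tie i l) by apply: bdmM; apply: bdm_le.
have Etie i l : i != l -> Ex P (tie i l) = 0.
  move=> il; rewrite /tie.
  pose Psi (z : R * R) : R := (z.2 == z.1)%:R.
  have PsiE z : Psi z = (z.2 <= z.1)%R%:R * (z.1 <= z.2)%R%:R.
    by rewrite /Psi eq_le; case: (_ <= _); case: (_ <= _); rewrite ?mulr1 ?mulr0.
  have bPsi : bdm Psi.
    rewrite (_ : Psi = fun z => (z.2 <= z.1)%R%:R * (z.1 <= z.2)%R%:R).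
      by apply: bdmM; apply: bdm_le.
    by apply/funext => z; exact: PsiE.
  rewrite [LHS](_ : _ = Ex P (fun w => Psi (e i w, e l w))); last first.
    by congr Ex; apply/funext => w; rewrite PsiE/= mulrC.
  rewrite (Ex_indep (indep_coord ie il) bPsi) -[RHS](Ex_cst P); congr Ex; apply/funext => w.
  exact: density_no_atom.
have t0 := @Ex_cdfe_sqr_triple 0 1 2 isT isT isT.
have t1 := @Ex_cdfe_sqr_triple 1 0 2 isT isT isT.
have t2 := @Ex_cdfe_sqr_triple 2 0 1 isT isT isT.
(* [S] counts the errors that are maximal among the three: at least 1, and more only under ties. The
   tie terms in [U] below have mean zero and dominate the surplus. *)
pose S w := (le_ 1 0 w * le_ 2 0 w + le_ 0 1 w * le_ 2 1 w) + le_ 0 2 w * le_ 1 2 w.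
have bS : bdm S by apply: bdmD; [apply: bdmD|]; apply: bdmM.
have ES : Ex P S = 3 * Ex P (fun w => cdfe (e 0 w) ^+ 2).
  rewrite /S !ExD; try (by apply: bdm_L1; apply: bdmM); last first.
    by apply: bdm_L1; apply: bdmD; apply: bdmM.
  by rewrite /le_ t0 t1 t2; ring.
pose U w := 2 * ((tie 0 1 w + tie 0 2 w) + tie 1 2 w).
have bU : bdm U by apply: bdmZ; apply: bdmD => //; apply: bdmD.
have EU : Ex P U = 0.
  rewrite /U ExZ; last by apply: bdm_L1; apply: bdmD => //; apply: bdmD.
  rewrite !ExD; try (by apply: bdm_L1); last by apply: bdm_L1; apply: bdmD.
  by rewrite !Etie// !addr0 mulr0.
have S1 w : 1 <= S w.
  rewrite /S /le_; case: (ltgtP (e 0%N w) (e 1%N w)) => h1;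
  case: (ltgtP (e 0%N w) (e 2 w)) => h2; case: (ltgtP (e 1%N w) (e 2 w)) => h3;
  rewrite ?mulr1 ?mulr0 ?addr0 ?add0r ?lerDl ?lerDr ?lexx ?addr_ge0 ?ler01//; exfalso; lra.
have S2 w : S w - U w <= 1.
  rewrite /S /U /tie /le_; case: (ltgtP (e 0%N w) (e 1%N w)) => h1;
  case: (ltgtP (e 0%N w) (e 2 w)) => h2; case: (ltgtP (e 1%N w) (e 2 w)) => h3;
  rewrite ?mulr1 ?mulr0 ?addr0 ?add0r ?subr0 ?lexx//; rewrite /=; lra.
have a1 : 1 <= Ex P S by rewrite -(Ex_cst P 1); apply: le_Ex => //; [exact: L1_cst|exact: bdm_L1].
have a2 : Ex P S - Ex P U <= 1.
  rewrite -ExB; [|exact: bdm_L1..]; rewrite -[leRHS](Ex_cst P); apply: le_Ex => //.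
    by apply: bdm_L1; exact: bdmB.
  exact: L1_cst.
lra.
Qed.

Definition score (x : R) : R := cdfe x - 2^-1.

Lemma bdm_score : bdm score.
Proof. by apply: bdmB; [exact: bdm_cdfe|exact: bdm_cst]. Qed.

Lemma score_le1 x : `|score x| <= 1.
Proof. by rewrite /score ler_norml; have := cdfe_ge0 x; have := cdfe_le1 x; lra. Qed.

Let L1F k n : L1 P (fun w => cdfe (e k w) ^+ n).
Proof. by apply: bdm_L1; apply: bdmX; exact: (bdm_comp1 ie k bdm_cdfe). Qed.

Lemma Ex_score k : Ex P (fun w => score (e k w)) = 0.
Proof.
have := L1F k 1; under eq_fun do rewrite expr1; move=> l.
by rewrite /score ExB ?Ex_cdfe ?Ex_cst ?subrr//; exact: L1_cst.
Qed.

Lemma Ex_score2 k : Ex P (fun w => score (e k w) ^+ 2) = 12^-1.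
Proof.
have := L1F k 1; under eq_fun do rewrite expr1; move=> l.
transitivity (Ex P (fun w => (cdfe (e k w) ^+ 2 - cdfe (e k w)) + 4^-1)).
  by congr Ex; apply/funext => w; rewrite /score; field.
rewrite ExD ?ExB ?Ex_cst ?Ex_cdfe_sqr ?Ex_cdfe//; [lra|exact: L1B|exact: L1_cst].
Qed.

(* What is left of the indicator after removing its projections on functions of
   one variable. *)
Definition null_kernel (z : R * R) : R := (z.2 <= z.1)%R%:R - cdfe z.1 + cdfe z.2 - 2^-1.

Let bF1 : bdm (fun z : R * R => cdfe z.1).
Proof. by have [m [B h]] := bdm_cdfe; split; [exact: measurableT_comp|exists B]. Qed.
Let bF2 : bdm (fun z : R * R => cdfe z.2).
Proof. by have [m [B h]] := bdm_cdfe; split; [exact: measurableT_comp|exists B]. Qed.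

Lemma bdm_null_kernel : bdm null_kernel.
Proof. by apply: bdmB; [apply: bdmD => //; apply: bdmB|exact: bdm_cst]. Qed.

Lemma null_kernel_le2 z : `|null_kernel z| <= 2.
Proof.
rewrite /null_kernel ler_norml.
have := cdfe_ge0 z.1; have := cdfe_le1 z.1; have := cdfe_ge0 z.2; have := cdfe_le1 z.2.
by case: (z.2 <= z.1) => /=; lra.
Qed.

Lemma Ex_null_kernel2 k x : Ex P (fun w => null_kernel (x, e k w)) = 0.
Proof.
rewrite /null_kernel/=.
have l1 : L1 P (fun w => (e k w <= x)%R%:R) by apply: bdm_L1; apply: bdm_le.
have l2 : L1 P (fun w => cdfe (e k w)) by have := L1F k 1; under eq_fun do rewrite expr1.
rewrite ExB ?ExD ?ExB ?Ex_cst ?cdfeE ?Ex_cdfe//; try exact: L1_cst; try (by apply: L1B => //; exact: L1_cst).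
  by ring.
by apply: L1D => //; apply: L1B => //; exact: L1_cst.
Qed.

Lemma Ex_null_kernel1 k x : Ex P (fun w => null_kernel (e k w, x)) = 0.
Proof.
rewrite /null_kernel/=.
have l1 : L1 P (fun w => (e k w <= x)%R%:R) by apply: bdm_L1; apply: bdm_le.
have l1' : L1 P (fun w => (x <= e k w)%R%:R) by apply: bdm_L1; apply: bdm_le.
have l2 : L1 P (fun w => cdfe (e k w)) by have := L1F k 1; under eq_fun do rewrite expr1.
have l3 : L1 P (fun w => (e k w == x)%:R).
  rewrite (_ : (fun w => _) = (fun w => (e k w <= x)%R%:R * (x <= e k w)%R%:R)).
    by apply: bdm_L1; apply: bdmM; apply: bdm_le.
  by apply/funext => w; rewrite eq_le; case: (_ <= _); case: (_ <= _); rewrite ?mulr1 ?mulr0.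
have E : Ex P (fun w => (x <= e k w)%R%:R) = 1 - cdfe x.
  have a1 : L1 P (fun w => 1 - (e k w <= x)%R%:R) by apply: L1B => //; exact: L1_cst.
  have H := ExD a1 l3; rewrite (ExB (L1_cst P 1) l1) Ex_cst cdfeE density_no_atom addr0 in H.
  rewrite -H; congr Ex; apply/funext => w; case: (ltgtP x (e k w)) => h //=; rewrite ?subr0 ?addr0 ?subrr ?add0r//.
have a1 := L1B l1' l2; have a2 := L1D a1 (L1_cst P (cdfe x)).
by rewrite (ExB a2 (L1_cst P _)) (ExD a1 (L1_cst P _)) (ExB l1' l2) !Ex_cst E Ex_cdfe; lra.
Qed.

End iid.

(** * Effect of a small shift on the comparison of two errors *)

Section shifted.
Context d (T : measurableType d) (R : realType) (P : probability T R).
Local Notation mu := (@lebesgue_measure R).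
Variables (e : nat -> T -> R) (f h : R -> R).
Hypothesis ie : mutually_independent P e.
Hypothesis fe : forall i, has_density P (e i) f.
Hypothesis he : has_density P (fun w => (e 0%N w - e 1%N w)%R) h.
Hypothesis lh : lipschitz_near0 h.

Let me_ j : measurable_fun setT (e j). Proof. exact: ie.1. Qed.

Definition excess (dl : R) : R := Ex P (fun w => (e 1%N w <= e 0%N w + dl)%R%:R) - 2^-1.

(** The change that the shift makes to the indicator, minus its mean. It is not degenerate in each
    variable; only its small variance is used. *)
Definition shift_kernel (dl : R) (z : R * R) : R :=
  (z.2 <= z.1 + dl)%R%:R - (z.2 <= z.1)%R%:R - excess dl.

Let bsh dl : bdm (fun z : R * R => (z.2 <= z.1 + dl)%R%:R : R).
Proof. by apply: bdm_le => //; apply: measurable_funD. Qed.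

Let ble : bdm (fun z : R * R => (z.2 <= z.1)%R%:R : R).
Proof. by apply: bdm_le. Qed.

Lemma bdm_shift_kernel dl : bdm (shift_kernel dl).
Proof. by apply: bdmB; [apply: bdmB|exact: bdm_cst]. Qed.

Lemma Ex_shift_diff dl i k : i != k ->
  Ex P (fun w => (e k w <= e i w + dl)%R%:R - (e k w <= e i w)%R%:R) = excess dl.
Proof.
move=> ik; rewrite ExB; [|exact: bdm_L1 (bdm_comp2 ie i k (bsh dl))|exact: bdm_L1 (bdm_comp2 ie i k ble)].
rewrite (Ex_le_half ie fe ik) /excess; congr (_ - _).
exact: (Ex_pair01 ie fe (bsh dl) ik).
Qed.

Lemma Ex_shift_kernel dl i k : i != k -> Ex P (fun w => shift_kernel dl (e i w, e k w)) = 0.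
Proof.
move=> ik; rewrite /shift_kernel/= ExB; last exact: L1_cst.
  by rewrite Ex_shift_diff// Ex_cst subrr.
by apply: bdm_L1; apply: bdmB; [exact: (bdm_comp2 ie i k (bsh dl))|exact: (bdm_comp2 ie i k ble)].
Qed.

(** The sign of [dl] fixes the sign of the change in the indicator, which takes values 0 and 1 or 0
    and -1. Its second moment is thus the absolute value of its mean, and centring only lowers
    it. *)
Lemma Ex_shift_kernel2 dl i k : i != k ->
  Ex P (fun w => shift_kernel dl (e i w, e k w) ^+ 2) <= `|excess dl|.
Proof.
move=> ik; pose D w : R := (e k w <= e i w + dl)%R%:R - (e k w <= e i w)%R%:R.
have bD : bdm D by apply: bdmB; [exact: (bdm_comp2 ie i k (bsh dl))|exact: (bdm_comp2 ie i k ble)].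
have ED : Ex P D = excess dl by exact: Ex_shift_diff.
have E2 : Ex P (fun w => D w ^+ 2) <= `|excess dl|.
  rewrite -ED; have [d0|d0] := leP 0 dl.
    apply: le_trans (ler_norm _); apply: le_Ex; [exact: bdm_L1 (bdmX 2 bD)|exact: bdm_L1|].
    move=> w; rewrite /D; case: (leP (e k w) (e i w)) => h1; case: (leP (e k w) (e i w + dl)) => h2; rewrite /= ?subr0 ?subrr ?expr1n ?expr0n//=.
    by exfalso; lra.
  rewrite -normrN -mulN1r -ExZ; last exact: bdm_L1.
  apply: le_trans (ler_norm _); apply: le_Ex; [exact: bdm_L1 (bdmX 2 bD)|exact: bdm_L1 (bdmZ _ bD)|].
  move=> w; rewrite /D; case: (leP (e k w) (e i w)) => h1; case: (leP (e k w) (e i w + dl)) => h2; rewrite /= ?subr0 ?subrr ?expr1n ?expr0n//=.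
  - by rewrite mulr0.
  - by rewrite sub0r sqrrN expr1n mulN1r opprK.
  - by exfalso; lra.
  - by rewrite mulr0.
have -> : Ex P (fun w => shift_kernel dl (e i w, e k w) ^+ 2) =
    Ex P (fun w => D w ^+ 2) - excess dl ^+ 2.
  transitivity (Ex P (fun w => (D w ^+ 2 - (2 * excess dl) * D w) + excess dl ^+ 2)).
    by congr Ex; apply/funext => w; rewrite /shift_kernel /= -/(D w); ring.
  have l1 := bdm_L1 P (bdmX 2 bD); have l2 := bdm_L1 P (bdmZ (2 * excess dl) bD).
  rewrite (ExD (L1B l1 l2) (L1_cst P _)) (ExB l1 l2) ExZ ?ED ?Ex_cst; [ring|exact: bdm_L1].
by have := sqr_ge0 (excess dl); lra.
Qed.

Let Dd w : R := e 0%N w - e 1%N w.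
Let mDd : measurable_fun setT Dd. Proof. exact: measurable_funB. Qed.

Let in_itvb (a b : R) w : bool := (a <= Dd w) && (Dd w < b).
Let m_in_itvb a b : measurable_fun setT (in_itvb a b).
Proof. by apply: measurable_and; [apply: measurable_fun_ler|apply: measurable_fun_ltr]. Qed.

Lemma density_interval (a b s L : R) : a <= b ->
  (forall x, a <= x < b -> `|h x - h 0| <= L * s) ->
  `|Ex P (fun w => (in_itvb a b w)%:R) - h 0 * (b - a)| <= L * s * (b - a).
Proof.
move=> ab hx; have [h0 [mh hE]] := he.
have ih : mu.-integrable setT (EFin \o h).
  apply/integrableP; split; first exact/measurable_EFinP.
  have := hE setT measurableT; rewrite preimage_setT probability_setT => E.
  apply: (@le_lt_trans _ _ 1%E); last exact: ltry.
  rewrite E le_eqVlt; apply/orP; left; apply/eqP.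
  by apply: eq_integral => x _; rewrite /= ger0_norm.
pose I := [set` `[a, b[]%R.
have mI : measurable I by exact: measurable_itv.
have ihI : mu.-integrable I (EFin \o h) by apply: integrableS ih.
have -> : Ex P (fun w => (in_itvb a b w)%:R) = (\int[mu]_(x in I) h x)%R.
  rewrite Ex_bool// /pr /Rintegral -(hE I mI); by congr (fine _).
have muI : mu I = (b - a)%:E.
  rewrite /I lebesgue_measure_itv/= lte_fin; case: ltP => // ba.
  by rewrite (_ : b = a) ?subrr//; apply/eqP; rewrite eq_le ab ba.
have ic (c : R) : mu.-integrable I (EFin \o (fun=> c)).
  apply: measurable_bounded_integrable => //.
    by apply: (@le_lt_trans _ _ (b - a)%:E); [rewrite -muI|exact: ltry].
  by exists `|c|; split; [rewrite num_real|move=> x cx y _; rewrite ltW].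
have ec (c : R) : (\int[mu]_(x in I) (fun=> c) x = c * (b - a))%R.
  by rewrite Rintegral_cst//; congr (_ * _); exact: (congr1 fine muI).
have up : (\int[mu]_(x in I) h x <= (h 0 + L * s) * (b - a))%R.
  rewrite -ec; apply: le_Rintegral => // x; rewrite /I /= in_itv/= => /hx.
  by rewrite ler_norml; lra.
have lo : ((h 0 - L * s) * (b - a) <= \int[mu]_(x in I) h x)%R.
  rewrite -ec; apply: le_Rintegral => // x; rewrite /I /= in_itv/= => /hx.
  by rewrite ler_norml; lra.
rewrite ler_norml; move: up lo; rewrite mulrBl mulrDl; lra.
Qed.

(** The excess is, up to sign, the integral of [h] over an interval of length |dl| with endpoint 0,
    on which [h] differs from [h 0] by at most L |dl|. *)
Lemma excess_taylor : exists r C : R, [/\ 0 < r, 0 <= C &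
  forall dl, `|dl| < r -> `|excess dl - h 0 * dl| <= C * dl ^+ 2].
Proof.
have [r [L' [r0 hL]]] := lh.
pose L := Num.max L' 0; have L0 : 0 <= L by rewrite le_max lexx orbT.
have hL0 x : `|x| < r -> `|h x - h 0| <= L * `|x|.
  move=> xr; have := hL x 0 xr; rewrite normr0 subr0 => /(_ r0) /le_trans; apply.
  by rewrite ler_wpM2r// le_max lexx.
exists r, L; split => // dl dlr.
have half : Ex P (fun w => (0 <= Dd w)%R%:R) = 2^-1.
  rewrite -(@Ex_le_half _ _ _ _ _ _ ie fe 0 1)//; congr Ex; apply/funext => w.
  by rewrite /Dd subr_ge0.
have lle (a : R) : L1 P (fun w => (a <= Dd w)%R%:R) by apply: bdm_L1; apply: bdm_le.
have exE : excess dl = Ex P (fun w => (- dl <= Dd w)%R%:R) - Ex P (fun w => (0 <= Dd w)%R%:R).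
  rewrite half /excess; congr (_ - _); congr Ex; apply/funext => w.
  by congr (nat_of_bool _)%:R; rewrite /Dd; apply/idP/idP; lra.
have [d0|d0] := leP 0 dl.
  have := @density_interval (- dl) 0 dl L; rewrite oppr_le0 sub0r opprK expr2 mulrA.
  rewrite ger0_norm// in dlr.
  rewrite exE -ExB//.
  have -> : (fun w => (- dl <= Dd w)%R%:R - (0 <= Dd w)%R%:R) = (fun w => (in_itvb (- dl) 0 w)%:R) :> (T -> R).
    apply/funext => w; rewrite /in_itvb; case: (leP (- dl) (Dd w)) => h1; case: (leP 0 (Dd w)) => h2;
    rewrite /= ?subrr ?subr0//; exfalso; lra.
  apply => // x /andP[x1 x2]; apply: (le_trans (hL0 x _)); first by rewrite ltr0_norm//; lra.
  by rewrite ler_wpM2l// ltr0_norm//; lra.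
have dl0 : 0 <= - dl by rewrite oppr_ge0 ltW.
have := @density_interval 0 (- dl) (- dl) L dl0; rewrite subr0.
rewrite ltr0_norm// in dlr.
have -> : Ex P (fun w => (in_itvb 0 (- dl) w)%:R) = - excess dl.
  rewrite exE opprB -ExB//; congr Ex; apply/funext => w.
  rewrite /in_itvb; case: (leP (- dl) (Dd w)) => h1; case: (leP 0 (Dd w)) => h2;
    rewrite /= ?subrr ?subr0//; exfalso; lra.
move=> H.
rewrite (_ : excess dl - h 0 * dl = - (- excess dl - h 0 * - dl)); last by ring.
rewrite normrN (_ : L * dl ^+ 2 = L * - dl * - dl); last by ring.
apply: H.
move=> x /andP[x1 x2]; apply: (le_trans (hL0 x _)); first by rewrite ger0_norm//; lra.
by rewrite ler_wpM2l// ger0_norm//; lra.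
Qed.

End shifted.

(** * Cosine sums *)

Section cosine_system.
Context {R : realType}.

Definition cosx (n j i : nat) : R := cos (pi * j%:R * xpt n i).

Lemma cosx_le1 n j i : `|cosx n j i| <= 1.
Proof. exact: cos_max. Qed.

Lemma sin_natpi m : sin (pi * m%:R) = 0 :> R.
Proof.
elim: m => [|m IH]; first by rewrite mulr0 sin0.
by rewrite -natr1 mulrDr mulr1 sinDpi IH oppr0.
Qed.

(* Multiplying by [2 sin (pi m / 2n)] makes the sum telescope. *)
Lemma sum_cosx n m : (0 < m < 2 * n)%N -> \sum_(i < n) cosx n m i = 0.
Proof.
move=> /andP[m0 mn].
have n0 : (0 < n)%N by move: mn; case: n => //; rewrite muln0.
have nR : 0 < n%:R :> R by rewrite ltr0n.
pose th : R := pi * m%:R / (2 * n%:R).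
have th0 : 0 < sin th.
  apply: sin_gt0_pi; apply/andP; split.
    by rewrite divr_gt0// mulr_gt0// ?pi_gt0// ltr0n.
  rewrite ltr_pdivrMr ?mulr_gt0// ltr_pM2l ?pi_gt0//.
  by rewrite -natrM ltr_nat.
have E i : 2 * sin th * cosx n m i = sin (pi * m%:R * (i.+1%:R / n%:R)) - sin (pi * m%:R * (i%:R / n%:R)).
  have -> : pi * m%:R * (i.+1%:R / n%:R) = pi * m%:R * xpt n i + th.
    by rewrite /th /xpt -natr1; field; rewrite gt_eqF.
  have -> : pi * m%:R * (i%:R / n%:R) = pi * m%:R * xpt n i - th.
    by rewrite /th /xpt; field; rewrite gt_eqF.
  by rewrite sinD sinB /cosx; ring.
have : 2 * sin th * \sum_(i < n) cosx n m i = 0.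
  rewrite mulr_sumr -(big_mkord xpredT (fun i => 2 * sin th * cosx n m i)).
  under eq_bigr do rewrite E.
  rewrite telescope_sumr// mul0r mulr0 sin0 subr0 divff ?gt_eqF//.
  by rewrite mulr1 sin_natpi.
by move/eqP; rewrite !mulf_eq0 pnatr_eq0/= (gt_eqF th0)/= => /eqP.
Qed.

(** Product-to-sum leaves the frequencies j - l and j + l. Both lie below 2n, which is why the
    vanishing of cosine sums is stated in that range. *)
Lemma cosx_orth n j l : (0 < j < n)%N -> (0 < l < n)%N ->
  \sum_(i < n) cosx n j i * cosx n l i = if j == l then n%:R / 2 else 0.
Proof.
wlog lj : j l / (l <= j)%N.
  move=> H hj hl; case: (leqP l j) => [/H|/ltnW /H]; first exact.
  move=> /(_ hl hj); rewrite eq_sym => <-.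
  by apply: eq_bigr => i _; rewrite mulrC.
move=> /andP[j0 jn] /andP[l0 ln].
have E i : cosx n j i * cosx n l i = 2^-1 * cosx n (j - l) i + 2^-1 * cosx n (j + l) i.
  rewrite /cosx natrB// natrD.
  rewrite (_ : pi * (j%:R - l%:R) * xpt n i = pi * j%:R * xpt n i - pi * l%:R * xpt n i); last by ring.
  rewrite (_ : pi * (j%:R + l%:R) * xpt n i = pi * j%:R * xpt n i + pi * l%:R * xpt n i); last by ring.
  by rewrite cosB cosD; field.
under eq_bigr do rewrite E.
rewrite big_split/= -!mulr_sumr (@sum_cosx n (j + l)); last first.
  by rewrite addn_gt0 j0/= mul2n -addnn (@leq_ltn_trans (n + l)) ?ltn_add2l ?leq_add2r// ltnW.
rewrite mulr0 addr0; case: eqP => [->|/eqP jl].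
  rewrite subnn (eq_bigr (fun=> 1)); last by move=> i _; rewrite /cosx mulr0 mul0r cos0.
  by rewrite sumr_const card_ord mulrC.
rewrite sum_cosx ?mulr0// subn_gt0 ltn_neqAle eq_sym jl lj/=.
by apply: leq_ltn_trans (leq_subr _ _) _; rewrite mul2n -addnn ltn_addr.
Qed.

(** Expands the nonnegative squared distance from [y] to its projection on the cosines, each of
    squared norm n/2. *)
Lemma bessel n (y : nat -> R) : (0 < n)%N ->
  \sum_(1 <= j < n) (\sum_(i < n) cosx n j i * y i) ^+ 2 <= n%:R / 2 * \sum_(i < n) y i ^+ 2.
Proof.
move=> n0; have nR : 0 < n%:R :> R by rewrite ltr0n.
pose al j := \sum_(i < n) cosx n j i * y i.
pose pr_ i := \sum_(1 <= j < n) al j * cosx n j i.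
have h : 0 <= \sum_(i < n) (y i - 2 / n%:R * pr_ i) ^+ 2 by apply: sumr_ge0 => i _; exact: sqr_ge0.
have E1 : \sum_(i < n) y i * pr_ i = \sum_(1 <= j < n) al j ^+ 2.
  under eq_bigr do rewrite mulr_sumr.
  rewrite exchange_big/=; apply: eq_bigr => j _.
  rewrite expr2 [X in _ = _ * X]/al mulr_sumr; apply: eq_bigr => i _; ring.
have E2 : \sum_(i < n) pr_ i ^+ 2 = n%:R / 2 * \sum_(1 <= j < n) al j ^+ 2.
  under eq_bigr do rewrite expr2 big_distrlr/=.
  rewrite exchange_big/= mulr_sumr big_nat_cond [RHS]big_nat_cond.
  apply: eq_bigr => j /andP[jn _].
  rewrite exchange_big/= (bigD1_seq j)//= ?mem_index_iota ?iota_uniq//.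
  rewrite [X in _ + X]big1_seq ?addr0.
    transitivity (al j ^+ 2 * \sum_(i < n) cosx n j i * cosx n j i).
      by rewrite mulr_sumr; apply: eq_bigr => i _; ring.
    by rewrite cosx_orth// eqxx mulrC.
  move=> l /andP[lj]; rewrite mem_index_iota => ln.
  transitivity (al j * al l * \sum_(i < n) cosx n j i * cosx n l i).
    by rewrite mulr_sumr; apply: eq_bigr => i _; ring.
  by rewrite cosx_orth// eq_sym (negbTE lj) mulr0.
move: h; rewrite (eq_bigr (fun i : 'I_n => (y i ^+ 2 - 4 / n%:R * (y i * pr_ i)) + (4 / n%:R ^+ 2) * pr_ i ^+ 2)); last first.
  by move=> i _; field; rewrite gt_eqF.
rewrite big_split/= sumrB -!mulr_sumr E1 E2 -/al.
set A := \sum_(1 <= j < n) _; set Y := \sum_(i < n) _.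
have -> : 4 / n%:R ^+ 2 * (n%:R / 2 * A) = 2 / n%:R * A by field; rewrite gt_eqF.
have -> : 4 / n%:R * A = 2 * (2 / n%:R * A) by field; rewrite gt_eqF.
move=> h; have h2 : 2 / n%:R * A <= Y by lra.
have -> : A = n%:R / 2 * (2 / n%:R * A) by field; rewrite gt_eqF.
by apply: ler_wpM2l => //; rewrite divr_ge0// ltW.
Qed.

End cosine_system.

(** * Riemann sums of piecewise Lipschitz functions *)

Section piecewise_lipschitz.
Context {R : realType}.
Local Notation mu := (@lebesgue_measure R).

(** Induction on the exceptional points: removing [a] splits [J] into the parts left and right of
    it, and |b a| covers the point itself. A general [J] makes both parts instances of the same
    statement. *)
Lemma lipschitz_off_bounded (b : R -> R) (L : R) (s : seq R) (J : set R) :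
  (forall x y, J x -> J y -> (forall a, a \in s -> ~ (Num.min x y <= a <= Num.max x y)) ->
     `|b x - b y| <= L * `|x - y|) ->
  (forall x, J x -> 0 <= x <= 1) ->
  exists2 B, 0 <= B & forall x, J x -> `|b x| <= B.
Proof.
elim: s J => [|a s IH] J Jb J01.
  have [[x0 Jx0]|J0] := pselect (exists x, J x); last first.
    by exists 0 => // x Jx; exfalso; apply: J0; exists x.
  exists (`|b x0| + `|L|) => [|x Jx]; first by rewrite addr_ge0.
  have h : `|b x - b x0| <= L * `|x - x0| by apply: Jb.
  have h2 : L * `|x - x0| <= `|L|.
    have x1 : `|x - x0| <= 1.
      by have := J01 _ Jx; have := J01 _ Jx0; rewrite ler_norml; lra.
    apply: (@le_trans _ _ (`|L| * `|x - x0|)); first by rewrite ler_wpM2r// ler_norm.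
    by rewrite ler_piMr.
  have := ler_normD (b x0) (b x - b x0); rewrite subrKC => h3.
  by apply: (le_trans h3); rewrite lerD2l; apply: le_trans h h2.
have [B1 B10 h1] : exists2 B, 0 <= B & forall x, J x /\ x < a -> `|b x| <= B.
  apply: (IH [set x | J x /\ x < a]); last by move=> x [Jx _]; exact: J01.
  move=> x y [Jx ax] [Jy ay] h; apply: Jb => // c; rewrite inE => /orP[/eqP ->|/h//].
  by case: (leP x y) => _ /andP[_ ?]; lra.
have [B2 B20 h2] : exists2 B, 0 <= B & forall x, J x /\ a < x -> `|b x| <= B.
  apply: (IH [set x | J x /\ a < x]); last by move=> x [Jx _]; exact: J01.
  move=> x y [Jx ax] [Jy ay] h; apply: Jb => // c; rewrite inE => /orP[/eqP ->|/h//].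
  by case: (leP x y) => _ /andP[? _]; lra.
exists (B1 + B2 + `|b a|) => [|x Jx]; first by rewrite !addr_ge0.
have n0 := normr_ge0 (b a).
case: (ltgtP x a) => [xa|ax|->]; last by rewrite lerDr addr_ge0.
- by have := h1 x (conj Jx xa); lra.
- by have := h2 x (conj Jx ax); lra.
Qed.

Lemma piecewise_bounded (b : R -> R) : piecewise_lipschitz01 b ->
  exists2 B, 0 <= B & forall x, 0 <= x <= 1 -> `|b x| <= B.
Proof.
move=> [s [L h]]; apply: (@lipschitz_off_bounded b L s [set x | 0 <= x <= 1]).
  by move=> x y; exact: h.
by [].
Qed.

Lemma xpt01 n i : (i < n)%N -> 0 <= @xpt R n i <= 1.
Proof.
move=> i_n; have nR : 0 < n%:R :> R by rewrite ltr0n (leq_ltn_trans _ i_n).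
rewrite /xpt divr_ge0 ?addr_ge0 ?invr_ge0//= ler_pdivrMr// mul1r.
have : i.+1%:R <= n%:R :> R by rewrite ler_nat.
by rewrite -natr1; lra.
Qed.

Definition cell n (x : R) : nat := Num.truncn (n%:R * x).

Lemma cellP n (x : R) : (0 < n)%N -> 0 <= x < 1 ->
  (cell n x < n)%N /\ `|xpt n (cell n x) - x| <= n%:R^-1.
Proof.
move=> n0 /andP[x0 x1]; have nR : 0 < n%:R :> R by rewrite ltr0n.
have nx0 : 0 <= n%:R * x by rewrite mulr_ge0// ltW.
have /andP[t1 t2] := truncn_itv nx0; rewrite -/(cell n x) in t1 t2 *; split.
  by rewrite -(ltr_nat R); apply: (le_lt_trans t1); rewrite -[ltRHS]mulr1 ltr_pM2l.
rewrite (_ : xpt n (cell n x) - x = ((cell n x)%:R + 2^-1 - n%:R * x) / n%:R); last first.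
  by rewrite /xpt; field; rewrite gt_eqF.
rewrite normrM (gtr0_norm (_ : 0 < n%:R^-1)) ?invr_gt0// ler_piMl// ?invr_ge0//.
by rewrite ler_norml; move: t2; rewrite -natr1; lra.
Qed.

(** [x] keeps a positive distance from the exceptional points, so for large n none of them separates
    [x] from the midpoint of its cell and the Lipschitz bound applies. *)
Lemma piecewise_cvg (b : R -> R) (s : seq R) (L : R) (x : R) :
  (forall x y, 0 <= x <= 1 -> 0 <= y <= 1 ->
    (forall a, a \in s -> ~ (Num.min x y <= a <= Num.max x y)) ->
    `|b x - b y| <= L * `|x - y|) ->
  0 <= x < 1 -> x \notin s ->
  b (xpt n (cell n x)) @[n --> \oo] --> b x.
Proof.
move=> bL x01 xs.
have [r r0 rs] : exists2 r, 0 < r & forall a, a \in s -> r <= `|a - x|.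
  elim: s xs {bL} => [|a s IH]; first by exists 1.
  rewrite inE negb_or => /andP[xa /IH[r r0 rs]].
  exists (Num.min r `|a - x|); first by rewrite lt_min r0 normr_gt0 subr_eq0 eq_sym.
  move=> c; rewrite inE => /orP[/eqP ->|/rs rc]; first by rewrite ge_min lexx orbT.
  by rewrite ge_min rc.
apply/cvgrPdist_le => eps eps0.
have iv : (fun n => n.+1%:R^-1) @ \oo --> (0 : R) by exact: cvg_harmonic.
pose c := Num.min (r / 2) (eps / (`|L| + 1)).
have c0 : 0 < c by rewrite lt_min !divr_gt0//= ltr_wpDl.
move/cvgrPdist_le: iv => /(_ c c0) [N _ hN]; exists N.+1 => // n /= Nn.
have n0 : (0 < n)%N by exact: leq_ltn_trans Nn.
have nc : n%:R^-1 <= c.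
  have := hN n.-1; rewrite /= prednK// sub0r normrN => h.
  by apply: le_trans (h _); [exact: ler_norm|rewrite -ltnS prednK].
have [cn cx] := cellP n0 x01.
have xc : `|xpt n (cell n x) - x| <= c by apply: le_trans cx nc.
have [cr ce] : c <= r / 2 /\ c <= eps / (`|L| + 1) by rewrite !ge_min !lexx orbT.
have hb : `|b x - b (xpt n (cell n x))| <= L * `|x - xpt n (cell n x)|.
  apply: bL; [by have := x01; lra|exact: xpt01|].
  move=> a /rs ra; move: xc; rewrite ler_norml => /andP[y1 y2].
  case: (leP x (xpt n (cell n x))) => h /andP[h1 h2]; move: ra.
    by rewrite ger0_norm; lra.
  by case: (leP 0 (a - x)) => h3; [rewrite ger0_norm//|rewrite ltr0_norm//]; lra.
apply: (le_trans hb).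
rewrite distrC.
apply: (@le_trans _ _ (`|L| * c)).
  apply: (@le_trans _ _ (`|L| * `|xpt n (cell n x) - x|)).
    by rewrite ler_wpM2r// ler_norm.
  by rewrite ler_wpM2l.
move: ce; rewrite ler_pdivlMr ?ltr_wpDl// mulrDr mulr1 mulrC => ce.
by have := ltW c0; lra.
Qed.

Lemma measurable_seq (s : seq R) : measurable ([set` s] : set R).
Proof.
apply: countable_measurable; first exact: measurable_set1.
by apply: finite_set_countable; exact: finite_seq.
Qed.

Lemma measurable_fun_seq (s : seq R) (g : R -> R) : measurable_fun [set` s] g.
Proof.
elim: s => [|a s IH]; first by rewrite (_ : [set` [::]] = set0); [exact: measurable_fun_set0|apply/seteqP; split].
rewrite (_ : [set` a :: s] = [set a] `|` [set` s]); last first.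
  apply/seteqP; split => x /=; rewrite inE.
    by move=> /orP[/eqP|]; [left|right].
  by move=> [->|->]; rewrite ?eqxx ?orbT.
have mA : measurable [set a] by exact: measurable_set1.
by apply/(measurable_funU _ mA (measurable_seq s)); split => //; exact: measurable_fun_set1.
Qed.

(** The Riemann sum is the integral of the step function [gn] that is constant on the n cells. It
    converges pointwise off a finite set and is bounded, so dominated convergence applies. *)
Lemma riemann_sum_cvg (b : R -> R) (j : nat) : piecewise_lipschitz01 b ->
  n%:R^-1 * \sum_(i < n) cosx n j i * b (xpt n i) @[n --> \oo] --> beta_coef b j.
Proof.
move=> pb; have [B B0 bB] := piecewise_bounded pb; have [s [L bL]] := pb.
pose c x : R := cos (pi * j%:R * x); pose g x : R := b x * c x.
have cc : continuous c.
  move=> x; apply: (@cvg_comp _ _ _ (fun x => pi * j%:R * x) cos); last exact: continuous_cos.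
  by apply: cvgM; [exact: cvg_cst|exact: cvg_id].
pose I n i : set R := [set` `[i%:R / n%:R, i.+1%:R / n%:R[].
pose gn n x : R := \sum_(i < n) g (xpt n i) * \1_(I n i) x.
have mI n i : measurable (I n i) by exact: measurable_itv.
have gnE n x : (0 < n)%N -> 0 <= x < 1 -> gn n x = g (xpt n (cell n x)).
  move=> n0 x01; have [cn _] := cellP n0 x01; have nR : 0 < n%:R :> R by rewrite ltr0n.
  have nx0 : 0 <= n%:R * x by rewrite mulr_ge0//; lra.
  have IE i : I n i x = (i%:R <= n%:R * x < i.+1%:R) :> Prop.
    by rewrite /I /= in_itv/= ler_pdivrMr// ltr_pdivlMr// [x * _]mulrC.
  have cI : I n (cell n x) x by rewrite IE; exact: truncn_itv.
  rewrite /gn (bigD1 (Ordinal cn))//= big1 ?addr0 => [|i ic].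
    by rewrite indicE mem_set// mulr1.
  rewrite indicE memNset ?mulr0// IE => h.
  move/eqP: ic; apply; apply/val_inj => /=; apply/esym.
  exact: (truncn_def h).
have mgn n : measurable_fun setT (gn n).
  apply: measurable_sum => i; apply: measurable_funM => //; exact/measurable_indicP.
have gB x : 0 <= x <= 1 -> `|g x| <= B.
  move=> x01; rewrite normrM -[leRHS]mulr1; apply: ler_pM => //; first exact: bB.
  exact: cos_max.
pose D : set R := [set` `[0, 1]].
have mD : measurable D by exact: measurable_itv.
(* The endpoint 1 joins the exceptional points because its cell would have index n, outside the
   design. *)
pose N : set R := [set` (1 :: s)].
have mN : measurable N by exact: measurable_seq.
have gn_g x : 0 <= x <= 1 -> ~ N x -> gn n x @[n --> \oo] --> g x.
  move=> x01 Nx; move: Nx; rewrite /N /= inE => /negP; rewrite negb_or => /andP[x1 xs].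
  have x01' : 0 <= x < 1 by rewrite lt_neqAle x1; lra.
  have h : g (xpt n (cell n x)) @[n --> \oo] --> g x.
    apply: cvgM; first exact: (piecewise_cvg bL x01' xs).
    apply: (@cvg_comp _ _ _ (fun n => xpt n (cell n x)) c); last exact: cc.
    have : (fun n => n.+1%:R^-1) @ \oo --> (0 : R) by exact: cvg_harmonic.
    move=> /cvgrPdist_le iv; apply/cvgrPdist_le => eps eps0.
    have [M _ hM] := iv eps eps0; exists M.+1 => // n /= Mn.
    have n0 : (0 < n)%N by exact: leq_ltn_trans Mn.
    have [_ h] := cellP n0 x01'; rewrite distrC; apply: (le_trans h).
    have := hM n.-1; rewrite /= prednK// sub0r normrN => h2.
    by apply: le_trans (h2 _); [exact: ler_norm|rewrite -ltnS prednK].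
  apply: cvg_trans h; apply: near_eq_cvg; exists 1%N => // n /= n0.
  by rewrite gnE.
(* Measurability of [b] is itself derived: off the finite set [N] the function is a pointwise limit
   of step functions, and on [N] every function is measurable. *)
have mg : measurable_fun D g.
  rewrite -(setUIDK D N); apply/measurable_funU.
  - exact: measurableI.
  - exact: measurableD.
  split; first by apply: (measurable_funS mN); [exact: subIsetr|exact: measurable_fun_seq].
  apply: (measurable_fun_cvg (h := gn)).
    by move=> n; apply: measurable_funTS.
  by move=> x [Dx Nx]; apply: gn_g => //; move: Dx; rewrite /D /= in_itv.
have N0 : mu N = 0 by apply: countable_lebesgue_measure0; apply: finite_set_countable; exact: finite_seq.
have muD : mu D = 1%:E by rewrite /D lebesgue_measure_itv/= lte_fin ltr01 oppr0 adde0.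
have DE x : D x -> 0 <= x <= 1 by rewrite /D /= in_itv.
have ae1 : {ae mu, forall x, D x -> EFin \o gn ^~ x @ \oo --> (g x)%:E}.
  exists N; split => // x /= h; apply: contrapT => Nx; apply: h => Dx.
  apply: cvg_EFin; first exact: nearW.
  by apply: gn_g => //; exact: DE.
have ae2 : {ae mu, forall x n, D x -> (`|(gn n x)%:E| <= B%:E)%E}.
  exists N; split => // x /= h; apply: contrapT => Nx; apply: h => n Dx.
  rewrite lee_fin; case: n => [|n]; first by rewrite /gn big_ord0 normr0.
  have x01 := DE _ Dx.
  have x1 : x != 1 by apply/eqP => x1; apply: Nx; rewrite /N x1 /= mem_head.
  have x01' : 0 <= x < 1 by rewrite lt_neqAle x1; lra.
  by rewrite gnE//; apply: gB; apply: xpt01; have [] := cellP (ltn0Sn n) x01'.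
have iB : mu.-integrable D (fun=> B%:E).
  apply: measurable_bounded_integrable => //.
    by apply: (@le_lt_trans _ _ 1%:E); [rewrite -muD|exact: ltry].
  by exists B; split; [rewrite num_real|move=> x cx y _; rewrite ger0_norm// ltW].
have mEgn n : measurable_fun D (EFin \o gn n) by apply/measurable_EFinP; exact: measurable_funTS.
have [ig _ cv] := @dominated_convergence _ _ _ mu _ mD (fun n => EFin \o gn n) (EFin \o g)
  (fun=> B%:E) mEgn
  ltac:(by apply/measurable_EFinP) ae1 iB ae2.
have e n : (0 < n)%N -> (\int[mu]_(x in D) (gn n x)%:E = (n%:R^-1 * \sum_(i < n) cosx n j i * b (xpt n i))%:E)%E.
  move=> n0; have nR : 0 < n%:R :> R by rewrite ltr0n.
  have i1 (i : 'I_n) : mu.-integrable D (EFin \o (\1_(I n i) : R -> R)).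
    by apply: integrableS (integrable_indic_itv _ _ _ _).
  rewrite /gn; under eq_integral do rewrite -sumEFin.
  rewrite integral_sum//; last first.
    move=> i; have := @integrableZl _ _ R mu D mD (g (xpt n i)) _ (i1 i).
    by apply: eq_integrable => // x _; rewrite EFinM.
  rewrite mulr_sumr -sumEFin; apply: eq_bigr => i _.
  transitivity ((g (xpt n i))%:E * \int[mu]_(x in D) (\1_(I n i) x)%:E)%E.
    by rewrite -(@integralZl _ _ R mu D mD _ (i1 i)); apply: eq_integral => x _; rewrite EFinM.
  rewrite integral_indic//; last exact: mI.
  have -> : I n i `&` D = I n i.
    apply/setIidPl => x; rewrite /I /D /= !in_itv/= => /andP[h1 h2].
    have i0 : 0 <= i%:R / n%:R :> R by rewrite divr_ge0.
    have i2 : i.+1%:R / n%:R <= 1 :> R by rewrite ler_pdivrMr// mul1r ler_nat.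
    by apply/andP; split; lra.
  have muI : mu (I n i) = (n%:R^-1)%:E.
    rewrite /I lebesgue_measure_itv/= lte_fin ltr_pM2r ?invr_gt0// ltr_nat ltnSn.
    by rewrite -EFinB; congr EFin; rewrite -natr1; field; rewrite gt_eqF.
  transitivity ((g (xpt n i))%:E * (n%:R^-1)%:E)%E; first by congr (_ * _)%E.
  by rewrite -EFinM; congr EFin; rewrite /g /cosx /c; ring.
rewrite /beta_coef /Rintegral.
have {}cv : (fun n => \int[mu]_(x in D) (gn n x)%:E)%E @ \oo --> (\int[mu]_(x in D) (g x)%:E)%E by exact: cv.
have fi : (\int[mu]_(x in D) (g x)%:E)%E \is a fin_num by exact: integrable_fin_num ig.
rewrite -(fineK fi) in cv.
have cv2 : fine (\int[mu]_(x in D) (gn n x)%:E)%E @[n --> \oo] --> fine (\int[mu]_(x in D) (g x)%:E)%E.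
  exact: (fine_cvg cv).
apply: cvg_trans cv2; apply: near_eq_cvg; exists 1%N => // n /= n0.
by rewrite /= e.
Qed.

End piecewise_lipschitz.

(** * The leading term of the Fourier coefficients *)

Section projection.
Context d (T : measurableType d) (R : realType) (P : probability T R).
Variables (e : nat -> T -> R) (f : R -> R).
Hypothesis ie : mutually_independent P e.
Hypothesis fe : forall i, has_density P (e i) f.
Local Notation v i w := (score P e (e i w)).

(** The score has variance 1/12 and the squared cosines sum to n/2, so the factor sqrt(24/n)
    normalises the variance to 1 when 0 < j < n. *)
Definition wcoef (n j : nat) (w : T) : R :=
  Num.sqrt (24 / n%:R) * \sum_(i < n) cosx n j i * v i w.

Let bv i : bdm (fun w => v i w).
Proof. exact: (bdm_comp1 ie i (bdm_score ie)). Qed.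

Lemma bdm_wcoef n j : bdm (wcoef n j).
Proof. by apply: bdmZ; apply: bdm_sum => i _; apply: bdmZ; exact: bv. Qed.

Let Ex_vv i k : i != k -> Ex P (fun w => v i w * v k w) = 0.
Proof.
move=> ik; have [ms _] := bdm_score ie.
have [_ E] := indep_ExM (indep_comp (indep_coord ie ik) ms ms) (bdm_L1 P (bv i)) (bdm_L1 P (bv k)).
rewrite [LHS]E [X in X * _](_ : _ = 0) ?mul0r//; exact: Ex_score.
Qed.

(** Bounding the squared cosines by 1 gives 2 in place of 1, but for all n and j, as the weak
    convergence argument requires. *)
Lemma Ex_wcoef2 n j : Ex P (fun w => wcoef n j w ^+ 2) <= 2.
Proof.
have -> : Ex P (fun w => wcoef n j w ^+ 2) = 24 / n%:R * (\sum_(i < n) cosx n j i ^+ 2 / 12).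
  transitivity (Ex P (fun w => 24 / n%:R * (\sum_(i < n) cosx n j i * v i w) ^+ 2)).
    by congr Ex; apply/funext => w; rewrite exprMn sqr_sqrtr// divr_ge0.
  have bs : bdm (fun w => \sum_(i < n) cosx n j i * v i w).
    by apply: bdm_sum => i _; apply: bdmZ; exact: bv.
  rewrite ExZ; last exact: bdm_L1 (bdmX 2 bs).
  congr (_ * _); rewrite -(big_mkord xpredT (fun i => cosx n j i ^+ 2 / 12)).
  under [X in Ex P X]eq_fun do rewrite -(big_mkord xpredT (fun i => cosx n j i * v i _)).
  have bf i k : L1 P (fun w => (cosx n j i * v i w) * (cosx n j k * v k w)).
    by apply: bdm_L1; apply: bdmM; apply: bdmZ; exact: bv.
  rewrite (Ex_sqr_uncorrelated (f := fun i w => cosx n j i * v i w)) ?iota_uniq//.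
    apply: eq_bigr => i _; under eq_fun do rewrite exprMn.
    by rewrite ExZ ?(Ex_score2 ie fe)//; exact: bdm_L1 (bdmX 2 (bv i)).
  move=> i k ik; under eq_fun do rewrite mulrACA.
  by rewrite ExZ ?Ex_vv ?mulr0//; apply: bdm_L1; exact: bdmM.
case: (posnP n) => [->|n0]; first by rewrite big_ord0 mulr0.
have nR : 0 < n%:R :> R by rewrite ltr0n.
apply: (@le_trans _ _ (24 / n%:R * (\sum_(i < n) 12^-1))).
  apply: ler_wpM2l; first by rewrite divr_ge0.
  apply: ler_sum => i _; rewrite ler_pdivrMr// mulVf// -(real_normK (num_real _)).
  by rewrite exprn_ile1// cosx_le1.
rewrite sumr_const card_ord -[X in _ * X]mulr_natl.
by rewrite le_eqVlt; apply/orP; left; apply/eqP; field; rewrite gt_eqF.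
Qed.

(** The sum of the W_j^2 is a quadratic form in the scores with matrix K(i,k) = sum_j cos cos.
    Orthogonality gives trace m n/2 and squared Hilbert-Schmidt norm m n^2/4. The off-diagonal part
    is a degenerate kernel sum, the diagonal part a sum of independent variables, and 864 is 2 times
    24^2 times (2 + 1)/4. *)
Lemma Ex_average_wcoef n m : (0 < n)%N -> (m < n)%N ->
  L1 P (fun w => (psum (fun j w => wcoef n j w ^+ 2) m w - m%:R) ^+ 2) /\
  Ex P (fun w => (psum (fun j w => wcoef n j w ^+ 2) m w - m%:R) ^+ 2) <= 864 * m%:R.
Proof.
move=> n0 mn; have nR : 0 < n%:R :> R by rewrite ltr0n.
pose K (i k : nat) : R := \sum_(1 <= j < m.+1) cosx n j i * cosx n j k.
pose p (z : R * R) : R := score P e z.1 * score P e z.2.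
pose A w := \sum_(x : 'I_n * 'I_n | x.1 != x.2) K x.1 x.2 * p (e x.1 w, e x.2 w).
pose B w := \sum_(0 <= i < n) K i i * (v i w ^+ 2 - 12^-1).
have sumKii : \sum_(i < n) K i i = m%:R * (n%:R / 2).
  rewrite /K exchange_big/= big_nat_cond.
  rewrite (eq_bigr (fun=> n%:R / 2)); last first.
    move=> j /andP[/andP[j1 jm] _]; by rewrite cosx_orth ?eqxx// j1/= (leq_trans jm mn).
  by rewrite -big_nat_cond sumr_const_nat subn1/= -[LHS]mulr_natl.
have sumK2 : \sum_(x : 'I_n * 'I_n) K x.1 x.2 ^+ 2 = m%:R * (n%:R ^+ 2 / 4).
  rewrite -(pair_bigA _ (fun i k : 'I_n => K i k ^+ 2))/=.
  transitivity (\sum_(1 <= j < m.+1) \sum_(1 <= l < m.+1) (\sum_(i < n) cosx n j i * cosx n l i) ^+ 2 : R).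
    rewrite /K; under eq_bigr do under eq_bigr do rewrite expr2 big_distrlr/=.
    under eq_bigr do rewrite exchange_big/=.
    rewrite exchange_big/=; apply: eq_bigr => j _.
    under eq_bigr do rewrite exchange_big/=.
    rewrite exchange_big/=; apply: eq_bigr => l _.
    rewrite expr2 big_distrlr/=; apply: eq_bigr => i _; apply: eq_bigr => k _; ring.
  rewrite big_nat_cond (eq_bigr (fun=> n%:R ^+ 2 / 4)).
    by rewrite -big_nat_cond sumr_const_nat subn1/= -[LHS]mulr_natl.
  move=> j /andP[/andP[j1 jm] _].
  have jn : (0 < j < n)%N by rewrite j1/= (leq_trans jm mn).
  rewrite (bigD1_seq j)//= ?mem_index_iota ?j1 ?iota_uniq// [X in _ + X]big1_seq ?addr0.
    by rewrite cosx_orth// eqxx; field.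
  move=> l /andP[lj]; rewrite mem_index_iota => /andP[l1 lm].
  rewrite cosx_orth//; last by rewrite l1/= (leq_trans lm mn).
  by rewrite eq_sym (negbTE lj) expr0n.
have S_E w : psum (fun j w => wcoef n j w ^+ 2) m w - m%:R = 24 / n%:R * (A w + B w).
  have -> : m%:R = 24 / n%:R * (\sum_(i < n) K i i * 12^-1).
    by rewrite -mulr_suml sumKii; field; rewrite gt_eqF.
  rewrite /psum /wcoef; under eq_bigr do rewrite exprMn sqr_sqrtr ?divr_ge0//.
  rewrite -mulr_sumr -mulrBr; congr (_ * _).
  have -> : \sum_(1 <= j < m.+1) (\sum_(i < n) cosx n j i * v i w) ^+ 2 =
      \sum_(x : 'I_n * 'I_n) K x.1 x.2 * p (e x.1 w, e x.2 w).
    under eq_bigr do rewrite expr2 big_distrlr/= pair_bigA/=.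
    rewrite exchange_big/=; apply: eq_bigr => x _; rewrite /K mulr_suml.
    by apply: eq_bigr => j _; rewrite /p/=; ring.
  rewrite (bigID (fun x : 'I_n * 'I_n => x.1 != x.2))/= -/(A w) -addrA; congr (_ + _).
  rewrite /B big_mkord.
  have -> : \sum_(x : 'I_n * 'I_n | ~~ (x.1 != x.2)) K x.1 x.2 * p (e x.1 w, e x.2 w) =
      \sum_(i < n) K i i * p (e i w, e i w).
    rewrite (reindex_onto (fun i : 'I_n => (i, i)) (fun x : 'I_n * 'I_n => x.1))/=.
      by apply: eq_bigl => i; rewrite !eqxx.
    by move=> [x y] /=; rewrite negbK => /eqP ->.
  rewrite -sumrB; apply: eq_bigr => i _; rewrite /p/=; ring.
have bK i k : bdm (fun w => K i k * p (e i w, e k w)).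
  by apply: bdmZ; rewrite /p/=; exact: bdmM.
have bA : bdm A by apply: bdm_sum => x _; exact: bK.
have bB1 i : bdm (fun w => K i i * (v i w ^+ 2 - 12^-1)).
  by apply: bdmZ; apply: bdmB; [exact: bdmX|exact: bdm_cst].
have bB : bdm B by apply: bdm_sum => i _.
have EA : Ex P (fun w => A w ^+ 2) <= 2 * (m%:R * (n%:R ^+ 2 / 4)).
  rewrite -sumK2.
  have bp : bdm p.
    have [ms [C hC]] := bdm_score ie.
    by apply: bdmM; split; [exact: measurableT_comp|exists C|exact: measurableT_comp|exists C].
  have := @degenerate_second_moment _ _ _ P e ie n K p 1 bp.
  rewrite expr1n mulr1; apply.
  - by move=> z; rewrite /p normrM -[leRHS]mulr1; apply: ler_pM => //; exact: (score_le1 ie).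
  - move=> k x; rewrite /p/= ExZ ?(Ex_score ie fe) ?mulr0//; exact: bdm_L1.
  - move=> k x; rewrite /p/=; under eq_fun do rewrite mulrC.
    by rewrite ExZ ?(Ex_score ie fe) ?mulr0//; exact: bdm_L1.
have EB : Ex P (fun w => B w ^+ 2) <= m%:R * (n%:R ^+ 2 / 4).
  rewrite Ex_sqr_uncorrelated ?iota_uniq//; last 2 first.
  - by move=> i j; apply: bdm_L1; exact: bdmM.
  - move=> i j ij.
    have mg k : measurable_fun setT (fun x => K k k * (score P e x ^+ 2 - 12^-1)).
      apply: measurable_funM => //; apply: measurable_funB => //.
      by apply: measurable_funX; case: (bdm_score ie).
    have [_ E] := indep_ExM (indep_comp (indep_coord ie ij) (mg i) (mg j)) (bdm_L1 P (bB1 i)) (bdm_L1 P (bB1 j)).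
    rewrite [LHS]E [X in X * _](_ : _ = 0) ?mul0r//.
    have l2 := bdm_L1 P (bdmX 2 (bv i)).
    rewrite [LHS](ExZ _ (L1B l2 (L1_cst P _))) (ExB l2 (L1_cst P _)).
    by rewrite (Ex_score2 ie fe) Ex_cst subrr mulr0.
  rewrite -sumK2 -(pair_bigA _ (fun i k : 'I_n => K i k ^+ 2))/= big_mkord.
  apply: ler_sum => i _; apply: (@le_trans _ _ (K i i ^+ 2)).
    have -> : K i i ^+ 2 = Ex P (fun=> K i i ^+ 2) by rewrite Ex_cst.
    apply: le_Ex; [exact: bdm_L1 (bdmX 2 (bB1 i))|exact: L1_cst|].
    move=> w; rewrite exprMn ler_piMr ?sqr_ge0//.
    have := score_le1 ie (e i w); have := sqr_ge0 (v i w).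
    rewrite ler_norml => h1 /andP[h2 h3].
    have h4 : v i w ^+ 2 <= 1 by nra.
    by nra.
  by rewrite (bigD1 i)//= lerDl sumr_ge0// => k _; exact: sqr_ge0.
under eq_fun do rewrite S_E.
have bAB := bdmD bA bB.
split; first exact: bdm_L1 (bdmX 2 (bdmZ _ bAB)).
have l2A := bdm_L1 P (bdmX 2 bA); have l2B := bdm_L1 P (bdmX 2 bB).
apply: (@le_trans _ _ (Ex P (fun w => 2 * (24 / n%:R) ^+ 2 * (A w ^+ 2 + B w ^+ 2)))).
  apply: le_Ex; [exact: bdm_L1 (bdmX 2 (bdmZ _ bAB))|by apply: L1Z; exact: L1D|].
  move=> w; rewrite exprMn [leRHS]mulrAC mulrC; apply: ler_wpM2r; first exact: sqr_ge0.
  by have := sqr_ge0 (A w - B w); nra.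
rewrite ExZ ?ExD//; last exact: L1D.
have c0 : 0 <= 2 * (24 / n%:R) ^+ 2 :> R by rewrite mulr_ge0// sqr_ge0.
apply: (le_trans (ler_wpM2l c0 (lerD EA EB))).
by rewrite le_eqVlt; apply/orP; left; apply/eqP; field; rewrite gt_eqF.
Qed.

(** Taylor expansion with the score bounded by 1, of mean 0 and variance 1/12: the cosine differs
    from the Gaussian factor at fourth order, and the sine is cubic. *)
Lemma cf_score (s : R) i :
  `|Ex P (fun w => cos (s * v i w)) - expR (- (s ^+ 2 / 24))| <= 2 * s ^+ 4 /\
  `|Ex P (fun w => sin (s * v i w))| <= `|s| ^+ 3.
Proof.
have ms : measurable_fun setT (fun w => s * v i w).
  by apply: measurable_funM => //; case: (bv i).
have lc := bdm_L1 P (bdm_cos ms); have ls := bdm_L1 P (bdm_sin ms).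
have l2 := bdm_L1 P (bdmX 2 (bv i)).
split.
  have e1 : `|Ex P (fun w => cos (s * v i w)) - (1 - s ^+ 2 / 24)| <= s ^+ 4.
    have E : 1 - s ^+ 2 / 24 = Ex P (fun w => 1 - s ^+ 2 / 2 * v i w ^+ 2).
      by rewrite ExB ?ExZ ?Ex_cst ?(Ex_score2 ie fe)//; [field|exact: L1_cst|exact: L1Z].
    rewrite E -ExB//; last by apply: L1B; [exact: L1_cst|exact: L1Z].
    apply: Ex_norm_le; first by apply: L1B => //; apply: L1B; [exact: L1_cst|exact: L1Z].
    move=> w; have [h _] := cos_sub_exp (s * v i w) (lexx 0).
    have -> : 1 - s ^+ 2 / 2 * v i w ^+ 2 = 1 - (s * v i w) ^+ 2 / 2 by field.
    apply: (le_trans h); rewrite exprMn ler_piMr ?exprn_even_ge0//.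
    rewrite (_ : v i w ^+ 4 = `|v i w| ^+ 4); last by rewrite -normrX ger0_norm// exprn_even_ge0.
    by rewrite exprn_ile1// (score_le1 ie).
  have y0 : 0 <= s ^+ 2 / 24 by rewrite divr_ge0// sqr_ge0.
  have [_ h] := cos_sub_exp 0 y0.
  have h2 : (s ^+ 2 / 24) ^+ 2 <= s ^+ 4.
    have -> : (s ^+ 2 / 24) ^+ 2 = s ^+ 4 / 576 by field.
    by have : 0 <= s ^+ 4 by [rewrite exprn_even_ge0]; lra.
  rewrite (_ : _ - _ = (Ex P (fun w => cos (s * v i w)) - (1 - s ^+ 2 / 24))
     - (expR (- (s ^+ 2 / 24)) - (1 - s ^+ 2 / 24))); last by ring.
  by apply: (le_trans (ler_normB _ _)); lra.
have E0 : Ex P (fun w => s * v i w) = 0 by rewrite ExZ ?(Ex_score ie fe) ?mulr0//; exact: bdm_L1.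
rewrite -[X in `|X|]subr0 -E0 -ExB//; last by apply: L1Z; exact: bdm_L1.
apply: Ex_norm_le; first by apply: L1B => //; apply: L1Z; exact: bdm_L1.
move=> w; apply: (le_trans (sin_sub_cube _)).
by rewrite normrM exprMn ler_piMr ?exprn_ge0// exprn_ile1// (score_le1 ie).
Qed.

(** A linear combination of the W_j is a sum of independent scores with coefficients [s n i] of
    order n^-1/2. The replacement errors are of third and fourth order in these, while their squares
    have a bounded sum. *)
Lemma cf_wcoef_cvg (M : nat) (a : nat -> R) (phi : R) :
  Ex P (fun w => cos (\sum_(j < M) a j * wcoef n j.+1 w + phi)) @[n --> \oo] -->
  cos phi * expR (- (\sum_(j < M) a j ^+ 2 / 2)).
Proof.
pose A := \sum_(j < M) `|a j|.
have A0 : 0 <= A by apply: sumr_ge0.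
pose s n i : R := Num.sqrt (24 / n%:R) * \sum_(j < M) a j * cosx n j.+1 i.
have sumE n w : \sum_(j < M) a j * wcoef n j.+1 w = \sum_(0 <= i < n) s n i * v i w.
  rewrite /wcoef big_mkord.
  under eq_bigr do rewrite mulrCA mulr_sumr.
  rewrite -mulr_sumr exchange_big/= mulr_sumr; apply: eq_bigr => i _.
  rewrite /s -mulrA mulr_suml; congr (_ * _); apply: eq_bigr => j _; ring.
(* Once n exceeds [M] all frequencies lie in the orthogonality range, so the product of the Gaussian
   factors equals its limit exactly. *)
have s2 n : (M < n)%N -> \sum_(i < n) s n i ^+ 2 = 12 * \sum_(j < M) a j ^+ 2.
  move=> Mn; have n0 : (0 < n)%N by exact: leq_ltn_trans Mn.
  have nR : 0 < n%:R :> R by rewrite ltr0n.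
  rewrite /s; under eq_bigr do rewrite exprMn sqr_sqrtr ?divr_ge0//.
  rewrite -mulr_sumr; under eq_bigr do rewrite expr2 big_distrlr/=.
  rewrite exchange_big/=.
  have -> : \sum_(j < M) \sum_(i < n) \sum_(l < M) a j * cosx n j.+1 i * (a l * cosx n l.+1 i) =
     \sum_(j < M) a j ^+ 2 * (n%:R / 2).
    apply: eq_bigr => j _; rewrite exchange_big/= (bigD1 j)//= [X in _ + X]big1 ?addr0.
      have jn : (0 < j.+1 < n)%N by rewrite /= (leq_ltn_trans _ Mn).
      have co := @cosx_orth R n j.+1 j.+1 jn jn; rewrite eqxx in co.
      by rewrite -co mulr_sumr; apply: eq_bigr => i _; ring.
    move=> l lj; transitivity (a j * a l * \sum_(i < n) cosx n j.+1 i * cosx n l.+1 i).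
      by rewrite mulr_sumr; apply: eq_bigr => i _; ring.
    rewrite cosx_orth/=; last 2 first.
    + by rewrite (leq_ltn_trans _ Mn).
    + by rewrite (leq_ltn_trans _ Mn).
    by rewrite eqSS eq_sym (negbTE (_ : l != j :> nat)) ?mulr0.
  by rewrite -mulr_suml; field; rewrite gt_eqF.
have sb n i : `|s n i| <= Num.sqrt (24 / n%:R) * A.
  rewrite normrM ger0_norm ?sqrtr_ge0//; apply: ler_wpM2l; first exact: sqrtr_ge0.
  apply: (le_trans (ler_norm_sum _ _ _)); apply: ler_sum => j _.
  by rewrite normrM ler_piMr// cosx_le1.
have key n : (M < n)%N ->
   `|Ex P (fun w => cos (\sum_(j < M) a j * wcoef n j.+1 w + phi)) -
     cos phi * expR (- (\sum_(j < M) a j ^+ 2 / 2))| <=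
   (2 * (Num.sqrt (24 / n%:R) * A) ^+ 2 + Num.sqrt (24 / n%:R) * A)
     * (12 * \sum_(j < M) a j ^+ 2).
  move=> Mn; have [ms _] := bdm_score ie.
  have mg i : measurable_fun setT (fun x => s n i * score P e x) by exact: measurable_funM.
  have c01 i : 0 <= expR (- (s n i ^+ 2 / 24)) <= 1.
    by rewrite expR_ge0 expR_le1 oppr_le0 divr_ge0// sqr_ge0.
  have := cf_indep_sum ie (g := fun i x => s n i * score P e x) phi mg c01 (iota_uniq 0 (n - 0)).
  rewrite -/(index_iota 0 n) => h.
  have e1 : \prod_(0 <= i < n) expR (- (s n i ^+ 2 / 24)) = expR (- (\sum_(j < M) a j ^+ 2 / 2)).
    rewrite -expR_sum big_mkord; congr expR; rewrite sumrN -!mulr_suml s2//; congr (- _).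
    by field.
  rewrite e1 in h.
  have -> : Ex P (fun w => cos (\sum_(j < M) a j * wcoef n j.+1 w + phi)) =
     Ex P (fun w => cos (\sum_(0 <= i < n) s n i * v i w + phi)).
    by congr Ex; apply/funext => w; rewrite sumE.
  apply: (le_trans h); rewrite -(s2 n Mn) mulr_sumr big_mkord; apply: ler_sum => i _.
  have [h1 h2] := cf_score (s n i) i.
  have := sb n i; set r := Num.sqrt _ * A => hr.
  have r0 : 0 <= r by rewrite mulr_ge0// sqrtr_ge0.
  apply: (le_trans (lerD h1 h2)); rewrite [leRHS]mulrDl; apply: lerD.
    rewrite -mulrA; apply: ler_wpM2l => //.
    rewrite (_ : s n i ^+ 4 = s n i ^+ 2 * s n i ^+ 2); last by ring.
    apply: ler_wpM2r; first exact: sqr_ge0.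
    by rewrite -(real_normK (num_real (s n i))) ler_pXn2r// nnegrE.
  by rewrite exprS real_normK ?num_real// ler_wpM2r// sqr_ge0.
have cs : (fun n => Num.sqrt (24 / n%:R) * A) @ \oo --> (0 : R).
  have h : (fun n => (24 : R) / n.+1%:R) @ \oo --> 24 * (0 : R).
    by apply: cvgM; [exact: cvg_cst|exact: cvg_harmonic].
  rewrite mulr0 in h.
  have hs : (fun n => Num.sqrt (24 / n.+1%:R : R)) @ \oo --> Num.sqrt (0 : R).
    exact: (cvg_comp _ _ h (@sqrt_continuous R 0)).
  rewrite sqrtr0 in hs.
  rewrite -(mul0r A) -cvg_shiftS; apply: cvgM; [exact: hs|exact: cvg_cst].
have cb : (fun n => (2 * (Num.sqrt (24 / n%:R) * A) ^+ 2 + Num.sqrt (24 / n%:R) * A)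
     * (12 * \sum_(j < M) a j ^+ 2)) @ \oo --> (0 : R).
  rewrite [X in _ --> X](_ : 0 = (2 * (0 * 0) + 0) * (12 * \sum_(j < M) a j ^+ 2)); last by ring.
  apply: cvgM; last exact: cvg_cst.
  apply: cvgD => //; apply: cvgM; first exact: cvg_cst.
  by under eq_fun do rewrite expr2; apply: cvgM.
apply/cvgrPdist_le => eps eps0; move/cvgrPdist_le : cb => /(_ eps eps0).
move=> [N _ hN]; exists (maxn N M.+1) => // n /=; rewrite geq_max => /andP[Nn Mn].
rewrite distrC; apply: (le_trans (key n Mn)).
by have := hN n Nn; rewrite sub0r normrN => /(le_trans _); apply; exact: ler_norm.
Qed.

End projection.

(** * Decomposition of the Fourier coefficients *)

Lemma sum_offdiag (R : realType) n (F : 'I_n * 'I_n -> R) :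
  \sum_(x : 'I_n * 'I_n) F x = \sum_(x : 'I_n * 'I_n | x.1 != x.2) F x + \sum_(i < n) F (i, i).
Proof.
rewrite (bigID (fun x : 'I_n * 'I_n => x.1 != x.2))/=; congr (_ + _).
rewrite (reindex_onto (fun i : 'I_n => (i, i)) (fun x : 'I_n * 'I_n => x.1))/=.
  by apply: eq_bigl => i; rewrite !eqxx.
by move=> [x y] /=; rewrite negbK => /eqP ->.
Qed.

Section decomposition.
Context d (T : measurableType d) (R : realType) (P : probability T R).
Variables (e : nat -> T -> R) (f h : R -> R) (b : R -> R).
Hypothesis ie : mutually_independent P e.
Hypothesis fe : forall i, has_density P (e i) f.
Hypothesis he : has_density P (fun w => (e 0%N w - e 1%N w)%R) h.
Hypothesis lh : lipschitz_near0 h.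
Hypothesis pb : piecewise_lipschitz01 b.

Definition alt_shift (n i k : nat) : R :=
  b (xpt n i) / Num.sqrt n%:R - b (xpt n k) / Num.sqrt n%:R.

Definition drift (n j : nat) : R :=
  Num.sqrt 24 * h 0 * (n%:R^-1 * \sum_(i < n) cosx n j i * b (xpt n i)).

(** The deterministic error of replacing each excess by its linear term h(0) times the shift. *)
Definition bias (n j : nat) : R :=
  \sum_(x : 'I_n * 'I_n) cosx n j x.1 * (excess P e (alt_shift n x.1 x.2) - h 0 * alt_shift n x.1 x.2).

Definition remainder (n j : nat) (w : T) : R :=
  Num.sqrt (24 / n%:R) / n%:R *
  (\sum_(x : 'I_n * 'I_n | x.1 != x.2) cosx n j x.1 * null_kernel P e (e x.1 w, e x.2 w)
   + \sum_(x : 'I_n * 'I_n | x.1 != x.2)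
       cosx n j x.1 * shift_kernel P e (alt_shift n x.1 x.2) (e x.1 w, e x.2 w)
   + bias n j).

Lemma sqrt24n n : (0 < n)%N -> Num.sqrt (24 * n%:R) = Num.sqrt (24 / n%:R) * n%:R :> R.
Proof.
move=> n0; have nR : 0 < n%:R :> R by rewrite ltr0n.
have -> : 24 * n%:R = 24 / n%:R * n%:R ^+ 2 :> R by field; rewrite gt_eqF.
by rewrite sqrtrM ?divr_ge0// sqrtr_sqr ger0_norm.
Qed.

(** The rank is a sum of indicators, each split by projection. Since the cosines sum to zero,
    everything that depends on the second index alone, or on neither index, drops out. *)
Lemma phihat_decomposition n j w : (0 < j < n)%N ->
  Num.sqrt (24 * n%:R) * phihat b e n j w =
  n%:R / n.+1%:R * (wcoef P e n j w + drift n j + remainder n j w).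
Proof.
move=> jn; have n0 : (0 < n)%N by case/andP: jn => j0; exact: ltn_trans.
have nR : 0 < n%:R :> R by rewrite ltr0n.
have n1R : 0 < n.+1%:R :> R by rewrite ltr0n.
have c0 : \sum_(i < n) cosx n j i = 0 :> R.
  by apply: sum_cosx; case/andP: jn => -> jn /=; apply: (leq_trans jn); rewrite leq_pmull.
pose c (i : nat) : R := cosx n j i.
pose v (i : nat) : R := score P e (e i w).
pose dl (i k : nat) : R := alt_shift n i k.
pose p (i k : nat) : R := null_kernel P e (e i w, e k w).
pose q (i k : nat) : R := shift_kernel P e (dl i k) (e i w, e k w).
(* The two kernels are defined so that this identity holds term by term; the tie with k = i is
   included, as the rank counts the observation itself. *)
have rk i : rankY b e n w i = \sum_(k < n) (((p i k + q i k) + (v i - v k)) + 2^-1 + excess P e (dl i k)).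
  rewrite /rankY; apply: eq_bigr => k _; rewrite /p /q /v /null_kernel /shift_kernel /score/=.
  rewrite (_ : (Yobs b e n w k <= Yobs b e n w i) = (e k w <= e i w + dl i k)%R); last first.
    by rewrite /Yobs /dl /alt_shift; apply/idP/idP; lra.
  by case: (e k w <= e i w + dl i k)%R => /=; ring.
pose OD := \sum_(x : 'I_n * 'I_n | x.1 != x.2) c x.1 * (p x.1 x.2 + q x.1 x.2).
have S_E : \sum_(i < n) rankY b e n w i * c i = n%:R * \sum_(i < n) c i * v i
    + OD + bias n j + h 0 * n%:R * \sum_(i < n) c i * (b (xpt n i) / Num.sqrt n%:R).
  (* On the diagonal the kernels take the constant value 1/2 - excess(0), which the cosine sum
     annihilates. *)
  have t1 : \sum_(i < n) \sum_(k < n) c i * (p i k + q i k) = OD.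
    rewrite (pair_bigA _ (fun i k : 'I_n => c i * (p i k + q i k)))/= sum_offdiag/=.
    rewrite -/OD (eq_bigr (fun i : 'I_n => c i * (2^-1 - excess P e 0))).
      by rewrite -mulr_suml c0 mul0r addr0.
    move=> i _; rewrite /p /q /null_kernel /shift_kernel/= /dl /alt_shift subrr addr0 lexx/=.
    by congr (_ * _); rewrite mulr1n; field.
  have t2 : \sum_(i < n) \sum_(k < n) c i * (v i - v k) = n%:R * \sum_(i < n) c i * v i.
    under eq_bigr do rewrite -mulr_sumr sumrB sumr_const card_ord mulrBr.
    rewrite sumrB -mulr_suml c0 mul0r subr0 mulr_sumr; apply: eq_bigr => i _.
    by rewrite -[v i *+ n]mulr_natl; ring.
  have t3 : \sum_(i < n) \sum_(k < n) c i * 2^-1 = 0.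
    by under eq_bigr do rewrite sumr_const; rewrite sumrMnl -mulr_suml c0 mul0r mul0rn.
  have t4 : \sum_(i < n) \sum_(k < n) c i * excess P e (dl i k) = bias n j +
      h 0 * n%:R * \sum_(i < n) c i * (b (xpt n i) / Num.sqrt n%:R).
    rewrite /bias -(pair_bigA _ (fun i k : 'I_n => cosx n j i * (excess P e (alt_shift n i k) - h 0 * alt_shift n i k)))/=.
    rewrite -[LHS](subrK (\sum_(i < n) \sum_(k < n) c i * (h 0 * dl i k))); congr (_ + _).
      rewrite -sumrB; apply: eq_bigr => i _; rewrite -sumrB; apply: eq_bigr => k _.
      by rewrite /c /dl; ring.
    transitivity (\sum_(i < n) (h 0 * n%:R * (c i * (b (xpt n i) / Num.sqrt n%:R))
       - h 0 * (\sum_(k < n) b (xpt n k) / Num.sqrt n%:R) * c i)).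
      apply: eq_bigr => i _; rewrite -!mulr_sumr /dl /alt_shift sumrB sumr_const card_ord.
      by rewrite -[_ *+ n]mulr_natl; ring.
    by rewrite sumrB -!mulr_sumr c0 mulr0 subr0.
  transitivity (\sum_(i < n) \sum_(k < n) (((c i * (p i k + q i k) + c i * (v i - v k)) + c i * 2^-1)
     + c i * excess P e (dl i k))).
    apply: eq_bigr => i _; rewrite rk mulr_suml; apply: eq_bigr => k _; ring.
  under eq_bigr do rewrite !big_split/=.
  by rewrite !big_split/= t1 t2 t3 t4; ring.
have ODE : OD = \sum_(x : 'I_n * 'I_n | x.1 != x.2) cosx n j x.1 * null_kernel P e (e x.1 w, e x.2 w)
   + \sum_(x : 'I_n * 'I_n | x.1 != x.2)
       cosx n j x.1 * shift_kernel P e (alt_shift n x.1 x.2) (e x.1 w, e x.2 w).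
  by rewrite -big_split/=; apply: eq_bigr => x _; rewrite mulrDr.
have drE : drift n j = Num.sqrt (24 / n%:R) * (h 0 * \sum_(i < n) c i * (b (xpt n i) / Num.sqrt n%:R)).
  under eq_bigr do rewrite mulrA.
  rewrite /drift -mulr_suml sqrtrM// sqrtrV//.
  have sn : Num.sqrt n%:R ^+ 2 = n%:R :> R by rewrite sqr_sqrtr.
  have sn0 : 0 < Num.sqrt n%:R :> R by rewrite sqrtr_gt0.
  rewrite -[in LHS]sn; field; rewrite gt_eqF//.
rewrite /remainder -ODE drE sqrt24n// /phihat.
have -> : \sum_(i < n) rankY b e n w i / n.+1%:R * cos (pi * j%:R * xpt n i) =
   n.+1%:R^-1 * \sum_(i < n) rankY b e n w i * c i.
  by rewrite mulr_sumr; apply: eq_bigr => i _; rewrite /c /cosx; ring.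
rewrite S_E /wcoef; field.
by rewrite !gt_eqF.
Qed.

Lemma bdm_remainder n j : bdm (remainder n j).
Proof.
apply: bdmZ; apply: bdmD; last exact: bdm_cst.
apply: bdmD; apply: bdm_sum => x _; apply: bdmZ.
  exact: (bdm_comp2 ie _ _ (bdm_null_kernel ie)).
exact: (bdm_comp2 ie _ _ (bdm_shift_kernel P e _)).
Qed.

(** After multiplication by 24/n^3 the degenerate part contributes 192/n, the shift part 96 H
    (2B)/sqrt n, and the squared bias 384 C^2 B^4 / n. The outer 3 is from (a+b+c)^2 <= 3
    (a^2+b^2+c^2). The shift part determines the rate. *)
Lemma Ex_remainder2 : exists (D : R) (N : nat), [/\ 0 <= D, (0 < N)%N & forall n j, (N <= n)%N ->
  Ex P (fun w => remainder n j w ^+ 2) <= D / Num.sqrt n%:R].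
Proof.
have [B B0 bB] := piecewise_bounded pb.
have [r [C [r0 C0 ex]]] := excess_taylor ie fe he lh.
pose H := `|h 0| + C * r.
have H0 : 0 <= H by rewrite addr_ge0// mulr_ge0// ltW.
pose D := 3 * (192 + 96 * (H * (2 * B)) + 384 * C ^+ 2 * B ^+ 4).
have D0 : 0 <= D.
  have h1 : 0 <= H * (2 * B) by apply: mulr_ge0 => //; lra.
  have h2 : 0 <= C ^+ 2 * B ^+ 4 by apply: mulr_ge0; [exact: sqr_ge0|exact: exprn_ge0].
  by rewrite /D -[384 * _ * _]mulrA; lra.
(* From here on every shift, at most 2B/sqrt n, lies in the neighbourhood where the expansion of the
   excess is valid. *)
pose N := (Num.truncn ((2 * B / r) ^+ 2)).+1.
exists D, N; split => // n j Nn.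
have n0 : (0 < n)%N by exact: leq_trans Nn.
have nR : 0 < n%:R :> R by rewrite ltr0n.
have n1 : 1 <= n%:R :> R by rewrite ler1n.
set sn := Num.sqrt n%:R.
have sn0 : 0 < sn by rewrite sqrtr_gt0.
have sn2 : sn ^+ 2 = n%:R by rewrite sqr_sqrtr// ltW.
have sn1 : 1 <= sn by rewrite -[leLHS]sqrtr1; apply: ler_wsqrtr.
have dlB i k : (i < n)%N -> (k < n)%N -> `|alt_shift n i k| <= 2 * B / sn.
  move=> i_n k_n; rewrite /alt_shift -mulrBl normrM (gtr0_norm (_ : 0 < sn^-1)) ?invr_gt0//.
  apply: ler_wpM2r; first by rewrite invr_ge0 ltW.
  apply: (le_trans (ler_normB _ _)).
  by have := bB _ (@xpt01 R _ _ i_n); have := bB _ (@xpt01 R _ _ k_n); lra.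
have Bsn : 2 * B / sn < r.
  have h1 : (2 * B / r) ^+ 2 < sn ^+ 2.
    rewrite sn2; apply: (lt_le_trans (truncnS_gt _)); by rewrite ler_nat.
  have h2 : 2 * B / r < sn.
    by rewrite -(@ltr_pXn2r _ 2)// nnegrE ?(ltW sn0)// divr_ge0 ?mulr_ge0// ltW.
  have h3 : 2 * B < sn * r by rewrite -ltr_pdivrMr.
  by rewrite ltr_pdivrMr// [r * _]mulrC.
have exB i k : (i < n)%N -> (k < n)%N -> `|excess P e (alt_shift n i k)| <= H * (2 * B / sn).
  move=> i_n k_n; have hd := dlB i k i_n k_n; set dl := alt_shift n i k in hd *.
  have hr : `|dl| < r by apply: le_lt_trans hd Bsn.
  have := ex dl hr => he1.
  rewrite (_ : excess P e dl = (excess P e dl - h 0 * dl) + h 0 * dl); last by ring.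
  apply: (le_trans (ler_normD _ _)); rewrite normrM.
  apply: (@le_trans _ _ (H * `|dl|)); last by apply: ler_wpM2l.
  rewrite -(real_normK (num_real dl)) in he1.
  have : C * `|dl| ^+ 2 <= C * r * `|dl|.
    by rewrite expr2 mulrA; apply: ler_wpM2r => //; apply: ler_wpM2l => //; exact: ltW.
  by rewrite /H mulrDl; lra.
have bias_le : `|bias n j| <= n%:R * (4 * C * B ^+ 2).
  rewrite /bias; apply: (le_trans (ler_norm_sum _ _ _)).
  apply: (@le_trans _ _ (\sum_(x : 'I_n * 'I_n) C * (2 * B / sn) ^+ 2)).
    apply: ler_sum => x _; rewrite normrM.
    have hd := dlB x.1 x.2 (ltn_ord _) (ltn_ord _).
    have hr : `|alt_shift n x.1 x.2| < r by apply: le_lt_trans hd Bsn.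
    rewrite -[leRHS]mul1r; apply: ler_pM => //; first exact: cosx_le1.
    apply: (le_trans (ex _ hr)); apply: ler_wpM2l => //.
    rewrite -(real_normK (num_real _)) ler_pXn2r// nnegrE//.
    by apply: le_trans hd.
  rewrite sumr_const card_prod !card_ord -[leLHS]mulr_natl natrM.
  rewrite le_eqVlt; apply/orP; left; apply/eqP.
  rewrite -[in LHS]sn2 expr_div_n -sn2; field; by rewrite gt_eqF.
pose kp : R := Num.sqrt (24 / n%:R) / n%:R.
have kp2 : kp ^+ 2 = 24 / n%:R ^+ 3.
  by rewrite /kp expr_div_n sqr_sqrtr ?divr_ge0//; field; rewrite gt_eqF.
pose A w := \sum_(x : 'I_n * 'I_n | x.1 != x.2) cosx n j x.1 * null_kernel P e (e x.1 w, e x.2 w).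
pose Bq w := \sum_(x : 'I_n * 'I_n | x.1 != x.2)
       cosx n j x.1 * shift_kernel P e (alt_shift n x.1 x.2) (e x.1 w, e x.2 w).
have bA : bdm A.
  by apply: bdm_sum => x _; apply: bdmZ; exact: (bdm_comp2 ie _ _ (bdm_null_kernel ie)).
have bBq : bdm Bq.
  by apply: bdm_sum => x _; apply: bdmZ; exact: (bdm_comp2 ie _ _ (bdm_shift_kernel P e _)).
have EA : Ex P (fun w => A w ^+ 2) <= 8 * n%:R ^+ 2.
  have := degenerate_second_moment ie n (fun i _ => cosx n j i) (bdm_null_kernel ie)
    (null_kernel_le2 ie) (Ex_null_kernel2 ie fe) (Ex_null_kernel1 ie fe).
  move/le_trans; apply; rewrite -(pair_bigA _ (fun i k : 'I_n => cosx n j i ^+ 2))/=.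
  apply: (@le_trans _ _ (2 * 2 ^+ 2 * \sum_(i < n) \sum_(k < n) 1)).
    apply: ler_wpM2l => //; apply: ler_sum => i _; apply: ler_sum => k _.
    by rewrite -(real_normK (num_real _)) exprn_ile1// cosx_le1.
  under eq_bigr do rewrite sumr_const card_ord.
  rewrite sumr_const card_ord -mulrnA.
  by rewrite natrM le_eqVlt; apply/orP; left; apply/eqP; ring.
have EB : Ex P (fun w => Bq w ^+ 2) <= 4 * n%:R ^+ 3 * (H * (2 * B / sn)).
  apply: (overlap_second_moment ie (c := fun i => cosx n j i)
    (q := fun i k => shift_kernel P e (alt_shift n i k))).
  - by move=> i; exact: cosx_le1.
  - by rewrite mulr_ge0// divr_ge0 ?mulr_ge0// ltW.
  - by move=> i k; exact: bdm_shift_kernel.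
  - by move=> i k ik; exact: (Ex_shift_kernel ie fe).
  - by move=> i k i_n k_n ik; apply: le_trans (Ex_shift_kernel2 ie fe _ ik) _; exact: exB.
have l1 := bdm_L1 P (bdmX 2 bA); have l2 := bdm_L1 P (bdmX 2 bBq).
apply: (@le_trans _ _ (Ex P (fun w => 3 * kp ^+ 2 * ((A w ^+ 2 + Bq w ^+ 2) + bias n j ^+ 2)))).
  apply: le_Ex; [exact: bdm_L1 (bdmX 2 (bdm_remainder n j))|apply: L1Z; apply: L1D; [exact: L1D|exact: L1_cst]|].
  move=> w; rewrite /remainder -/(A w) -/(Bq w) -/kp exprMn [leRHS]mulrAC mulrC.
  apply: ler_wpM2r; first exact: sqr_ge0.
  have := sqr_ge0 (A w - Bq w); have := sqr_ge0 (A w - bias n j).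
  by have := sqr_ge0 (Bq w - bias n j); nra.
rewrite ExZ; last by apply: L1D; [exact: L1D|exact: L1_cst].
rewrite (ExD (L1D l1 l2) (L1_cst P _)) (ExD l1 l2) Ex_cst kp2.
have b2 : bias n j ^+ 2 <= n%:R ^+ 2 * (16 * C ^+ 2 * B ^+ 4).
  rewrite -(real_normK (num_real _)).
  rewrite (_ : _ * (16 * C ^+ 2 * B ^+ 4) = (n%:R * (4 * C * B ^+ 2)) ^+ 2); last by ring.
  by rewrite ler_pXn2r// nnegrE// !mulr_ge0// exprn_ge0.
have k0 : 0 <= 3 * (24 / n%:R ^+ 3) :> R by rewrite mulr_ge0// divr_ge0// exprn_ge0.
apply: (le_trans (ler_wpM2l k0 (lerD (lerD EA EB) b2))).
have E : 3 * (24 / n%:R ^+ 3) * (8 * n%:R ^+ 2 + 4 * n%:R ^+ 3 * (H * (2 * B / sn)) + n%:R ^+ 2 * (16 * C ^+ 2 * B ^+ 4))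
  = 3 * (192 * n%:R^-1 + 96 * (H * (2 * B)) / sn + 384 * C ^+ 2 * B ^+ 4 * n%:R^-1).
  by field; rewrite !gt_eqF.
rewrite E /D.
have ns : n%:R^-1 <= sn^-1 by rewrite -sn2 lef_pV2 ?posrE ?exprn_gt0// expr2 ler_peMr// ltW.
rewrite -![384 * _ * _]mulrA.
have : 0 <= C ^+ 2 * B ^+ 4 by apply: mulr_ge0; [exact: sqr_ge0|exact: exprn_ge0].
move: (C ^+ 2 * B ^+ 4) (H * (2 * B)) (n%:R^-1) (sn^-1) ns => x y u v uv x0.
have h2 : x * u <= x * v by exact: ler_wpM2l.
by lra.
Qed.

End decomposition.

(** * Averaged squares *)

Section rms.
Context {R : realType}.
Implicit Types x y : nat -> R.

(** A seminorm in [x]: the test statistic is a maximum of its squares, and the triangle inequality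
    separates the three terms of the Fourier coefficients. *)
Definition rms m x : R := Num.sqrt (m%:R^-1 * \sum_(1 <= j < m.+1) x j ^+ 2).

Let ssq m x : R := m%:R^-1 * \sum_(1 <= j < m.+1) x j ^+ 2.

Let ssq_ge0 m x : 0 <= ssq m x.
Proof. by rewrite mulr_ge0// sumr_ge0// => j _; exact: sqr_ge0. Qed.

Lemma rms_ge0 m x : 0 <= rms m x. Proof. exact: sqrtr_ge0. Qed.

Lemma rms_sqr m x : rms m x ^+ 2 = m%:R^-1 * \sum_(1 <= j < m.+1) x j ^+ 2.
Proof. by rewrite sqr_sqrtr// ssq_ge0. Qed.

Lemma eq_rms m x y : (forall j, (0 < j <= m)%N -> x j = y j) -> rms m x = rms m y.
Proof.
move=> xy; rewrite /rms big_nat_cond [in RHS]big_nat_cond; congr (Num.sqrt (_ * _)).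
by apply: eq_bigr => j /andP[jm _]; rewrite xy.
Qed.

Lemma le_rms m (s : R) x : 0 <= s -> (0 < m)%N ->
  (s <= rms m x) = (s ^+ 2 * m%:R <= \sum_(1 <= j < m.+1) x j ^+ 2).
Proof.
move=> s0 m0; have mR : 0 < m%:R :> R by rewrite ltr0n.
by rewrite -(@ler_pXn2r _ 2)// ?nnegrE ?rms_ge0// rms_sqr mulrC ler_pdivlMr.
Qed.

Lemma rmsZ m a x : rms m (fun j => a * x j) = `|a| * rms m x.
Proof.
rewrite /rms -sqrtr_sqr -sqrtrM ?sqr_ge0//; congr Num.sqrt.
under eq_bigr do rewrite exprMn.
by rewrite -mulr_sumr mulrCA.
Qed.

Let cauchy_schwarz m x y :
  (\sum_(1 <= j < m.+1) x j * y j) ^+ 2 <=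
  (\sum_(1 <= j < m.+1) x j ^+ 2) * (\sum_(1 <= j < m.+1) y j ^+ 2).
Proof.
set A := \sum_(1 <= j < m.+1) x j ^+ 2; set B := \sum_(1 <= j < m.+1) y j ^+ 2.
set C := \sum_(1 <= j < m.+1) x j * y j.
have A0 : 0 <= A by apply: sumr_ge0 => j _; exact: sqr_ge0.
have : 0 <= \sum_(1 <= j < m.+1) (A * y j - C * x j) ^+ 2.
  by apply: sumr_ge0 => j _; exact: sqr_ge0.
rewrite (eq_bigr (fun j => A ^+ 2 * y j ^+ 2 - 2 * A * C * (x j * y j) + C ^+ 2 * x j ^+ 2)); last first.
  by move=> j _; ring.
rewrite big_split/= sumrB -!mulr_sumr -/A -/B -/C.
have -> : A ^+ 2 * B - 2 * A * C * C + C ^+ 2 * A = A * (A * B - C ^+ 2) by ring.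
move: A0; rewrite le_eqVlt => /orP[/eqP A0 _|A0]; last by rewrite pmulr_rge0// subr_ge0.
suff -> : C = 0 by rewrite expr0n/= -A0 mul0r.
rewrite /C big_nat_cond big1// => j jm; suff -> : x j = 0 by rewrite mul0r.
have /eqP := esym A0; rewrite /A big_nat_cond psumr_eq0; last by move=> i _; exact: sqr_ge0.
move=> /allP/(_ j); rewrite mem_index_iota; move: (jm); rewrite andbT => jm' /(_ jm').
by rewrite /= jm' /= sqrf_eq0 => /eqP.
Qed.

Lemma rms_triangle m x y : rms m (fun j => x j + y j) <= rms m x + rms m y.
Proof.
rewrite -(@ler_pXn2r _ 2) ?nnegrE ?addr_ge0 ?rms_ge0// sqrrD !rms_sqr.
set u := m%:R^-1; have u0 : 0 <= u :> R by rewrite invr_ge0.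
under eq_bigr do rewrite sqrrD.
rewrite !big_split/= !mulrDr lerD2r lerD2l -mulr2n ler_pMn2r//.
apply: (le_trans (ler_norm _)).
rewrite -(@ler_pXn2r _ 2) ?nnegrE ?mulr_ge0 ?rms_ge0// real_normK ?num_real//.
rewrite [leRHS]exprMn !rms_sqr exprMn -/u.
rewrite (_ : u * _ * (u * _) = u ^+ 2 * ((\sum_(1 <= j < m.+1) x j ^+ 2) * (\sum_(1 <= j < m.+1) y j ^+ 2))); last by ring.
by apply: ler_wpM2l; [exact: sqr_ge0|exact: cauchy_schwarz].
Qed.

Lemma rms_le m x B : 0 <= B -> (forall j, (0 < j <= m)%N -> `|x j| <= B) -> rms m x <= B.
Proof.
move=> B0 xB; rewrite -(@ler_pXn2r _ 2) ?nnegrE ?rms_ge0// rms_sqr.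
case: m xB => [|m] xB; first by rewrite invr0 mul0r sqr_ge0.
rewrite ler_pdivrMl ?ltr0n//; apply: (@le_trans _ _ (\sum_(1 <= j < m.+2) B ^+ 2)).
  rewrite big_nat_cond [leRHS]big_nat_cond; apply: ler_sum => j /andP[jm _].
  by rewrite -(real_normK (num_real _)) ler_pXn2r ?nnegrE// xB.
by rewrite sumr_const_nat subSS subn0 mulr_natl.
Qed.

Lemma rms_sub m x y : rms m x <= rms m y + rms m (fun j => x j - y j).
Proof.
apply: le_trans (rms_triangle _ _ _); rewrite le_eqVlt; apply/orP; left; apply/eqP.
by apply: eq_rms => j _; ring.
Qed.

Definition peak M x : R := \big[Num.max/0]_(1 <= m < M.+1) rms m x.

(** A positive level is needed because the maximum starts from the value 0. *)
Lemma le_peak M (s : R) x : 0 < s ->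
  (s <= peak M x) <-> exists2 m, (0 < m <= M)%N & s <= rms m x.
Proof.
move=> s0; rewrite /peak; split.
  move=> sM; apply: contrapT => nm; move: sM; apply/negP; rewrite -ltNge big_seq.
  elim/big_ind : _ => // [u v us vs|m]; first by rewrite gt_max us.
  by rewrite mem_index_iota ltnS => mM; rewrite ltNge; apply/negP => sm; apply: nm; exists m.
move=> [m /andP[m0 mM] sm]; apply: (le_trans sm).
by apply: (le_bigmax_seq 0 m xpredT (fun m => rms m x)) => //; rewrite mem_index_iota m0.
Qed.

Lemma peak_ge0 M x : 0 <= peak M x.
Proof. by rewrite /peak; apply: bigmax_ge_id. Qed.

Lemma peak_sub M x y B : (forall j, (0 < j <= M)%N -> `|x j - y j| <= B) ->
  0 <= B -> `|peak M x - peak M y| <= B.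
Proof.
move=> xyB B0.
suff h u v : (forall j, (0 < j <= M)%N -> `|u j - v j| <= B) -> peak M u <= peak M v + B.
  have h1 := h x y xyB; have h2 : peak M y <= peak M x + B by apply: h => j /xyB; rewrite distrC.
  by rewrite ler_norml; lra.
move=> uvB; rewrite [peak M u]/peak big_seq; apply: bigmax_le; first by rewrite addr_ge0// peak_ge0.
move=> m; rewrite mem_index_iota ltnS => mM.
apply: (le_trans (rms_sub _ _ v)); apply: lerD.
  by apply: (le_bigmax_seq 0 m xpredT (fun m => rms m v)) => //; rewrite mem_index_iota.
apply: rms_le => // j /andP[j0 jm]; apply: uvB; rewrite j0 (leq_trans jm)//.
by case/andP: mM.
Qed.

End rms.

Lemma measurable_rms d (T : measurableType d) (R : realType) (X : nat -> T -> R) m :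
  (forall j, measurable_fun setT (X j)) -> measurable_fun setT (fun w => rms m (X ^~ w)).
Proof.
move=> mX; apply: (measurableT_comp (f := @Num.sqrt R)).
  by apply: continuous_measurable_fun; exact: sqrt_continuous.
apply: measurable_funM => //; apply: measurable_sum => j.
exact: measurable_funX.
Qed.

Lemma measurable_peak d (T : measurableType d) (R : realType) (X : nat -> T -> R) M :
  (forall j, measurable_fun setT (X j)) -> measurable_fun setT (fun w => peak M (X ^~ w)).
Proof.
move=> mX; rewrite /peak; elim: (index_iota 1 M.+1) => [|m r IH].
  by under eq_fun do rewrite big_nil; exact: measurable_cst.
by under eq_fun do rewrite big_cons; apply: measurable_maxr => //; exact: measurable_rms.
Qed.

Lemma measurable_rms_event d (T : measurableType d) (R : realType) (X : nat -> T -> R) (s : R)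
    (D : set nat) :
  (forall j, measurable_fun setT (X j)) ->
  measurable [set w | exists2 m, D m & s <= rms m (X ^~ w)].
Proof.
move=> mX.
rewrite (_ : [set _ | _] = \bigcup_(m in D) [set w | s <= rms m (X ^~ w)]).
  apply: bigcup_measurable => m _.
  by apply: measurable_set_bool; apply: measurable_fun_ler => //; exact: measurable_rms.
by apply/seteqP; split => w /= [m]; exists m.
Qed.

(** The fourth root of n is a crude substitute for the logarithm, sufficient against remainders of
    order n^-1/2. *)
Lemma harmonic_le (R : realType) n :
  \sum_(1 <= j < n) j%:R^-1 <= 16 * Num.sqrt (Num.sqrt n%:R) :> R.
Proof.
elim: n => [|n IH]; first by rewrite big_geq// mulr_ge0// sqrtr_ge0.
case: n IH => [|n] IH; first by rewrite big_geq// mulr_ge0// sqrtr_ge0.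
rewrite big_nat_recr//=.
set a := Num.sqrt (Num.sqrt n.+1%:R) in IH; set c := Num.sqrt (Num.sqrt n.+2%:R).
have n1 : 1 <= n.+1%:R :> R by rewrite ler1n.
have aE : n.+1%:R = a ^+ 4 by rewrite -[4%N]/(2 * 2)%N (exprM a 2 2) !sqr_sqrtr ?sqrtr_ge0.
have cE : n.+2%:R = c ^+ 4 by rewrite -[4%N]/(2 * 2)%N (exprM c 2 2) !sqr_sqrtr ?sqrtr_ge0.
have a1 : 1 <= a by rewrite -[leLHS]sqrtr1 ler_wsqrtr// -[leLHS]sqrtr1 ler_wsqrtr.
have ac : a <= c by rewrite !ler_wsqrtr// ler_nat.
have acE : c ^+ 4 = a ^+ 4 + 1 by rewrite -aE -cE natr1.
have c2 : c <= 2 * a.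
  rewrite leNgt; apply/negP => h.
  have : (2 * a) ^+ 4 < c ^+ 4 by rewrite ltr_pXn2r// nnegrE; lra.
  rewrite acE exprMn; have : 1 <= a ^+ 4 by rewrite exprn_ege1.
  lra.
apply: (le_trans (lerD IH (lexx _))).
rewrite aE -lerBrDl -mulrBr -div1r ler_pdivrMr; last by rewrite exprn_gt0//; lra.
(* For consecutive fourth roots, c^4 - a^4 = 1 factors as displayed; with c <= 2a the second factor
   is at most 15 a^3, so c - a >= 1/(15 a^3). *)
have e1 : (c - a) * ((c + a) * (c ^+ 2 + a ^+ 2)) = 1.
  by rewrite (_ : _ * _ = c ^+ 4 - a ^+ 4); [rewrite acE; ring|ring].
have e2 : (c + a) * (c ^+ 2 + a ^+ 2) <= 15 * a ^+ 3.
  rewrite (_ : 15 * a ^+ 3 = (3 * a) * (5 * a ^+ 2)); last by ring.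
  have a0 : 0 <= a ^+ 2 by exact: sqr_ge0.
  have c0 : c ^+ 2 <= (2 * a) ^+ 2 by rewrite ler_pXn2r// nnegrE; lra.
  rewrite exprMn in c0.
  by apply: ler_pM; try lra; rewrite addr_ge0// sqr_ge0.
have e3 : a ^+ 3 <= a ^+ 4 by apply: ler_weXn2l.
have ca : 0 <= c - a by rewrite subr_ge0.
have e4 := ler_wpM2l ca e2; have e5 := ler_wpM2l ca e3.
by rewrite e1 in e4; lra.
Qed.

(** * Tails and absence of atoms for the Gaussian averages *)

Section gauss_limit.
Context d (T : measurableType d) (R : realType) (Q : probability T R).
Variable Z : nat -> T -> R.
Hypothesis iZ : mutually_independent Q Z.
Hypothesis nZ : forall j, has_density Q (Z j) (normal_pdf 0 1).

(** The maximal inequality handles m <= N with a bound free of [N]; continuity from below removes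
    the cap. The constant is 32 times the variance 2. *)
Lemma gauss_tail (s : R) K : 1 < s -> 6 / (s ^+ 2 - 1) <= K%:R ->
  pr Q [set w | exists2 m, (K ^ 2 <= m)%N & s <= rms m (Z ^~ w)]
    <= 64 / (s ^+ 2 - 1) ^+ 2 / K%:R.
Proof.
move=> s1 Ks; have s21 : 1 < s ^+ 2 by rewrite expr_gt1// ltW// (lt_trans _ s1).
have K0 : (0 < K)%N.
  rewrite -(ltr0n R); apply: lt_le_trans Ks; by rewrite divr_gt0// subr_gt0.
pose E N := [set w | exists2 m, (K ^ 2 <= m <= N)%N & s <= rms m (Z ^~ w)].
have mE (D : set nat) := measurable_rms_event s D iZ.1.
set F := [set w | _].
have FE : F = \bigcup_N E N.
  apply/seteqP; split => w /=; last by move=> [N _ [m /andP[Km _] sm]]; exists m.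
  by move=> [m Km sm]; exists m => //; exists m => //; rewrite Km leqnn.
rewrite -lee_fin EFin_pr; last exact: mE.
have cv := @nondecreasing_cvg_mu _ _ _ Q E.
rewrite FE -(cvg_lim _ (cv _ _ _))//; last 3 first.
- by move=> N; exact: mE.
- by rewrite -FE; exact: mE.
- move=> N N' NN'; apply/subsetPset => w [m /andP[Km mN] sm].
  by exists m => //; rewrite Km (leq_trans mN).
apply: lime_le; first by apply/cvg_ex; eexists; apply: cv;
  [move=> N; exact: mE|rewrite -FE; exact: mE|
   move=> N N' NN'; apply/subsetPset => w [m /andP[Km mN] sm]; exists m => //; rewrite Km (leq_trans mN)].
apply: nearW => N; rewrite [leLHS](_ : _ = (pr Q (E N))%:E); last by rewrite EFin_pr//; exact: mE.
rewrite lee_fin.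
have mZ j : measurable_fun setT (fun w => Z j w ^+ 2) by apply: measurable_funX; exact: iZ.1.
have := @average_tail _ _ _ Q (fun j w => Z j w ^+ 2) N K 2 (s ^+ 2) _ s21 Ks mZ (fun j w => sqr_ge0 _).
rewrite (_ : 32 * 2 = 64) -?natrM// => h; apply: le_trans (h _ _) => //; last first.
  move=> m mN; have [l e] := chi2_second_moment iZ nZ (iota_uniq 1 m).
  rewrite size_iota in e.
  rewrite (_ : (fun w => (psum _ m w - m%:R) ^+ 2) = (fun w => (\sum_(j <- iota 1 m) (Z j w ^+ 2 - 1)) ^+ 2)).
    by rewrite e; split.
  apply/funext => w; rewrite /psum /index_iota subSS subn0 sumrB; congr ((_ - _) ^+ 2).
  by rewrite big_const_seq count_predT size_iota iter_addr_0.
apply: le_pr; first exact: mE.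
  rewrite (_ : [set _ | _] = E N); first exact: mE.
  apply/seteqP; split => w /= [m Km sm]; exists m => //; move: sm; rewrite le_rms//; try lra;
   by apply: leq_trans (_ : (K ^ 2 <= _)%N); rewrite ?expn_gt0 ?K0//; case/andP: Km.
move=> w /= [m Km sm]; exists m => //; move: sm; rewrite le_rms//; first lra.
by apply: leq_trans (_ : (K ^ 2 <= _)%N); rewrite ?expn_gt0 ?K0//; case/andP: Km.
Qed.

(* Given the other coordinates, the event fixes the last one up to two values. *)
Lemma rms_no_atom (s : R) (c : nat -> R) m : (0 < m)%N -> 0 < s ->
  pr Q [set w | rms m (fun j => Z j w + c j) == s] = 0.
Proof.
case: m => // m _ s0; set S := [set w | _].
pose g (j : nat) (z : R) := (z + c j) ^+ 2.
have mg j : measurable_fun setT (g j).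
  by apply: measurable_funX; apply: measurable_funD.
pose a := s ^+ 2 * m.+1%:R.
pose Phi (x : R * R) : R := (x.1 + g m.+1 x.2 == a)%:R.
have iU := @indep_sum _ _ _ Q Z iZ g (index_iota 1 m.+1) m.+1 mg.
rewrite mem_index_iota ltnn andbF in iU; have {}iU := iU isT.
have bPhi : bdm Phi.
  apply: bdm_bool; rewrite (_ : (fun x : R * R => _) = (fun x : R * R =>
    (x.1 + g m.+1 x.2 <= a) && (a <= x.1 + g m.+1 x.2))); last first.
    by apply/funext => x; rewrite -eq_le.
  have mx : measurable_fun setT (fun x : R * R => x.1 + g m.+1 x.2).
    by apply: measurable_funD => //; exact: (measurableT_comp (mg _)).
  by apply: measurable_and; apply: measurable_fun_ler.
have SE w : (rms m.+1 (fun j => Z j w + c j) == s) =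
    (\sum_(j <- index_iota 1 m.+1) g j (Z j w) + g m.+1 (Z m.+1 w) == a).
  rewrite -(@eqrXn2 _ 2) ?rms_ge0// ?ltW// rms_sqr big_nat_recr//= mulrC.
  by rewrite /a; apply/eqP/eqP => [<-|->]; rewrite ?divfK ?mulfK// pnatr_eq0.
rewrite /S (_ : [set w | _] = [set w | \sum_(j <- index_iota 1 m.+1) g j (Z j w) + g m.+1 (Z m.+1 w) == a]); last first.
  by apply/seteqP; split => w /=; rewrite SE.
rewrite -(@Ex_bool _ _ _ Q (fun w => \sum_(j <- index_iota 1 m.+1) g j (Z j w) + g m.+1 (Z m.+1 w) == a)); last first.
  have [mU mV _] := iU.
  rewrite (_ : (fun w => _) = (fun w => (\sum_(j <- index_iota 1 m.+1) g j (Z j w) + g m.+1 (Z m.+1 w) <= a)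
    && (a <= \sum_(j <- index_iota 1 m.+1) g j (Z j w) + g m.+1 (Z m.+1 w)))); last first.
    by apply/funext => x; rewrite -eq_le.
  have mx : measurable_fun setT (fun w => \sum_(j <- index_iota 1 m.+1) g j (Z j w) + g m.+1 (Z m.+1 w)).
    by apply: measurable_funD => //; exact: (measurableT_comp (mg _)).
  by apply: measurable_and; apply: measurable_fun_ler.
rewrite (Ex_indep iU bPhi).
under eq_fun => w.
  rewrite (_ : Ex _ _ = 0); first by over.
  set u := \sum_(_ <- _) _.
  have le2 w' : Phi (u, Z m.+1 w') <= (Z m.+1 w' == Num.sqrt (a - u) - c m.+1)%:R
      + (Z m.+1 w' == - Num.sqrt (a - u) - c m.+1)%:R.
    rewrite /Phi /=; case: eqP => [h|_]; last by rewrite addr_ge0.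
    have e : (Z m.+1 w' + c m.+1) ^+ 2 = Num.sqrt (a - u) ^+ 2.
      by rewrite sqr_sqrtr -h /g; [ring|rewrite addrAC subrr add0r sqr_ge0].
    move/eqP: e; rewrite eqf_sqr => /orP[] /eqP e.
      by rewrite (_ : Z m.+1 w' = Num.sqrt (a - u) - c m.+1) ?eqxx ?lerDl//; lra.
    by rewrite (_ : (Z m.+1 w' == - Num.sqrt (a - u) - c m.+1)) ?lerDr//; apply/eqP; lra.
  have mb x : measurable_fun setT (fun w' => Z m.+1 w' == x).
    rewrite (_ : (fun w' => _) = (fun w' => (Z m.+1 w' <= x) && (x <= Z m.+1 w'))); last first.
      by apply/funext => w'; rewrite -eq_le.
    by have mZ := iZ.1 m.+1; apply: measurable_and; apply: measurable_fun_ler.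
  have l x := bdm_L1 Q (bdm_bool R (mb x)).
  apply/eqP; rewrite eq_le Ex_ge0 ?andbT; last by move=> w'; rewrite /Phi ler0n.
  rewrite -[leRHS]addr0 -[X in _ <= X + _](density_no_atom iZ nZ m.+1 (Num.sqrt (a - u) - c m.+1)).
  rewrite -[X in _ <= _ + X](density_no_atom iZ nZ m.+1 (- Num.sqrt (a - u) - c m.+1)) -ExD//.
  apply: le_Ex => //; last exact: L1D.
  apply: bdm_L1; exact: (bdm_partial (iZ.1 m.+1) bPhi u).
by rewrite Ex_cst.
Qed.

(** The shrinking neighbourhoods of the level decrease to an event of probability zero, so
    continuity from above applies. *)
Lemma rms_concentration (s eps : R) (c : nat -> R) m : (0 < m)%N -> 0 < s -> 0 < eps ->
  exists2 eta, 0 < eta & pr Q [set w | `|rms m (fun j => Z j w + c j) - s| <= eta] <= eps.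
Proof.
move=> m0 s0 e0.
have mr : measurable_fun setT (fun w => rms m (fun j => Z j w + c j)).
  apply: (measurable_rms (X := fun j w => Z j w + c j)) => j.
  by apply: measurable_funD => //; exact: iZ.1.
pose F k := [set w | `|rms m (fun j => Z j w + c j) - s| <= k.+1%:R^-1].
have mF k : measurable (F k).
  apply: measurable_set_bool; apply: measurable_fun_ler => //.
  by apply: measurableT_comp => //; exact: measurable_funB.
have capF : \bigcap_k F k = [set w | rms m (fun j => Z j w + c j) == s].
  apply/seteqP; split => w /=; last by move=> /eqP h k _; rewrite /F/= h subrr normr0.
  move=> h; rewrite -subr_eq0 -normr_eq0 eq_le normr_ge0 andbT.
  apply/ler_addgt0Pl => x x0; rewrite addr0.
  have := h (Num.truncn x^-1) I => /le_trans; apply.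
  rewrite -[leRHS]invrK lef_pV2 ?posrE ?invr_gt0//; exact/ltW/truncnS_gt.
have mcap : measurable (\bigcap_k F k) by exact: bigcap_measurable.
have F0 : (Q (F 0%N) < +oo)%E by exact: le_lt_trans (probability_le1 _ (mF _)) (ltry _).
have niF : nonincreasing_seq F.
  move=> k l kl; apply/subsetPset => w /= /le_trans; apply.
  by rewrite lef_pV2 ?posrE// ler_nat.
have Q0 : Q (\bigcap_k F k) = 0%E by rewrite -EFin_pr// capF rms_no_atom.
have := nonincreasing_cvg_mu F0 mF mcap niF.
rewrite [X in _ --> X](_ : _ = 0%E); last exact: Q0.
move=> /fine_cvgP[_] /cvgrPdist_le /(_ _ e0)[k _ /(_ k (leqnn _))] /= h.
exists k.+1%:R^-1; first by [].
by move: h; rewrite sub0r normrN; apply: le_trans; exact: ler_norm.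
Qed.

End gauss_limit.

(** * Bounds uniform in m for the three terms of the Fourier coefficients *)

Section rank_tails.
Context d (T : measurableType d) (R : realType) (P : probability T R).
Variables (e : nat -> T -> R) (f h : R -> R) (b : R -> R).
Hypothesis ie : mutually_independent P e.
Hypothesis fe : forall i, has_density P (e i) f.
Hypothesis he : has_density P (fun w => (e 0%N w - e 1%N w)%R) h.
Hypothesis lh : lipschitz_near0 h.
Hypothesis pb : piecewise_lipschitz01 b.

Lemma wcoef_tail (s : R) K n : 1 < s -> 6 / (s ^+ 2 - 1) <= K%:R ->
  pr P [set w | exists2 m, (K ^ 2 <= m < n)%N & s <= rms m (fun j => wcoef P e n j w)]
    <= 32 * 864 / (s ^+ 2 - 1) ^+ 2 / K%:R.
Proof.
move=> s1 Ks; have s21 : 1 < s ^+ 2 by rewrite expr_gt1// ltW// (lt_trans _ s1).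
have K0 : (0 < K)%N.
  rewrite -(ltr0n R); apply: lt_le_trans Ks; by rewrite divr_gt0// subr_gt0.
have mW j : measurable_fun setT (wcoef P e n j) by have [] := bdm_wcoef ie n j.
have mW2 j : measurable_fun setT (fun w => wcoef P e n j w ^+ 2) by exact: measurable_funX.
case: n mW mW2 => [|n] mW mW2.
  have -> : [set w | exists2 m, (K ^ 2 <= m < 0)%N & s <= rms m (fun j => wcoef P e 0 j w)] = set0.
    by apply/seteqP; split => w // [m]; rewrite ltn0 andbF.
  by rewrite /pr measure0; apply: divr_ge0; [apply: divr_ge0|]; rewrite ?sqr_ge0 ?mulr_ge0 ?ler0n.
have C0 : 0 <= 864 :> R by rewrite ler0n.
have Wm m : (m <= n)%N -> L1 P (fun w => (psum (fun j w => wcoef P e n.+1 j w ^+ 2) m w - m%:R) ^+ 2) /\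
     Ex P (fun w => (psum (fun j w => wcoef P e n.+1 j w ^+ 2) m w - m%:R) ^+ 2) <= 864 * m%:R.
  by move=> mn; exact: (Ex_average_wcoef ie fe).
have := average_tail C0 s21 Ks mW2 (fun j w => sqr_ge0 _) Wm.
have E : [set w | exists2 m, (K ^ 2 <= m <= n)%N & s ^+ 2 * m%:R <= psum (fun j w => wcoef P e n.+1 j w ^+ 2) m w] =
   [set w | exists2 m, (K ^ 2 <= m < n.+1)%N & s <= rms m (fun j => wcoef P e n.+1 j w)].
  apply/seteqP; split => w /= [m Km sm]; exists m => //; move: sm; rewrite le_rms//; try lra;
   by apply: leq_trans (_ : (K ^ 2 <= _)%N); rewrite ?expn_gt0 ?K0//; case/andP: Km.
by rewrite E.
Qed.

(** Markov's inequality for one sum dominating all averages: its mean is at most (D / sqrt n) times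
    16 n^(1/4), which tends to 0. *)
Lemma residual_small (dl eps : R) : 0 < dl -> 0 < eps -> \forall n \near \oo,
  pr P [set w | exists2 m, (0 < m < n)%N & dl <= rms m (fun j => remainder P e h b n j w)] <= eps.
Proof.
move=> dl0 eps0; have [D [N [D0 N0 hD]]] := Ex_remainder2 ie fe he lh pb.
have dl2 : 0 < dl ^+ 2 by rewrite exprn_gt0.
pose A := 16 * D / dl ^+ 2 / eps.
have A0 : 0 <= A by rewrite !divr_ge0// ?mulr_ge0// ltW.
near=> n.
have Nn : (N <= n)%N by near: n; exists N.
have n0 : (0 < n)%N by exact: leq_trans Nn.
have nR : 0 < n%:R :> R by rewrite ltr0n.
have mr j : measurable_fun setT (remainder P e h b n j) by have [] := bdm_remainder h b ie n j.
(* For j <= m one has 1/m <= 1/j, so this single weighted sum dominates the average of the squares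
   for every m < n. *)
pose F w := \sum_(1 <= j < n) j%:R^-1 * remainder P e h b n j w ^+ 2.
have lr j : L1 P (fun w => j%:R^-1 * remainder P e h b n j w ^+ 2).
  exact: L1Z (bdm_L1 P (bdmX 2 (bdm_remainder h b ie n j))).
have lF : L1 P F by apply: L1_sum.
have F0 w : 0 <= F w by apply: sumr_ge0 => j _; rewrite mulr_ge0// sqr_ge0.
apply: (@le_trans _ _ (pr P [set w | dl ^+ 2 <= F w])).
  apply: le_pr; first exact: (measurable_rms_event _ _ mr).
    by apply: measurable_set_bool; apply: measurable_fun_ler => //; exact: L1_measurable lF.
  move=> w /= [m /andP[m0 mn]] dm.
  have : dl ^+ 2 <= rms m (fun j => remainder P e h b n j w) ^+ 2.
    by rewrite ler_pXn2r// nnegrE ?rms_ge0// ltW.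
  move/le_trans; apply; rewrite rms_sqr /F (@big_cat_nat _ _ _ m.+1 1 n)//= -[leLHS]addr0.
  apply: lerD; last by apply: sumr_ge0 => j _; rewrite mulr_ge0// sqr_ge0.
  rewrite mulr_sumr [leLHS]big_nat_cond [leRHS]big_nat_cond; apply: ler_sum => j /andP[/andP[j0 jm] _].
  by apply: ler_wpM2r; [exact: sqr_ge0|rewrite lef_pV2 ?posrE ?ltr0n// ler_nat].
apply: (le_trans (markov_pr lF F0 dl2)).
rewrite ler_pdivrMr// Ex_sum; last by move=> j _; exact: lr.
set q := Num.sqrt (Num.sqrt n%:R) : R.
have q0 : 0 < q by rewrite !sqrtr_gt0.
have q2 : Num.sqrt n%:R = q ^+ 2 by rewrite sqr_sqrtr// sqrtr_ge0.
apply: (@le_trans _ _ (\sum_(1 <= j < n) j%:R^-1 * (D / q ^+ 2))).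
  apply: ler_sum => j _; rewrite ExZ; last exact: bdm_L1 (bdmX 2 (bdm_remainder h b ie n j)).
  by apply: ler_wpM2l; [rewrite invr_ge0|rewrite -q2; exact: hD].
rewrite -mulr_suml.
have h1 : 0 <= D / q ^+ 2 by rewrite divr_ge0// sqr_ge0.
apply: (le_trans (ler_wpM2r h1 (harmonic_le R n))); rewrite -/q.
have Aq : A <= q.
  have : (A ^+ 2) ^+ 2 <= n%:R by near: n; exact: nbhs_infty_ger.
  move=> /ler_wsqrtr; rewrite sqrtr_sqr ger0_norm ?sqr_ge0// => /ler_wsqrtr.
  by rewrite sqrtr_sqr ger0_norm.
rewrite (_ : 16 * q * (D / q ^+ 2) = 16 * D / q); last by field; rewrite gt_eqF.
rewrite ler_pdivrMr//; move: Aq; rewrite /A ler_pdivrMr// ler_pdivrMr//.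
by rewrite mulrC [q * _]mulrC mulrAC.
Unshelve. all: by end_near.
Qed.

Lemma drift_cvg j : drift h b n j @[n --> \oo] --> Num.sqrt 24 * h 0 * beta_coef b j.
Proof. by rewrite /drift; apply: cvgM; [exact: cvg_cst|exact: riemann_sum_cvg]. Qed.

(** Bessel's inequality applied to the values of [b] on the design, with 24 h(0)^2 n^-2 times n/2
    times n B^2. *)
Lemma drift_sum : exists2 C : R, 0 <= C & forall n m, (m < n)%N ->
  \sum_(1 <= j < m.+1) drift h b n j ^+ 2 <= C.
Proof.
have [B B0 bB] := piecewise_bounded pb.
exists (12 * h 0 ^+ 2 * B ^+ 2); first by apply: mulr_ge0; [apply: mulr_ge0|]; rewrite ?sqr_ge0 ?ler0n.
move=> n m mn; have n0 : (0 < n)%N by exact: leq_ltn_trans mn.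
have nR : 0 < n%:R :> R by rewrite ltr0n.
apply: (@le_trans _ _ (\sum_(1 <= j < n) drift h b n j ^+ 2)).
  rewrite [leRHS](@big_cat_nat _ _ _ m.+1)//= lerDl.
  by apply: sumr_ge0 => j _; exact: sqr_ge0.
rewrite /drift; under eq_bigr do rewrite mulrA exprMn.
rewrite -mulr_sumr.
apply: (le_trans (ler_wpM2l (sqr_ge0 _) (bessel (fun i => b (xpt n i)) n0))).
have bb : \sum_(i < n) b (xpt n i) ^+ 2 <= n%:R * B ^+ 2.
  apply: (@le_trans _ _ (\sum_(i < n) B ^+ 2)).
    apply: ler_sum => i _; rewrite -(real_normK (num_real _)) ler_pXn2r ?nnegrE//.
    by apply: bB; exact: xpt01.
  by rewrite sumr_const card_ord mulr_natl.
rewrite mulrA.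
have k0 : 0 <= (Num.sqrt 24 * h 0 * n%:R^-1) ^+ 2 * (n%:R / 2) :> R.
  by rewrite mulr_ge0 ?sqr_ge0// divr_ge0.
apply: (le_trans (ler_wpM2l k0 bb)).
rewrite !exprMn sqr_sqrtr//.
by rewrite le_eqVlt; apply/orP; left; apply/eqP; field; rewrite gt_eqF.
Qed.

(** For fixed m the finite sum converges term by term, so the limiting coefficients inherit the
    bound with the same constant. *)
Lemma limit_drift_sum : exists2 C : R, 0 <= C &
  (forall n m, (m < n)%N -> \sum_(1 <= j < m.+1) drift h b n j ^+ 2 <= C) /\
  (forall m, \sum_(1 <= j < m.+1) (Num.sqrt 24 * h 0 * beta_coef b j) ^+ 2 <= C).
Proof.
have [C C0 hC] := drift_sum; exists C => //; split => // m.
have cv : \sum_(1 <= j < m.+1) drift h b n j ^+ 2 @[n --> \oo] -->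
   \sum_(1 <= j < m.+1) (Num.sqrt 24 * h 0 * beta_coef b j) ^+ 2.
  elim: (index_iota 1 m.+1) => [|j r IH].
    by under eq_fun do rewrite big_nil; rewrite big_nil; exact: cvg_cst.
  rewrite big_cons expr2; under eq_fun do rewrite big_cons expr2.
  by apply: cvgD => //; apply: cvgM; exact: drift_cvg.
rewrite -(cvg_lim _ cv)//; apply: limr_le; first by apply/cvg_ex; eexists; exact: cv.
by exists m.+1 => // n /= mn; exact: hC.
Qed.

End rank_tails.

(** * Limit of the power *)

Section ramp.
Context {R : realType}.

(** A Lipschitz function between the indicators of x >= a + dl and x >= a, which brings the events
    within reach of convergence for Lipschitz functions. *)
Definition ramp (a dl x : R) : R := Num.min 1 (Num.max 0 ((x - a) / dl)).

Lemma ramp01 a dl x : 0 <= ramp a dl x <= 1.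
Proof. by rewrite /ramp ge_min lexx le_min ler01 le_max lexx. Qed.

Lemma ramp_le a dl x : 0 < dl -> ramp a dl x <= (a <= x)%R%:R.
Proof.
move=> dl0; case: (leP a x) => [_|xa]; first by case/andP: (ramp01 a dl x).
rewrite /ramp ge_min [X in _ || X](_ : _ = true) ?orbT//.
by rewrite ge_max lexx/= pmulr_lle0 ?invr_gt0//; lra.
Qed.

Lemma ramp_ge a dl x : 0 < dl -> (a + dl <= x)%R%:R <= ramp a dl x.
Proof.
move=> dl0; case: (leP (a + dl) x) => [h|_]; last by case/andP: (ramp01 a dl x).
by rewrite /ramp le_min lexx le_max ler_pdivlMr// mul1r; apply/orP; right; lra.
Qed.

Let clamp_lipschitz (u v : R) :
  `|Num.min 1 (Num.max 0 u) - Num.min 1 (Num.max 0 v)| <= `|u - v|.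
Proof.
have clampE (z : R) : [\/ z <= 0 /\ Num.min 1 (Num.max 0 z) = 0,
    0 <= z <= 1 /\ Num.min 1 (Num.max 0 z) = z | 1 <= z /\ Num.min 1 (Num.max 0 z) = 1].
  case/orP: (le_total z 0) => z0; first by apply: Or31; rewrite max_l// min_r// ler01.
  case/orP: (le_total z 1) => z1; first by apply: Or32; rewrite z0 z1 max_r// min_r.
  by apply: Or33; rewrite max_r// min_l.
have : - `|u - v| <= u - v <= `|u - v| by rewrite -ler_norml.
move: (`|u - v|) => N /andP[h1 h2].
by rewrite ler_norml; case: (clampE u) => -[uE ->]; case: (clampE v) => -[vE ->]; lra.
Qed.

Lemma ramp_lipschitz a dl x y : 0 < dl -> `|ramp a dl x - ramp a dl y| <= dl^-1 * `|x - y|.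
Proof.
move=> dl0; rewrite -[X in _ <= X * _]gtr0_norm ?invr_gt0// -normrM.
rewrite (_ : dl^-1 * (x - y) = (x - a) / dl - (y - a) / dl); last by ring.
exact: clamp_lipschitz.
Qed.

Lemma measurable_ramp a dl : measurable_fun setT (ramp a dl).
Proof.
apply: measurable_minr => //; apply: measurable_maxr => //.
by apply: measurable_funM => //; apply: measurable_funB.
Qed.

End ramp.

(** * Weak limit of the maximum over boundedly many averages *)

Section peak_limit.
Context d (T : measurableType d) (R : realType) (P : probability T R).
Variables (e : nat -> T -> R) (f : R -> R).
Hypothesis ie : mutually_independent P e.
Hypothesis fe : forall i, has_density P (e i) f.
Context d' (T' : measurableType d') (Q : probability T' R).
Variable Z : nat -> T' -> R.
Hypothesis iZ : mutually_independent Q Z.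
Hypothesis nZ : forall j, has_density Q (Z j) (normal_pdf 0 1).
Variables (c : nat -> R) (M : nat).

(** The replacement estimate with exact factors has error zero: the cosine factor is the Gaussian
    one, and the sine factor is a cosine of phase -pi/2, hence vanishes. *)
Lemma gauss_cf_sum (a : nat -> R) phi :
  Ex Q (fun w => cos (\sum_(j < M) a j * Z j.+1 w + phi)) =
  cos phi * expR (- (\sum_(j < M) a j ^+ 2 / 2)).
Proof.
pose g (j : nat) (z : R) := a j.-1 * z.
pose w (j : nat) := expR (- (a j.-1 ^+ 2 / 2)).
have mg i : measurable_fun setT (g i) by exact: measurable_funM.
have w01 i : 0 <= w i <= 1 by rewrite expR_ge0 -expR0 ler_expR oppr_le0 divr_ge0// sqr_ge0.
have := cf_indep_sum iZ phi mg w01 (iota_uniq 1 M).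
rewrite [leRHS]big1 ?normr_le0 ?subr_eq0.
  move=> /eqP; rewrite (_ : \prod_(i <- iota 1 M) w i = expR (- (\sum_(j < M) a j ^+ 2 / 2))); last first.
    rewrite -sumrN expR_sum (iotaDl 1 0 M) big_map -val_enum_ord big_map big_enum/=.
    by apply: eq_bigr.
  move=> <-; congr Ex; apply/funext => x.
  by rewrite (iotaDl 1 0 M) big_map -val_enum_ord big_map big_enum/=.
move=> i _; have mZ := iZ.1 i.
have -> : Ex Q (fun x => cos (g i (Z i x))) = w i.
  have := gauss_cf mZ (nZ i) 0 (a i.-1); rewrite cos0 mulr1 /w => <-.
  by congr Ex; apply/funext => x; rewrite addr0.
have -> : Ex Q (fun x => sin (g i (Z i x))) = 0.
  have := gauss_cf mZ (nZ i) (- (pi / 2)) (a i.-1); rewrite cosN cos_pihalf mulr0 => <-.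
  by congr Ex; apply/funext => x; rewrite cosBpihalf.
by rewrite subrr normr0 addr0.
Qed.

Lemma peak_cvg (a dl : R) : 0 < dl ->
  Ex P (fun w => ramp a dl (peak M (fun j => wcoef P e n j w + c j))) @[n --> \oo] -->
  Ex Q (fun w => ramp a dl (peak M (fun j => Z j w + c j))).
Proof.
move=> dl0.
(* Frequencies start at 1 while the weak convergence lemma numbers coordinates from 0, whence the
   predecessor; index 0 never enters the averages. *)
pose F (x : nat -> R) := ramp a dl (peak M (fun j => x j.-1 + c j)).
have eqF x : F (fun j => x j.+1) = ramp a dl (peak M (fun j => x j + c j)).
  rewrite /F /peak; congr ramp; rewrite big_nat_cond [RHS]big_nat_cond.
  apply: eq_bigr => m /andP[/andP[m0 _] _]; apply: eq_rms => -[|j]//.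
have mW n j : measurable_fun setT (wcoef P e n j) by have [] := bdm_wcoef ie n j.
have mZ j := iZ.1 j.
have bF d0 (U : measurableType d0) (X : nat -> U -> R) : (forall j, measurable_fun setT (X j)) ->
    bdm (fun w => F (fun j => X j.+1 w)).
  move=> mX; split; last first.
    by exists 1 => w; rewrite /F; have /andP[h1 h2] := ramp01 a dl (peak M (fun j => X j.-1.+1 w + c j)); rewrite ger0_norm.
  under eq_fun => w do rewrite (eqF (X ^~ w)).
  apply: (measurableT_comp (measurable_ramp a dl)).
  by apply: (measurable_peak (X := fun j w => X j w + c j)) => j; exact: measurable_funD.
rewrite (_ : (fun n => _) = (fun n => Ex P (fun w => F (fun j => wcoef P e n j.+1 w)))); last first.
  by apply/funext => n; congr Ex; apply/funext => w; rewrite (eqF (wcoef P e n ^~ w)).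
rewrite (_ : Ex Q _ = Ex Q (fun w => F (fun j => Z j.+1 w))); last first.
  by congr Ex; apply/funext => w; rewrite (eqF (Z ^~ w)).
apply: (@weak_cvg_lipschitz _ _ _ P _ _ Q (fun n j => wcoef P e n j.+1) (fun j => Z j.+1) M 2 _ _ _ _ _ F dl^-1).
- by move=> n j; exact: mW.
- by move=> j; exact: mZ.
- move=> n j _; split; first exact: bdm_L1 (bdmX 2 (bdm_wcoef ie n j.+1)).
  exact: Ex_wcoef2.
- move=> j _; split; first exact: L1_gauss_pow.
  by rewrite gauss_second_moment// ler1n.
- by move=> aa phi; rewrite gauss_cf_sum; exact: cf_wcoef_cvg.
- by rewrite invr_ge0 ltW.
- move=> x y; apply: (le_trans (ramp_lipschitz _ _ _ dl0)).
  apply: ler_wpM2l; first by rewrite invr_ge0 ltW.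
  apply: peak_sub => [j /andP[j0 jM]|]; last exact: sumr_ge0.
  have jM' : (j.-1 < M)%N by rewrite prednK.
  rewrite (_ : _ - _ = x j.-1 - y j.-1); last by ring.
  by rewrite (bigD1 (Ordinal jM'))//= lerDl; exact: sumr_ge0.
- by move=> n; exact: bF.
- exact: bF.
Qed.

Let mpW n (a : R) : measurable_fun setT (fun w => a <= peak M (fun j => wcoef P e n j w + c j)).
Proof.
apply: measurable_fun_ler => //.
apply: (measurable_peak (X := fun j w => wcoef P e n j w + c j)) => j.
by apply: measurable_funD => //; have [] := bdm_wcoef ie n j.
Qed.

Let mpZ (a : R) : measurable_fun setT (fun w => a <= peak M (fun j => Z j w + c j)).
Proof.
apply: measurable_fun_ler => //.
apply: (measurable_peak (X := fun j w => Z j w + c j)) => j.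
by apply: measurable_funD => //; exact: iZ.1.
Qed.

Let bW n a dl : bdm (fun w => ramp a dl (peak M (fun j => wcoef P e n j w + c j))).
Proof.
split; last first.
  by exists 1 => w; have /andP[h1 h2] := ramp01 a dl (peak M (fun j => wcoef P e n j w + c j)); rewrite ger0_norm.
apply: (measurableT_comp (measurable_ramp a dl)).
apply: (measurable_peak (X := fun j w => wcoef P e n j w + c j)) => j.
by apply: measurable_funD => //; have [] := bdm_wcoef ie n j.
Qed.

Let bZ a dl : bdm (fun w => ramp a dl (peak M (fun j => Z j w + c j))).
Proof.
split; last first.
  by exists 1 => w; have /andP[h1 h2] := ramp01 a dl (peak M (fun j => Z j w + c j)); rewrite ger0_norm.
apply: (measurableT_comp (measurable_ramp a dl)).
apply: (measurable_peak (X := fun j w => Z j w + c j)) => j.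
by apply: measurable_funD => //; exact: iZ.1.
Qed.

(** Probabilities are compared in both directions at the cost of [dl] in the level, as the ramp
    separates the two indicators. *)
Lemma peak_limit (a dl eps : R) : 0 < dl -> 0 < eps -> \forall n \near \oo,
  pr P [set w | a + dl <= peak M (fun j => wcoef P e n j w + c j)] <=
    pr Q [set w | a <= peak M (fun j => Z j w + c j)] + eps /\
  pr Q [set w | a + dl <= peak M (fun j => Z j w + c j)] <=
    pr P [set w | a <= peak M (fun j => wcoef P e n j w + c j)] + eps.
Proof.
move=> dl0 eps0; have /cvgrPdist_le/(_ _ eps0) := peak_cvg (a := a) dl0.
apply: filterS => n; rewrite ler_norml => /andP[h1 h2].
rewrite -!Ex_bool//.
have a1 := le_Ex (bdm_L1 P (bdm_bool R (mpW n (a + dl)))) (bdm_L1 P (bW n a dl)) (fun w => ramp_ge _ _ dl0).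
have a2 := le_Ex (bdm_L1 P (bW n a dl)) (bdm_L1 P (bdm_bool R (mpW n a))) (fun w => ramp_le _ _ dl0).
have a3 := le_Ex (bdm_L1 Q (bdm_bool R (mpZ (a + dl)))) (bdm_L1 Q (bZ a dl)) (fun w => ramp_ge _ _ dl0).
have a4 := le_Ex (bdm_L1 Q (bZ a dl)) (bdm_L1 Q (bdm_bool R (mpZ a))) (fun w => ramp_le _ _ dl0).
by split; lra.
Qed.

End peak_limit.

Section power.
Context d (T : measurableType d) (R : realType) (P : probability T R).
Variables (e : nat -> T -> R) (f h : R -> R) (b : R -> R).
Hypothesis ie : mutually_independent P e.
Hypothesis fe : forall i, has_density P (e i) f.
Hypothesis he : has_density P (fun w => (e 0%N w - e 1%N w)%R) h.
Hypothesis lh : lipschitz_near0 h.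
Hypothesis pb : piecewise_lipschitz01 b.
Context d' (T' : measurableType d') (Q : probability T' R).
Variable Z : nat -> T' -> R.
Hypothesis iZ : mutually_independent Q Z.
Hypothesis nZ : forall j, has_density Q (Z j) (normal_pdf 0 1).
Variable t : R.
Hypothesis t1 : 1 < t.

Let s : R := Num.sqrt t.
Let c (j : nat) : R := Num.sqrt 24 * h 0 * beta_coef b j.

Let s1 : 1 < s. Proof. by rewrite /s -[ltLHS]sqrtr1 ltr_sqrt// (lt_trans _ t1). Qed.
Let s0 : 0 < s. Proof. exact: lt_trans s1. Qed.
Let s2 : s ^+ 2 = t. Proof. by rewrite sqr_sqrtr// ltW// (lt_trans _ t1). Qed.

Let rfourier (n j : nat) (w : T) : R :=
  n%:R / n.+1%:R * (wcoef P e n j w + drift h b n j + remainder P e h b n j w).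

(** The comparison moves to square roots, where the terms of the decomposition add. As [t] is
    positive, the initial value 0 of the maximum cannot decide it. *)
Lemma le_Rstat n w : (t <= Rstat b e n w) <->
  exists2 m, (0 < m < n)%N & s <= n%:R / n.+1%:R *
    rms m (fun j => wcoef P e n j w + drift h b n j + remainder P e h b n j w).
Proof.
have t0 : 0 < t by exact: lt_trans t1.
have RE : Rstat b e n w = \big[Num.max/0]_(1 <= m < n) rms m (rfourier n ^~ w) ^+ 2.
  rewrite /Rstat big_nat_cond [RHS]big_nat_cond; apply: eq_bigr => m /andP[/andP[m0 mn] _].
  rewrite rms_sqr; congr (_ * _).
  rewrite big_nat_cond [RHS]big_nat_cond; apply: eq_bigr => j /andP[/andP[j0 jm] _].
  rewrite /rfourier -phihat_decomposition; last by rewrite j0 (leq_trans jm).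
  by rewrite [RHS]exprMn sqr_sqrtr// mulr_ge0.
have rE m : rms m (rfourier n ^~ w) = n%:R / n.+1%:R *
    rms m (fun j => wcoef P e n j w + drift h b n j + remainder P e h b n j w).
  by rewrite rmsZ ger0_norm// divr_ge0.
have sE m : (t <= rms m (rfourier n ^~ w) ^+ 2) = (s <= n%:R / n.+1%:R *
    rms m (fun j => wcoef P e n j w + drift h b n j + remainder P e h b n j w)).
  by rewrite -rE -s2 ler_pXn2r// nnegrE ?rms_ge0// ltW.
rewrite RE; split.
  move=> tR; apply: contrapT => nm; move: tR; apply/negP; rewrite -ltNge big_seq.
  elim/big_ind : _ => // [u v us vs|m]; first by rewrite gt_max us.
  by rewrite mem_index_iota => mn; rewrite ltNge sE; apply/negP => sm; apply: nm; exists m.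
move=> [m mn]; rewrite -sE => /le_trans; apply.
by apply: (le_bigmax_seq 0 m xpredT (fun m => rms m (rfourier n ^~ w) ^+ 2)) => //; rewrite mem_index_iota.
Qed.

Lemma measurable_Rstat_ge n : measurable [set w | t <= Rstat b e n w].
Proof.
pose X j w := wcoef P e n j w + drift h b n j + remainder P e h b n j w.
have mX j : measurable_fun setT (X j).
  have [mW _] := bdm_wcoef ie n j; have [mr _] := bdm_remainder h b ie n j.
  by apply: measurable_funD => //; exact: measurable_funD.
rewrite (_ : [set _ | _] = \bigcup_(m in [set m | (0 < m < n)%N]) [set w | s <= n%:R / n.+1%:R * rms m (X ^~ w)]).
  apply: bigcup_measurable => m _; apply: measurable_set_bool; apply: measurable_fun_ler => //.
  by apply: measurable_funM => //; exact: measurable_rms.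
by apply/seteqP; split => w /= => [/le_Rstat[m]|[m mn sm]]; [exists m|apply/le_Rstat; exists m].
Qed.

Lemma measurable_Tlim_ge : measurable [set w | (t%:E <= Tlim Z (h 0) b w)%E].
Proof.
pose F (m : nat) (w : T') := ((m%:R^-1 * \sum_(1 <= j < m.+1) (Z j w + c j) ^+ 2)%:E)%E.
have mF m : measurable_fun setT (F m).
  apply/measurable_EFinP; apply: measurable_funM => //; apply: measurable_sum => j.
  by apply: measurable_funX; apply: measurable_funD => //; exact: iZ.1.
rewrite (_ : [set _ | _] = setT `&` (fun w => esups (F ^~ w) 1%N) @^-1` `[t%:E, +oo[%classic).
  by apply: measurable_fun_esups => //; exact: emeasurable_itv.
by rewrite setTI; apply/seteqP; split => w /=; rewrite in_itv/= andbT.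
Qed.

Lemma Tlim_ge M w : s <= peak M (fun j => Z j w + c j) -> (t%:E <= Tlim Z (h 0) b w)%E.
Proof.
move/(le_peak _ _ s0) => [m /andP[m0 _] sm].
apply: (@le_trans _ _ (rms m (fun j => Z j w + c j) ^+ 2)%:E).
  by rewrite lee_fin -s2 ler_pXn2r// nnegrE ?rms_ge0// ltW.
by rewrite rms_sqr; apply: ereal_sup_ubound; exists m.
Qed.

(** A supremum over infinitely many m may equal [t] without being attained, so a uniform bound
    strictly below [s] is required. *)
Lemma Tlim_lt (v : R) w : 0 <= v < s -> (forall m, (0 < m)%N -> rms m (fun j => Z j w + c j) <= v) ->
  ~ (t%:E <= Tlim Z (h 0) b w)%E.
Proof.
move=> /andP[v0 vs] hv; apply/negP; rewrite -ltNge; apply: (@le_lt_trans _ _ (v ^+ 2)%:E).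
  apply: ge_ereal_sup => _ [m m0 <-]; rewrite lee_fin.
  have h2 : rms m (fun j => Z j w + c j) ^+ 2 <= v ^+ 2.
    by rewrite ler_pXn2r ?nnegrE ?rms_ge0// hv.
  by rewrite rms_sqr in h2.
by rewrite lte_fin -s2 ltr_pXn2r// nnegrE// ltW.
Qed.

Let mpZ M (a : R) : measurable [set w | a <= peak M (fun j => Z j w + c j)].
Proof.
apply: measurable_set_bool; apply: measurable_fun_ler => //.
apply: (measurable_peak (X := fun j w => Z j w + c j)) => j.
by apply: measurable_funD => //; exact: iZ.1.
Qed.

Let mpW M n (a : R) : measurable [set w | a <= peak M (fun j => wcoef P e n j w + c j)].
Proof.
apply: measurable_set_bool; apply: measurable_fun_ler => //.
apply: (measurable_peak (X := fun j w => wcoef P e n j w + c j)) => j.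
by apply: measurable_funD => //; have [] := bdm_wcoef ie n j.
Qed.

(** The event on which moving the level by [eta] may change the outcome for some m <= M. *)
Let near_s M (eta : R) := [set w | exists2 m, (0 < m <= M)%N & `|rms m (fun j => Z j w + c j) - s| <= eta].

Let measurable_near_s M eta : measurable (near_s M eta).
Proof.
rewrite (_ : near_s M eta = \bigcup_(m in [set m | (0 < m <= M)%N])
   [set w | `|rms m (fun j => Z j w + c j) - s| <= eta]).
  apply: bigcup_measurable => m _; apply: measurable_set_bool; apply: measurable_fun_ler => //.
  apply: measurableT_comp => //; apply: measurable_funB => //.
  apply: (measurable_rms (X := fun j w => Z j w + c j)) => j.
  by apply: measurable_funD => //; exact: iZ.1.
by apply/seteqP; split => w /= [m]; exists m.
Qed.

Lemma peak_concentration M (eps : R) : 0 < eps ->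
  exists2 eta, 0 < eta & pr Q (near_s M eta) <= eps.
Proof.
elim: M eps => [|M IH] eps e0.
  exists 1; rewrite ?ltr01// (_ : near_s 0 1 = set0); last first.
    by apply/seteqP; split => w // [m]; case: m.
  by rewrite /pr measure0 ltW.
have e2 : 0 < eps / 2 by rewrite divr_gt0.
have [eta1 eta10 h1] := IH _ e2.
have [eta2 eta20 h2] := rms_concentration iZ nZ c (ltn0Sn M) s0 e2.
exists (Num.min eta1 eta2); first by rewrite lt_min eta10.
have mS : measurable [set w | `|rms M.+1 (fun j => Z j w + c j) - s| <= eta2].
  apply: measurable_set_bool; apply: measurable_fun_ler => //.
  apply: measurableT_comp => //; apply: measurable_funB => //.
  apply: (measurable_rms (X := fun j w => Z j w + c j)) => j.
  by apply: measurable_funD => //; exact: iZ.1.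
apply: (@le_trans _ _ (pr Q (near_s M eta1 `|` [set w | `|rms M.+1 (fun j => Z j w + c j) - s| <= eta2]))).
  apply: le_pr => //; first exact: measurableU.
  move=> w [m /andP[m0]]; rewrite le_min leq_eqVlt => /orP[/eqP->|mM] /andP[h3 h4]; first by right.
  by left; exists m => //; rewrite m0.
by apply: (le_trans (pr_setU _ _ _)) => //; lra.
Qed.

(** [M] is a square K^2, with [K] large enough for both maximal inequalities and for the drift: C <=
    M d0^2 makes every average of squared drifts over more than M terms at most d0^2. *)
Lemma uniform_tail (r d0 eps C : R) : 1 < r -> 0 < d0 -> 0 < eps -> 0 <= C ->
  exists M : nat, [/\ C <= M%:R * d0 ^+ 2,
    forall n, pr P [set w | exists2 m, (M <= m < n)%N & r <= rms m (fun j => wcoef P e n j w)] <= eps &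
    pr Q [set w | exists2 m, (M <= m)%N & r <= rms m (Z ^~ w)] <= eps].
Proof.
move=> r1 d00 eps_gt0 C0.
have r21 : 0 < r ^+ 2 - 1 by rewrite subr_gt0 expr_gt1// ltW// (lt_trans _ r1).
pose K := (Num.truncn (6 / (r ^+ 2 - 1) + 32 * 864 / (r ^+ 2 - 1) ^+ 2 / eps + C / d0 ^+ 2)).+1.
have KR : 0 < K%:R :> R by rewrite ltr0n.
have p1 : 0 <= 6 / (r ^+ 2 - 1) by rewrite divr_ge0// ltW.
have p2 : 0 <= 32 * 864 / (r ^+ 2 - 1) ^+ 2 / eps.
  by apply: divr_ge0; [apply: divr_ge0|]; rewrite ?sqr_ge0 ?mulr_ge0 ?ler0n// ltW.
have p3 : 0 <= C / d0 ^+ 2 by rewrite divr_ge0// sqr_ge0.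
have KE : 6 / (r ^+ 2 - 1) + 32 * 864 / (r ^+ 2 - 1) ^+ 2 / eps + C / d0 ^+ 2 <= K%:R by exact/ltW/truncnS_gt.
have K1 : 6 / (r ^+ 2 - 1) <= K%:R by lra.
have K2 : 32 * 864 / (r ^+ 2 - 1) ^+ 2 / K%:R <= eps.
  have : 32 * 864 / (r ^+ 2 - 1) ^+ 2 / eps <= K%:R by lra.
  by rewrite ler_pdivrMr// => k2; rewrite ler_pdivrMr// [eps * _]mulrC.
exists (K ^ 2)%N; split.
- have K3 : C <= K%:R * d0 ^+ 2 by rewrite -ler_pdivrMr ?exprn_gt0//; lra.
  apply: (le_trans K3); apply: ler_wpM2r; first exact: sqr_ge0.
  by rewrite ler_nat -[leqLHS]expn1 leq_pexp2l.
- by move=> n; exact: le_trans (wcoef_tail ie fe n r1 K1) K2.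
- apply: (le_trans (gauss_tail iZ nZ r1 K1)).
  apply: le_trans K2; apply: ler_wpM2r; first by rewrite invr_ge0 ltW.
  apply: ler_wpM2r; first by rewrite invr_ge0 sqr_ge0.
  rewrite (_ : 64 = 32 * 2 :> R); last by rewrite -natrM.
  by apply: ler_wpM2l; rewrite ?ler0n// ler_nat.
Qed.

Lemma power_cvg : (fun n => fine (P [set w | t <= Rstat b e n w])) @ \oo -->
  fine (Q [set w | (t%:E <= Tlim Z (h 0) b w)%E]).
Proof.
apply/cvgrPdist_le => eps0 eps00.
pose eps := eps0 / 4; have eps_gt0 : 0 < eps by rewrite divr_gt0.
have [C C0 [dC cC]] := limit_drift_sum h pb.
(* Here r + d0 = s - d0. For m > M, averages of the noise below [r] and of the drift at most [d0]
   leave a margin [d0] below the level for the remainder. *)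
pose r : R := (1 + s) / 2; pose d0 : R := (s - 1) / 4.
have s1' := s1; have d00 : 0 < d0 by rewrite /d0; lra.
have r1 : 1 < r by rewrite /r; lra.
have [M [MC WM ZM]] := uniform_tail r1 d00 eps_gt0 C0.
have tail_rms (x : nat -> R) m : (M < m)%N -> \sum_(1 <= j < m.+1) x j ^+ 2 <= C -> rms m x <= d0.
  move=> Mm xC; have mR : 0 < m%:R :> R by rewrite ltr0n (leq_trans _ Mm).
  rewrite -(@ler_pXn2r _ 2) ?nnegrE ?rms_ge0 ?(ltW d00)// rms_sqr ler_pdivrMl//.
  apply: (le_trans xC); apply: (le_trans MC); apply: ler_wpM2r; first exact: sqr_ge0.
  by rewrite ler_nat ltnW.
clear MC.
have [eta eta0 heta] := @peak_concentration M eps eps_gt0.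
(* Of the total displacement 3 dl <= eta, one [dl] is spent on the ramp, one on drift and remainder
   together, half each, and one on the factor n/(n+1). *)
pose dl := Num.min d0 (eta / 3).
have dl0 : 0 < dl by rewrite lt_min d00 divr_gt0.
have dld0 : dl <= d0 by rewrite ge_min lexx.
have dleta : 3 * dl <= eta by rewrite mulrC -ler_pdivlMr// ge_min lexx orbT.
pose TQ := [set w | (t%:E <= Tlim Z (h 0) b w)%E].
pose B a := [set w | a <= peak M (fun j => Z j w + c j)].
have mTQ : measurable TQ by exact: measurable_Tlim_ge.
(* The limiting event is compared with truncated maxima at displaced levels: [near_s] absorbs the
   displacement, and the Gaussian tail absorbs the averages beyond M. *)
have sandwich : pr Q (B (s - 3 * dl)) <= pr Q TQ + eps /\ pr Q TQ <= pr Q (B (s + 3 * dl)) + eps + eps.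
  split.
  - apply: (@le_trans _ _ (pr Q (TQ `|` near_s M eta))).
      apply: le_pr; [exact: mpZ|exact: measurableU|].
      have s3 : 0 < s - 3 * dl by move: dld0; rewrite /d0; lra.
      move=> w /(le_peak _ _ s3) [m mM sm].
      have [ss|ss] := lerP s (rms m (fun j => Z j w + c j)).
        by left; apply: (@Tlim_ge M); apply/(le_peak _ _ s0); exists m.
      by right; exists m => //; rewrite ler_norml; lra.
    by apply: (le_trans (pr_setU _ _ _)) => //; lra.
  - pose E := [set w | exists2 m, (M <= m)%N & r <= rms m (Z ^~ w)].
    have mE : measurable E by apply: (measurable_rms_event _ [set m | (M <= m)%N] iZ.1).
    have pE : pr Q E <= eps by [].
    have mB : measurable (B (s + 3 * dl)) by exact: mpZ.
    have mN := measurable_near_s M eta.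
    apply: (@le_trans _ _ (pr Q ((B (s + 3 * dl) `|` near_s M eta) `|` E))).
      apply: le_pr => //; first by apply: measurableU => //; exact: measurableU.
      move=> w tw; apply: contrapT => nw; move: tw.
      have nE m : (M <= m)%N -> rms m (Z ^~ w) < r.
        by move=> Mm; rewrite ltNge; apply/negP => rm; apply: nw; right; exists m.
      have nB m : (0 < m <= M)%N -> rms m (fun j => Z j w + c j) < s.
        move=> mM; rewrite ltNge; apply/negP => sm; apply: nw; left.
        have [h1|h1] := lerP (s + 3 * dl) (rms m (fun j => Z j w + c j)).
          by left; apply/le_peak; [lra|exists m].
        by right; exists m => //; rewrite ler_norml; lra.
      (* A uniform bound below [s]: the maximum over m <= M is a finite maximum of values below [s],
         and all later averages are at most r + d0. *)
      pose v := Num.max (peak M (fun j => Z j w + c j)) (r + d0).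
      apply: (@Tlim_lt v).
        rewrite le_max peak_ge0/= gt_max; apply/andP; split; last by rewrite /r /d0; lra.
        by rewrite ltNge; apply/negP => /(le_peak _ _ s0) [m /nB]; rewrite ltNge => /negP.
      move=> m m0; rewrite le_max; have [mM|Mm] := leqP m M.
        apply/orP; left.
        by apply: (le_bigmax_seq 0 m xpredT (fun m => rms m (fun j => Z j w + c j))) => //;
          rewrite mem_index_iota m0.
      apply/orP; right; apply: (le_trans (rms_triangle _ _ _)); apply: lerD; first exact/ltW/nE/ltnW.
      by apply: tail_rms => //; exact: cC.
    have u1 := pr_setU Q (measurableU _ _ mB mN) mE; have u2 := pr_setU Q mB mN.
    by lra.
have dl2 : 0 < dl / 2 by rewrite divr_gt0.
have cd : \forall n \near \oo, forall j, (j <= M)%N -> `|drift h b n j - c j| <= dl / 2.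
  elim: M {tail_rms heta B sandwich WM ZM} => [|M' IH].
    have /cvgrPdist_le/(_ _ dl2) := drift_cvg (h := h) (j := 0%N) pb; apply: filterS => n hn j.
    by rewrite leqn0 => /eqP ->; rewrite distrC.
  have /cvgrPdist_le/(_ _ dl2) := drift_cvg (h := h) (j := M'.+1) pb.
  move: IH; apply: filterS2 => n h1 h2 j; rewrite leq_eqVlt => /orP[/eqP ->|]; last exact: h1.
  by rewrite distrC.
have ev : \forall n \near \oo, [/\ (M < n)%N, s <= n%:R / n.+1%:R * (s + dl),
    forall j, (j <= M)%N -> `|drift h b n j - c j| <= dl / 2,
    pr P [set w | exists2 m, (0 < m < n)%N & dl / 2 <= rms m (fun j => remainder P e h b n j w)] <= eps &
    pr P [set w | s - 2 * dl <= peak M (fun j => wcoef P e n j w + c j)] <= pr Q (B (s - 3 * dl)) + eps /\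
    pr Q (B (s + 3 * dl)) <= pr P [set w | s + 2 * dl <= peak M (fun j => wcoef P e n j w + c j)] + eps].
  near=> n; split.
  - by near: n; exists M.+1.
  - rewrite mulrAC ler_pdivlMr ?ltr0n// -natr1 mulrDr mulrDr mulr1 mulrC lerD2l -ler_pdivrMr//.
    by near: n; exact: nbhs_infty_ger.
  - by near: n.
  - by near: n; exact: (residual_small ie fe he lh pb dl2 eps_gt0).
  - rewrite (_ : s - 2 * dl = s - 3 * dl + dl); last by ring.
    rewrite (_ : s + 3 * dl = s + 2 * dl + dl); last by ring.
    near: n; move: (peak_limit ie fe iZ nZ c M (s + 2 * dl) dl0 eps_gt0).
    move: (peak_limit ie fe iZ nZ c M (s - 3 * dl) dl0 eps_gt0).
    by apply: filterS2 => n [? _] [_ ?].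
move: ev; apply: filterS => n [nM lam cdn pE PQ].
have lam1 : n%:R / n.+1%:R <= 1 :> R by rewrite ler_pdivrMr ?ltr0n// mul1r ler_nat.
have lam0 : 0 <= n%:R / n.+1%:R :> R by rewrite divr_ge0.
set E := [set w | _] in pE.
have mE : measurable E.
  apply: (measurable_rms_event _ [set m | (0 < m < n)%N]) => j.
  by have [] := bdm_remainder h b ie n j.
have mR := measurable_Rstat_ge n.
(* Rejection forces a large remainder, a large noise average beyond M, or a truncated maximum above
   s - 2 dl. Two further errors, from weak convergence and from the sandwich, complete the 4 eps. *)
have PR : pr P [set w | t <= Rstat b e n w] <= pr Q TQ + 4 * eps.
  pose A := [set w | s - 2 * dl <= peak M (fun j => wcoef P e n j w + c j)].
  pose D := [set w | exists2 m, (M <= m < n)%N & r <= rms m (fun j => wcoef P e n j w)].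
  have mA : measurable A by exact: mpW.
  have mD : measurable D.
    apply: (measurable_rms_event _ [set m | (M <= m < n)%N]) => j.
    by have [] := bdm_wcoef ie n j.
  have pD : pr P D <= eps by exact: WM.
  apply: (@le_trans _ _ (pr P ((A `|` D) `|` E))); last first.
    have := pr_setU P (measurableU _ _ mA mD) mE; have := pr_setU P mA mD.
    by have [up _] := sandwich; have [PL _] := PQ; rewrite -/A in PL; lra.
  apply: le_pr => //; first by apply: measurableU => //; exact: measurableU.
  move=> w /le_Rstat [m /andP[m0 mn] sm].
  have [rm|rm] := lerP (dl / 2) (rms m (fun j => remainder P e h b n j w)).
    by right; exists m => //; rewrite m0.
  have h1 : s <= rms m (fun j => wcoef P e n j w + drift h b n j + remainder P e h b n j w).
    by apply: (le_trans sm); rewrite -[leRHS]mul1r; apply: ler_wpM2r => //; exact: rms_ge0.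
  have h2 := rms_triangle m (fun j => wcoef P e n j w + drift h b n j) (fun j => remainder P e h b n j w).
  left; have [mM|Mm] := leqP m M.
    left; apply/le_peak; first by move: dld0; rewrite /d0; lra.
    exists m; first by rewrite m0.
    have h3 := rms_sub m (fun j => wcoef P e n j w + drift h b n j) (fun j => wcoef P e n j w + c j).
    have h4 : rms m (fun j => wcoef P e n j w + drift h b n j - (wcoef P e n j w + c j)) <= dl / 2.
      apply: rms_le => [|j /andP[j0 jm]]; first exact: ltW.
      by rewrite (_ : _ - _ = drift h b n j - c j) ?cdn ?(leq_trans jm)//; ring.
    lra.
  right; exists m; first by rewrite (ltnW Mm).
  have h3 := rms_triangle m (fun j => wcoef P e n j w) (fun j => drift h b n j).
  have h4 : rms m (fun j => drift h b n j) <= d0 by apply: tail_rms => //; exact: dC.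
  by move: dld0; rewrite /r /d0 in h4 *; lra.
(* Only m <= M are needed here: a truncated maximum above s + 2 dl loses at most [dl] to drift and
   remainder, and s + dl times n/(n+1) is still at least [s]. *)
have QT : pr Q TQ <= pr P [set w | t <= Rstat b e n w] + 4 * eps.
  pose A := [set w | s + 2 * dl <= peak M (fun j => wcoef P e n j w + c j)].
  have mA : measurable A by exact: mpW.
  have : pr P A <= pr P ([set w | t <= Rstat b e n w] `|` E).
    apply: le_pr => //; first exact: measurableU.
    have s2dl : 0 < s + 2 * dl by lra.
    move=> w /(le_peak _ _ s2dl) [m /andP[m0 mM] sm].
    have [rm|rm] := lerP (dl / 2) (rms m (fun j => remainder P e h b n j w)).
      by right; exists m => //; rewrite m0 (leq_ltn_trans mM).
    left; apply/le_Rstat; exists m; first by rewrite m0 (leq_ltn_trans mM).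
    apply: (le_trans lam); apply: ler_wpM2l => //.
    have h3 := rms_sub m (fun j => wcoef P e n j w + c j)
      (fun j => wcoef P e n j w + drift h b n j + remainder P e h b n j w).
    have h4 : rms m (fun j => wcoef P e n j w + c j - (wcoef P e n j w + drift h b n j + remainder P e h b n j w))
        <= rms m (fun j => c j - drift h b n j) + rms m (fun j => -1 * remainder P e h b n j w).
      apply: le_trans (rms_triangle _ _ _); rewrite le_eqVlt; apply/orP; left; apply/eqP.
      by apply: eq_rms => j _; ring.
    rewrite rmsZ normrN1 mul1r in h4.
    have h5 : rms m (fun j => c j - drift h b n j) <= dl / 2.
      apply: rms_le => [|j /andP[j0 jm]]; first exact: ltW.
      by rewrite distrC cdn// (leq_trans jm).
    lra.
  have [_ lo] := sandwich; have [_ QL] := PQ; rewrite -/A in QL.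
  by have := pr_setU P mR mE; lra.
rewrite -/(pr Q TQ) -/(pr P _) ler_norml; move: PR QT; rewrite /eps; lra.
Unshelve. all: by end_near.
Qed.

End power.

Theorem theorem2p2 (R : realType)
  (d : measure_display) (Omega : measurableType d) (P : probability Omega R)
  (eps : nat -> Omega -> R) (f h : R -> R) (b : R -> R)
  (d' : measure_display) (Omega' : measurableType d') (Q : probability Omega' R)
  (Z : nat -> Omega' -> R) (alpha : R) :
  mutually_independent P eps ->
  (forall i, has_density P (eps i) f) ->
  has_density P (fun w => (eps 0%N w - eps 1%N w)%R) h ->
  lipschitz_near0 h ->
  piecewise_lipschitz01 b ->
  (0 < \int[lebesgue_measure]_(x in `[0%R, 1%R]) ((b x) ^+ 2)%:E)%E ->
  mutually_independent Q Z ->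
  (forall j, has_density Q (Z j) (normal_pdf 0%R 1%R)) ->
  0 < alpha < 1 ->
  (fun n => fine (P [set w | quantileG Q Z alpha <= Rstat b eps n w]))
    @ \oo --> fine (Q [set w | ((quantileG Q Z alpha)%:E <= Tlim Z (h 0%R) b w)%E]).
Proof.
move=> ie fe he lh pb _ iZ nZ a01.
exact: (power_cvg ie fe he lh pb iZ nZ (quantile_gt1 iZ nZ a01)).
Qed.
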